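(* For every $f\in M^{\infty,1}(\mathbb{R}^d)$ and $g,\gamma\in\mathcal{S}(\mathbb{R}^d)$ such that $\langle g,\gamma\rangle\ne0$, we have the representation formula $$f(t)=\frac1{\langle\gamma,g\rangle}\int_{\mathbb{R}^{2d}}V_g\hat f(x,\xi)\,\overline{V_\gamma\psi_{-t}(x,\xi)}\,dx\,d\xi=\frac1{\langle\gamma,g\rangle}\int_{\mathbb{R}^{2d}}V_g\hat f(x,\xi)\,\mathcal{V}_\gamma\psi_t(x,\xi)\,dx\,d\xi,\qquad t\in\mathbb{R}^d,$$ where $\psi_\omega(y)=(2\pi\hbar)^{-d/2}e^{\frac i\hbar\omega\cdot y}$ for $\omega,y\in\mathbb{R}^d$.
   Context: Fix $\hbar\in(0,1]$ and $d\ge1$. $\langle f,g\rangle=\int_{\mathbb{R}^d} f\overline g\,dy$, extended to $f\in\mathcal{S}'$, $g\in\mathcal{S}$ by $\langle f,g\rangle=f(\overline g)$. The Fourier transform is $\hat f(\xi)=(2\pi\hbar)^{-d/2}\int e^{-\frac i\hbar\xi\cdot x}f(x)\,dx$, extended to $\mathcal{S}'(\mathbb{R}^d)$. For $g\in\mathcal{S}(\mathbb{R}^d)$, $f\in\mathcal{S}'(\mathbb{R}^d)$: $V_gf(x,\xi)=\langle f,\pi(x,\xi)g\rangle$ with $\pi(x,\xi)g(y)=(2\pi\hbar)^{-d/2}e^{\frac i\hbar\xi\cdot y}g(y-x)$, and $\mathcal{V}_gf(x,\xi)=\overline{V_g\overline f(x,\xi)}$. $M^{\infty,1}(\mathbb{R}^d)$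 is the space of $f\in\mathcal{S}'(\mathbb{R}^d)$ with $\int_{\mathbb{R}^d}\sup_x|V_gf(x,\xi)|\,d\xi<\infty$ for some (equivalently every) $g\in\mathcal{S}(\mathbb{R}^d)\setminus\{0\}$; its elements are identified with bounded continuous functions. *)

(* Defs.v *)
From HB Require Import structures.
From mathcomp Require Import all_boot all_order all_algebra complex.
From mathcomp Require Import all_classical all_reals all_analysis.

Set Implicit Arguments.
Unset Strict Implicit.
Unset Printing Implicit Defensive.

Import Order.TTheory GRing.Theory Num.Theory.
Import numFieldNormedType.Exports.
Import ComplexField.

Local Open Scope classical_set_scope.
Local Open Scope ring_scope.

Definition rV_display : measure_display.
Proof. exact: default_measure_display. Qed.

(* The sigma-algebra on R^n generated by the coordinates is the Borel one. *)
Section measurable_rV.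
Context {R : realType} (n : nat).

Definition rV_coord (i : 'I_n) (v : 'rV[R]_n) : measurableTypeR R := v ord0 i.

Let rV_set0 : g_sigma_preimage rV_coord set0.
Proof. exact: sigma_algebra0. Qed.

Let rV_setC A : g_sigma_preimage rV_coord A -> g_sigma_preimage rV_coord (~` A).
Proof. exact: sigma_algebraC. Qed.

Let rV_bigcup (F : _^nat) : (forall i, g_sigma_preimage rV_coord (F i)) ->
  g_sigma_preimage rV_coord (\bigcup_i (F i)).
Proof. exact: sigma_algebra_bigcup. Qed.

HB.instance Definition _ := @isMeasurable.Build rV_display 'rV[R]_n
  (g_sigma_preimage rV_coord) rV_set0 rV_setC rV_bigcup.

Lemma measurable_rV_coord (i : 'I_n) : measurable_fun setT (rV_coord i).
Proof.
move=> _ Y mY; rewrite setTI; apply: sub_sigma_algebra => /=.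
rewrite -bigcup_seq/=; exists i => /=; first by rewrite mem_index_enum.
by exists Y => //; rewrite setTI.
Qed.

Lemma measurable_fun_rV d (T : measurableType d) (f : T -> 'rV[R]_n) :
  (forall i, measurable_fun setT (rV_coord i \o f)) -> measurable_fun setT f.
Proof.
move=> mf; apply: measurability; first by [].
move=> _ [A bigA <-]; move: bigA; rewrite -bigcup_seq => -[i _ [B mB <-]].
by have := mf i measurableT B mB; rewrite !setTI.
Qed.

End measurable_rV.

Section rV_cons.
Context {R : realType} (n : nat).

Definition rV_cons (p : measurableTypeR R * 'rV[R]_n) : 'rV[R]_n.+1 :=
  row_mx (const_mx p.1 : 'rV[R]_1) p.2.

Lemma measurable_rV_cons : measurable_fun setT rV_cons.
Proof.
apply: measurable_fun_rV => i; case: (@split_ordP 1 n i) => [j ->|k ->].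
  rewrite (_ : _ \o _ = fst)//; apply/funext => -[x v] /=.
  by rewrite /rV_coord /rV_cons /= [LHS]row_mxEl mxE.
rewrite (_ : _ \o _ = rV_coord k \o snd).
  by apply: measurableT_comp => //; exact: measurable_rV_coord.
by apply/funext => -[x v] /=; rewrite /rV_coord /rV_cons /= [LHS]row_mxEr.
Qed.

Definition rV_uncons (v : 'rV[R]_n.+1) : measurableTypeR R * 'rV[R]_n :=
  (v ord0 ord0, @rsubmx R 1 1 n v).

Lemma measurable_rV_uncons : measurable_fun setT rV_uncons.
Proof.
apply/measurable_fun_pairP; split; first exact: (measurable_rV_coord ord0).
apply: measurable_fun_rV => i.
rewrite (_ : _ \o _ = @rV_coord R n.+1 (rshift 1 i)).
  exact: measurable_rV_coord.
by apply/funext => v; rewrite /rV_coord /= mxE.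
Qed.

Lemma rV_consK : cancel rV_cons rV_uncons.
Proof.
move=> [x v]; rewrite /rV_uncons /rV_cons /= row_mxKr; congr pair.
by rewrite (_ : ord0 = lshift n (ord0 : 'I_1)) ?[LHS]row_mxEl ?mxE//; exact: val_inj.
Qed.

End rV_cons.

Section lebesgue_rV_cons.
Context {R : realType} (n : nat).
Variable mu : {sigma_finite_measure set 'rV[R]_n -> \bar R}.
Local Open Scope ereal_scope.

Definition lebesgue_rV_cons : set 'rV[R]_n.+1 -> \bar R :=
  pushforward (@lebesgue_measure R \x mu) (@rV_cons R n).

Let cons0 : lebesgue_rV_cons set0 = 0.
Proof. by rewrite /lebesgue_rV_cons /pushforward preimage_set0 measure0. Qed.

Let cons_ge0 A : 0 <= lebesgue_rV_cons A.
Proof. rewrite /lebesgue_rV_cons /pushforward; exact: measure_ge0. Qed.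

Let cons_sigma_additive : semi_sigma_additive lebesgue_rV_cons.
Proof.
pose m := measure_function_pushforward__canonical__measure_function_Measure
  (@lebesgue_measure R \x mu) (@measurable_rV_cons R n).
exact: (@measure_semi_sigma_additive _ _ _ m).
Qed.

HB.instance Definition _ := isMeasure.Build _ _ _ lebesgue_rV_cons
  cons0 cons_ge0 cons_sigma_additive.

Let cons_sigma_finite : sigma_finite setT lebesgue_rV_cons.
Proof.
have [F TF Foo] : sigma_finite setT (@lebesgue_measure R \x mu).
  have /sigma_finiteP[F [TF ndF Foo]] := sigma_finiteT (@lebesgue_measure R).
  have /sigma_finiteP[G [TG ndG Goo]] := sigma_finiteT mu.
  exists (fun k => F k `*` G k).
    rewrite -setXTT TF TG predeqE => -[x y]; split.
      move=> [/= [k _ Fkx] [l _ Gly]]; exists (maxn k l) => //; split.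
      - by move: x Fkx; exact/subsetPset/ndF/leq_maxl.
      - by move: y Gly; exact/subsetPset/ndG/leq_maxr.
    by move=> [k _ []/= ? ?]; split; exists k.
  move=> k; have [? ?] := Foo k; have [? ?] := Goo k.
  split; first exact: measurableX.
  by rewrite product_measure1E// lte_mul_pinfty// ge0_fin_numE.
exists (fun k => @rV_uncons R n @^-1` (F k)).
  by rewrite -preimage_bigcup -TF preimage_setT.
move=> k; have [mF Fk] := Foo k; split.
  by rewrite -[X in measurable X]setTI; exact: measurable_rV_uncons.
rewrite /lebesgue_rV_cons /pushforward -comp_preimage.
by rewrite (_ : _ \o _ = id) ?preimage_id//; apply/funext; exact: rV_consK.
Qed.

HB.instance Definition _ := Measure_isSigmaFinite.Build _ _ _ lebesgue_rV_cons
  cons_sigma_finite.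

End lebesgue_rV_cons.

(* Lebesgue measure on R^n, as the n-fold product of the one on R; on R^0 it is
   the unit mass. *)
Fixpoint lebesgue_rV {R : realType} (n : nat) :
    {sigma_finite_measure set 'rV[R]_n -> \bar R} :=
  match n with
  | 0%N => \d_(0 : 'rV[R]_0)
  | m.+1 => lebesgue_rV_cons (@lebesgue_rV R m)
  end.

Local Open Scope complex_scope.

Section complex_integral.
Context d (T : measurableType d) (R : realType).
Variable mu : {measure set T -> \bar R}.

Definition cintegrable (f : T -> R[i]) : Prop :=
  mu.-integrable setT (EFin \o (fun x => complex.Re (f x))) /\
  mu.-integrable setT (EFin \o (fun x => complex.Im (f x))).

Definition cintegral (f : T -> R[i]) : R[i] :=
  (\int[mu]_x complex.Re (f x)) +i* (\int[mu]_x complex.Im (f x)).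

End complex_integral.

(* C-valued functions on R^d; continuity and differentiation are componentwise,
   real and imaginary part separately. *)
Section schwartz.
Context {R : realType} {d : nat}.
Local Notation V := 'rV[R]_d.
Implicit Types (f g phi psi : V -> R[i]) (u : (V -> R[i]) -> R[i]).

Definition ccontinuous f : Prop :=
  continuous (fun x => complex.Re (f x)) /\
  continuous (fun x => complex.Im (f x)).

Definition basis_vec (i : 'I_d) : V := delta_mx ord0 i.

Definition cderivable f (x : V) (i : 'I_d) : Prop :=
  derivable (fun y => complex.Re (f y)) x (basis_vec i) /\
  derivable (fun y => complex.Im (f y)) x (basis_vec i).

Definition cpartial (i : 'I_d) f : V -> R[i] := fun x =>
  ('D_(basis_vec i) (fun y => complex.Re (f y)) x) +i*
  ('D_(basis_vec i) (fun y => complex.Im (f y)) x).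

(* A multi-index is encoded as a word [:: i1; ...; ik] of coordinates: it
   stands for the derivative d_i1 ... d_ik and for the monomial
   x_i1 * ... * x_ik, and its order is its length k. *)
Definition cpartials (s : seq 'I_d) f : V -> R[i] := foldr cpartial f s.

Definition monomial (r : seq 'I_d) (x : V) : R := \prod_(i <- r) x ord0 i.

Definition smooth f : Prop := forall s : seq 'I_d,
  ccontinuous (cpartials s f) /\ forall x i, cderivable (cpartials s f) x i.

Definition schwartz_norm (N : nat) f : \bar R :=
  ereal_sup [set y : \bar R | exists (r s : seq 'I_d) (x : V),
    [/\ (size r <= N)%N, (size s <= N)%N &
        y = (Normc.normc ((monomial r x)%:C * cpartials s f x))%:E]].

(* S(R^d) *)
Definition schwartz f : Prop :=
  smooth f /\ forall N, (schwartz_norm N f < +oo)%E.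

(* S'(R^d).  A tempered distribution is represented by a map u on all
   functions R^d -> C of which only the values on S(R^d) are relevant: they
   are constrained here and are the only ones used below. *)
Definition tempered u : Prop :=
  (forall (a : R[i]) phi psi, schwartz phi -> schwartz psi ->
     u (fun x => a * phi x + psi x) = a * u phi + u psi) /\
  (exists (N : nat) (C : R), forall phi, schwartz phi ->
     ((Normc.normc (u phi))%:E <= C%:E * schwartz_norm N phi)%E).

(* the distribution associated with a function *)
Definition distr f : (V -> R[i]) -> R[i] :=
  fun phi => cintegral (lebesgue_rV d) (fun y => f y * phi y).

Definition distr_conj u : (V -> R[i]) -> R[i] :=
  fun phi => conjc (u (fun y => conjc (phi y))).

(* the sesquilinear brackets <f, g>, on functions and on S' x S *)
Definition inner f g : R[i] :=
  cintegral (lebesgue_rV d) (fun y => f y * conjc (g y)).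

Definition pairing u g : R[i] := u (fun y => conjc (g y)).

(* the identification of a distribution u with a bounded continuous function *)
Definition identified_with u f : Prop :=
  [/\ ccontinuous f,
      exists M : R, forall x, Normc.normc (f x) <= M &
      forall phi, schwartz phi -> u phi = distr f phi].

End schwartz.

Section time_frequency.
Context {R : realType} {d : nat}.
Variable hbar : R.
Local Notation V := 'rV[R]_d.
Implicit Types (f g gamma : V -> R[i]) (u : (V -> R[i]) -> R[i]).

Definition dot (x y : V) : R := \sum_i x ord0 i * y ord0 i.

Definition expi (a : R) : R[i] := cos a +i* sin a.

(* (2 pi hbar)^(-d/2) *)
Definition normalization : R[i] := ((2 * pi * hbar) `^ (- (d%:R / 2)))%:C.

Definition fourier f : V -> R[i] := fun xi => normalization *
  cintegral (lebesgue_rV d) (fun x => expi (- (dot xi x / hbar)) * f x).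

(* the Fourier transform on S', by duality *)
Definition fourier_distr u : (V -> R[i]) -> R[i] := fun phi => u (fourier phi).

Definition tf_shift (x xi : V) g : V -> R[i] :=
  fun y => normalization * expi (dot xi y / hbar) * g (y - x).

(* V_g u (x, xi) *)
Definition stft g u (x xi : V) : R[i] := pairing u (tf_shift x xi g).

(* calligraphic V_g u (x, xi) *)
Definition stft_conj g u (x xi : V) : R[i] := conjc (stft g (distr_conj u) x xi).

(* psi_omega *)
Definition plane_wave (omega : V) : V -> R[i] :=
  fun y => normalization * expi (dot omega y / hbar).

(* M^{oo,1}(R^d) *)
Definition modulation_oo1 u : Prop :=
  tempered u /\
  exists g, [/\ schwartz g, (exists y, g y != 0) &
    (\int[lebesgue_rV d]_xi
       ereal_sup [set (Normc.normc (stft g u x xi))%:E | x in setT]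
     < +oo)%E].

End time_frequency.

Arguments normalization {R} d hbar.

(* Main.v *)
(** Write [G] and [D] for the Fourier transforms of the conjugates of [g] and [gamma],
and identify [u] with the bounded continuous function [f].  Then [V_g u^ (x, xi)] is the
Fourier transform at [x] of [h_xi := f (. - xi) * G], while [V_gamma psi_(-t) (x, xi)] is,
up to the normalization, [expi (- (t + xi) . x / hbar) * D (t + xi)].  Integrating in [x]
first, Fourier inversion for [h_xi] at the point [t + xi] gives [f t * G (t + xi) * conj (D
(t + xi))], and Parseval's formula turns the integral over [xi] into [f t * <gamma, g>].

Inversion and Fubini need [∫ |fourier h_xi| <= M] uniformly in [xi].  The hypothesis
bounds [∫ |fourier (f * conj (g0 (. - x)))|] uniformly in [x] for one window [g0] only; the
window is changed by averaging over [x], the kernel being rapidly decreasing in both of its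
variables.  Tonelli's theorem then suffices, and the supremum over [x] in the definition of
[M^(oo,1)] need not be measurable. *)

Require Import Defs.
From HB Require Import structures.
From mathcomp Require Import all_boot all_order all_algebra complex.
From mathcomp Require Import all_classical all_reals all_analysis.
From mathcomp Require Import measurable_realfun.
From mathcomp Require Import ring lra.

Set Implicit Arguments.
Unset Strict Implicit.
Unset Printing Implicit Defensive.

Import Order.TTheory GRing.Theory Num.Theory.
Import numFieldNormedType.Exports.

Local Open Scope classical_set_scope.
Local Open Scope ring_scope.
Local Open Scope complex_scope.

Local Notation Re := complex.Re.
Local Notation Im := complex.Im.
Local Notation normc := Normc.normc.

(** * Complex-valued integrals *)

Section complex_numbers.
Context {R : realType}.
Implicit Types (z w : R[i]) (a b : R).

(** Multiplication by a Schwartz function does not smooth [f], which is only bounded and continuous: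
    the products [f (. - xi) * G] are integrable, but nothing elementary makes their Fourier
    transforms integrable. This is exactly what membership in M^(oo,1) provides, and it is why
    inversion is proved for bounded continuous integrable functions with integrable transform rather
    than for Schwartz functions alone. The change of window is uniform in [xi] because the window
    centred at [x] contributes a constant that decays in [x + xi], and the integral over [x] of such
    a weight is invariant under translation. The damping factor in the inversion theorem is exp (- e
    |xi|_1), with the l^1 norm, and not a Gaussian: it factors over the coordinates, like the
    Lebesgue measure built as an iterated product; the integrals that give its transform have
    elementary antiderivatives; and the mass of the resulting kernel reduces to the integral of 1 /
    (1 + x^2). *)

Lemma complexP z w : Re z = Re w -> Im z = Im w -> z = w.
Proof. by case: z w => [a b] [c d] /= -> ->. Qed.

Lemma ReD z w : Re (z + w) = Re z + Re w. Proof. by case: z w => ? ? []. Qed.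
Lemma ImD z w : Im (z + w) = Im z + Im w. Proof. by case: z w => ? ? []. Qed.
Lemma ReN z : Re (- z) = - Re z. Proof. by case: z. Qed.
Lemma ImN z : Im (- z) = - Im z. Proof. by case: z. Qed.
Lemma Re_mulc z w : Re (z * w) = Re z * Re w - Im z * Im w.
Proof. by case: z w => ? ? []. Qed.
Lemma Im_mulc z w : Im (z * w) = Re z * Im w + Im z * Re w.
Proof. by case: z w => ? ? []. Qed.
Lemma Re_conjc z : Re (conjc z) = Re z. Proof. by case: z. Qed.
Lemma Im_conjc z : Im (conjc z) = - Im z. Proof. by case: z. Qed.

Definition ReImE := (ReD, ImD, ReN, ImN, Re_mulc, Im_mulc, Re_conjc, Im_conjc).

Lemma normcE z : normc z = Num.sqrt (Re z ^+ 2 + Im z ^+ 2).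
Proof. by case: z. Qed.

Lemma normc_ge0 z : 0 <= normc z. Proof. by case: z => a b; exact: sqrtr_ge0. Qed.

Lemma sqr_normc z : normc z ^+ 2 = Re z ^+ 2 + Im z ^+ 2.
Proof. by rewrite normcE sqr_sqrtr// addr_ge0// sqr_ge0. Qed.

Lemma normcD z w : normc (z + w) <= normc z + normc w.
Proof. by have := ler_normD z w; rewrite !normc_def -!normcE -rmorphD/= lecR. Qed.

Lemma normcN z : normc (- z) = normc z.
Proof. by rewrite !normcE !ReImE !sqrrN. Qed.

Lemma normcB z w : normc (z - w) <= normc z + normc w.
Proof. by rewrite -(normcN w) normcD. Qed.

Lemma normc_conj z : normc (conjc z) = normc z.
Proof. by rewrite !normcE !ReImE sqrrN. Qed.

Lemma normc_real a : normc a%:C = `|a|.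
Proof. by rewrite normcE /= expr0n addr0 sqrtr_sqr. Qed.

Lemma normr_Re z : `|Re z| <= normc z.
Proof. by rewrite normcE -sqrtr_sqr ler_wsqrtr// lerDl sqr_ge0. Qed.

Lemma normr_Im z : `|Im z| <= normc z.
Proof. by rewrite normcE -sqrtr_sqr ler_wsqrtr// lerDr sqr_ge0. Qed.

Lemma normc_le_ReIm z : normc z <= `|Re z| + `|Im z|.
Proof.
rewrite [z in leLHS]complexE (le_trans (normcD _ _))// Normc.normcM !normc_real.
by rewrite normcE/= expr0n/= expr1n add0r sqrtr1 mul1r.
Qed.

Lemma normc_gt0 z : (0 < normc z) = (z != 0).
Proof.
rewrite lt_def normc_ge0 andbT; congr negb; apply/eqP/eqP => [/Normc.eq0_normc//|->].
exact: Normc.normc0.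
Qed.

Lemma mulc_conj z : z * conjc z = (normc z ^+ 2)%:C.
Proof. by apply: complexP; rewrite !ReImE ?sqr_normc/=; ring. Qed.

Lemma conjcM z w : conjc (z * w) = conjc z * conjc w.
Proof. by apply: complexP; rewrite !ReImE; ring. Qed.

Lemma conjc_real a : conjc a%:C = a%:C.
Proof. by apply: complexP; rewrite !ReImE /= ?oppr0. Qed.

Lemma expiD a b : expi (a + b) = expi a * expi b.
Proof. by apply: complexP; rewrite !ReImE /= ?cosD ?sinD; ring. Qed.

Lemma expi0 : expi (0 : R) = 1.
Proof. by apply: complexP; rewrite /= ?cos0 ?sin0. Qed.

Lemma normc_expi a : normc (expi a) = 1.
Proof. by rewrite normcE /= cos2Dsin2 sqrtr1. Qed.

Lemma conj_expi a : conjc (expi a) = expi (- a).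
Proof. by apply: complexP; rewrite !ReImE /= ?cosN ?sinN. Qed.

End complex_numbers.

Section complex_measurable.
Context d (T : measurableType d) (R : realType).
Implicit Types f g : T -> R[i].

Definition cmeasurable f :=
  measurable_fun setT (fun x => Re (f x)) /\ measurable_fun setT (fun x => Im (f x)).

Lemma cmeasurable_cst (z : R[i]) : cmeasurable (fun=> z).
Proof. by split; exact: measurable_cst. Qed.

Lemma cmeasurableD f g : cmeasurable f -> cmeasurable g ->
  cmeasurable (fun x => f x + g x).
Proof.
move=> [mf1 mf2] [mg1 mg2]; split.
- by under eq_fun do rewrite ReD; exact: measurable_funD.
- by under eq_fun do rewrite ImD; exact: measurable_funD.
Qed.

Lemma cmeasurableM f g : cmeasurable f -> cmeasurable g ->
  cmeasurable (fun x => f x * g x).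
Proof.
move=> [mf1 mf2] [mg1 mg2]; split.
- by under eq_fun do rewrite Re_mulc; apply: measurable_funB; exact: measurable_funM.
- by under eq_fun do rewrite Im_mulc; apply: measurable_funD; exact: measurable_funM.
Qed.

Lemma cmeasurable_conj f : cmeasurable f -> cmeasurable (fun x => conjc (f x)).
Proof.
move=> [mf1 mf2]; split; first by under eq_fun do rewrite Re_conjc.
by under eq_fun do rewrite Im_conjc; exact: measurable_funN.
Qed.

Lemma cmeasurable_real (a : T -> R) : measurable_fun setT a ->
  cmeasurable (fun x => (a x)%:C).
Proof. by move=> ma; split => //=; exact: measurable_cst. Qed.

Lemma cmeasurable_expi (a : T -> R) : measurable_fun setT a ->
  cmeasurable (fun x => expi (a x)).
Proof.
move=> ma; split.
- by apply: (measurableT_comp _ ma); apply: continuous_measurable_fun; exact: continuous_cos.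
- by apply: (measurableT_comp _ ma); apply: continuous_measurable_fun; exact: continuous_sin.
Qed.

Lemma measurable_normc f : cmeasurable f -> measurable_fun setT (fun x => normc (f x)).
Proof.
move=> [mf1 mf2]; under eq_fun do rewrite normcE.
have mi : measurable_fun setT (fun x => Re (f x) ^+ 2 + Im (f x) ^+ 2).
  by apply: measurable_funD; exact: measurable_funX.
apply: (measurableT_comp _ mi).
by apply: continuous_measurable_fun; exact: sqrt_continuous.
Qed.

End complex_measurable.

Lemma cmeasurable_comp d1 d2 (T1 : measurableType d1) (T2 : measurableType d2)
  (R : realType) (f : T2 -> R[i]) (h : T1 -> T2) :
  cmeasurable f -> measurable_fun setT h -> cmeasurable (fun x => f (h x)).
Proof. by move=> [mf1 mf2] mh; split;
  [exact: (measurableT_comp mf1)|exact: (measurableT_comp mf2)]. Qed.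

Section complex_integral.
Context d (T : measurableType d) (R : realType) (mu : {measure set T -> \bar R}).
Implicit Types (f g : T -> R[i]) (phi : T -> R).

Lemma cintegrable_measurable f : cintegrable mu f -> cmeasurable f.
Proof. by move=> [i1 i2]; split; exact/measurable_EFinP/(measurable_int mu). Qed.

Lemma le_real_integrable phi psi : measurable_fun setT phi ->
  mu.-integrable setT (EFin \o psi) -> (forall x, `|phi x| <= psi x) ->
  mu.-integrable setT (EFin \o phi).
Proof.
move=> mphi ipsi le; apply: le_integrable ipsi => //; first exact/measurable_EFinP.
by move=> x _ /=; rewrite lee_fin (le_trans (le x))// ler_norm.
Qed.

Lemma real_integrableZ (k : R) phi : mu.-integrable setT (EFin \o phi) ->
  mu.-integrable setT (EFin \o (fun x => k * phi x)).
Proof. exact: (integrableZl measurableT k). Qed.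

Lemma le_cintegrable f phi : cmeasurable f ->
  mu.-integrable setT (EFin \o phi) -> (forall x, normc (f x) <= phi x) ->
  cintegrable mu f.
Proof.
move=> [mf1 mf2] iphi le; split; apply: le_real_integrable iphi _ => // x.
- exact: le_trans (normr_Re _) (le x).
- exact: le_trans (normr_Im _) (le x).
Qed.

Lemma cintegrable_normc f : cintegrable mu f ->
  mu.-integrable setT (EFin \o (fun x => normc (f x))).
Proof.
move=> fi; have mf := measurable_normc (cintegrable_measurable fi).
case: fi => [i1 i2]; apply: (@le_real_integrable _ (fun x => `|Re (f x)| + `|Im (f x)|)) => //.
  by apply: (integrableD measurableT (integrable_norm i1) (integrable_norm i2)).
by move=> x; rewrite ger0_norm ?normc_ge0// normc_le_ReIm.
Qed.

Lemma cintegrableP f : cintegrable mu f <->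
  cmeasurable f /\ (\int[mu]_x (normc (f x))%:E < +oo)%E.
Proof.
split=> [fi|[mf foo]].
  split; first exact: cintegrable_measurable.
  have /integrableP[_] := cintegrable_normc fi.
  by under eq_integral do rewrite /= ger0_norm ?normc_ge0//.
apply: (@le_cintegrable _ (fun x => normc (f x))) => //.
apply/integrableP; split; first exact/measurable_EFinP/measurable_normc.
by under eq_integral do rewrite /= ger0_norm ?normc_ge0//.
Qed.

Lemma cintegrable_le f g : cmeasurable f -> cintegrable mu g ->
  (forall x, normc (f x) <= normc (g x)) -> cintegrable mu f.
Proof. by move=> mf ig; apply: le_cintegrable => //; exact: cintegrable_normc. Qed.

Lemma cintegrableD f g : cintegrable mu f -> cintegrable mu g ->
  cintegrable mu (fun x => f x + g x).
Proof.
move=> fi gi; apply: (@le_cintegrable _ (fun x => normc (f x) + normc (g x))).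
- by apply: cmeasurableD; exact: cintegrable_measurable.
- exact: (integrableD measurableT (cintegrable_normc fi) (cintegrable_normc gi)).
- by move=> x; exact: normcD.
Qed.

Lemma cintegrableMl (m : T -> R[i]) (M : R) f : cmeasurable m ->
  (forall x, normc (m x) <= M) -> cintegrable mu f ->
  cintegrable mu (fun x => m x * f x).
Proof.
move=> mm mM fi; apply: (@le_cintegrable _ (fun x => M * normc (f x))).
- by apply: cmeasurableM => //; exact: cintegrable_measurable.
- exact/real_integrableZ/cintegrable_normc.
- by move=> x; rewrite Normc.normcM ler_wpM2r ?normc_ge0.
Qed.

Lemma cintegrableZ (z : R[i]) f : cintegrable mu f -> cintegrable mu (fun x => z * f x).
Proof. by apply: (@cintegrableMl _ (normc z)) => //; exact: cmeasurable_cst. Qed.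

Lemma cintegrableN f : cintegrable mu f -> cintegrable mu (fun x => - f x).
Proof. by move=> fi; under eq_fun do rewrite -mulN1r; exact: cintegrableZ. Qed.

Lemma cintegrableB f g : cintegrable mu f -> cintegrable mu g ->
  cintegrable mu (fun x => f x - g x).
Proof. by move=> fi gi; apply: cintegrableD => //; exact: cintegrableN. Qed.

Lemma cintegrable_conj f : cintegrable mu f -> cintegrable mu (fun x => conjc (f x)).
Proof.
move=> fi; apply: (cintegrable_le _ fi) => [|x]; last by rewrite normc_conj.
exact/cmeasurable_conj/(cintegrable_measurable fi).
Qed.

Lemma eq_cintegral f g : (forall x, f x = g x) -> cintegral mu f = cintegral mu g.
Proof. by move=> fg; congr cintegral; exact/funext. Qed.

Lemma eq_cintegrable f g : (forall x, f x = g x) -> cintegrable mu f -> cintegrable mu g.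
Proof. by move=> /funext ->. Qed.

Lemma Re_cintegral f : Re (cintegral mu f) = \int[mu]_x Re (f x).
Proof. by []. Qed.

Lemma Im_cintegral f : Im (cintegral mu f) = \int[mu]_x Im (f x).
Proof. by []. Qed.

Lemma cintegralD f g : cintegrable mu f -> cintegrable mu g ->
  cintegral mu (fun x => f x + g x) = cintegral mu f + cintegral mu g.
Proof.
move=> [f1 f2] [g1 g2]; apply: complexP; rewrite ?ReD ?ImD !(Re_cintegral, Im_cintegral).
- by under eq_Rintegral do rewrite ReD; rewrite RintegralD.
- by under eq_Rintegral do rewrite ImD; rewrite RintegralD.
Qed.

Lemma cintegralZ (z : R[i]) f : cintegrable mu f ->
  cintegral mu (fun x => z * f x) = z * cintegral mu f.
Proof.
move=> [f1 f2]; apply: complexP; rewrite ?Re_mulc ?Im_mulc ?(Re_cintegral, Im_cintegral).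
- rewrite -!RintegralZl// -RintegralB; [|by []|exact: real_integrableZ..].
  by apply: eq_Rintegral => x _; rewrite Re_mulc.
- rewrite -!RintegralZl// -RintegralD; [|by []|exact: real_integrableZ..].
  by apply: eq_Rintegral => x _; rewrite Im_mulc.
Qed.

Lemma cintegralN f : cintegrable mu f ->
  cintegral mu (fun x => - f x) = - cintegral mu f.
Proof.
move=> fi; rewrite -mulN1r -cintegralZ//.
by apply: eq_cintegral => x; rewrite mulN1r.
Qed.

Lemma cintegralB f g : cintegrable mu f -> cintegrable mu g ->
  cintegral mu (fun x => f x - g x) = cintegral mu f - cintegral mu g.
Proof. by move=> fi gi; rewrite cintegralD ?cintegralN//; exact: cintegrableN. Qed.

Lemma cintegral_conj f : cintegrable mu f ->
  cintegral mu (fun x => conjc (f x)) = conjc (cintegral mu f).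
Proof.
move=> [f1 f2]; apply: complexP; rewrite ?Re_conjc ?Im_conjc !(Re_cintegral, Im_cintegral).
  by apply: eq_Rintegral => x _; rewrite Re_conjc.
rewrite -mulN1r -RintegralZl//.
by apply: eq_Rintegral => x _; rewrite Im_conjc mulN1r.
Qed.

Lemma cintegral_real phi : cintegral mu (fun x => (phi x)%:C) = (\int[mu]_x phi x)%:C.
Proof.
apply: complexP => //=; rewrite /Rintegral.
by rewrite integral0.
Qed.

(* The modulus of [I = ∫ f] is the real part of the integral of [f] times the unit
   number [I^* / |I|]. *)
Lemma normc_cintegral f : cintegrable mu f ->
  normc (cintegral mu f) <= \int[mu]_x normc (f x).
Proof.
move=> fi; set I := cintegral mu f.
have [->|I0] := eqVneq I 0.
  by rewrite Normc.normc0 Rintegral_ge0// => x _; exact: normc_ge0.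
have nI0 : 0 < normc I by rewrite normc_gt0.
have e : normc I * normc I = Re (cintegral mu (fun x => conjc I * f x)).
  by rewrite cintegralZ// -/I [_ * I]mulrC mulc_conj -expr2.
rewrite -(ler_pM2l nI0) e Re_cintegral -RintegralZl//; last exact: cintegrable_normc.
apply: le_Rintegral => //.
- by have [] := cintegrableZ (conjc I) fi.
- exact/real_integrableZ/cintegrable_normc.
- move=> x _; apply: le_trans (ler_norm _) _; apply: le_trans (normr_Re _) _.
  by rewrite Normc.normcM normc_conj.
Qed.

Lemma le_normc_cintegral f phi : cintegrable mu f ->
  mu.-integrable setT (EFin \o phi) -> (forall x, normc (f x) <= phi x) ->
  normc (cintegral mu f) <= \int[mu]_x phi x.
Proof.
move=> fi phii le; apply: le_trans (normc_cintegral fi) _.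
by apply: le_Rintegral => //; exact: cintegrable_normc.
Qed.

Lemma EFin_Rintegral phi : mu.-integrable setT (EFin \o phi) ->
  (\int[mu]_x phi x)%:E = (\int[mu]_x (phi x)%:E)%E.
Proof. by move=> phii; rewrite fineK//; exact: integrable_fin_num. Qed.

Lemma normc_cintegralE f : cintegrable mu f ->
  ((normc (cintegral mu f))%:E <= \int[mu]_x (normc (f x))%:E)%E.
Proof.
move=> fi; rewrite -EFin_Rintegral ?lee_fin ?normc_cintegral//.
exact: cintegrable_normc.
Qed.

Definition ccvg (u : nat -> R[i]) (l : R[i]) :=
  (Re (u n) @[n --> \oo] --> Re l) /\ (Im (u n) @[n --> \oo] --> Im l).

Lemma cdominated_convergence (F : nat -> T -> R[i]) f phi :
  (forall n, cmeasurable (F n)) -> cmeasurable f ->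
  (forall x, ccvg (F ^~ x) (f x)) ->
  mu.-integrable setT (EFin \o phi) ->
  (forall n x, normc (F n x) <= phi x) ->
  ccvg (fun n => cintegral mu (F n)) (cintegral mu f).
Proof.
move=> mF [mf1 mf2] cF iphi le; split.
(* Dominated convergence is used twice for each component: once for the integrability of the limit,
   so that its integral is finite and can be written as an extended real, and once for the
   convergence itself. *)
- apply: fine_cvg; rewrite EFin_Rintegral; last first.
    have [] // := @dominated_convergence _ _ _ mu setT measurableT
      (fun n => EFin \o (fun x => Re (F n x))) (EFin \o (fun x => Re (f x))) (EFin \o phi).
    + by move=> n; apply/measurable_EFinP; have [] := mF n.
    + exact/measurable_EFinP.
    + by apply: aeW => x _; apply: cvg_EFin; [exact: nearW|have [] := cF x].
    + by apply: aeW => x n _ /=; rewrite lee_fin (le_trans (normr_Re _)).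
  have [] // := @dominated_convergence _ _ _ mu setT measurableT
      (fun n => EFin \o (fun x => Re (F n x))) (EFin \o (fun x => Re (f x))) (EFin \o phi).
  + by move=> n; apply/measurable_EFinP; have [] := mF n.
  + exact/measurable_EFinP.
  + by apply: aeW => x _; apply: cvg_EFin; [exact: nearW|have [] := cF x].
  + by apply: aeW => x n _ /=; rewrite lee_fin (le_trans (normr_Re _)).
- apply: fine_cvg; rewrite EFin_Rintegral; last first.
    have [] // := @dominated_convergence _ _ _ mu setT measurableT
      (fun n => EFin \o (fun x => Im (F n x))) (EFin \o (fun x => Im (f x))) (EFin \o phi).
    + by move=> n; apply/measurable_EFinP; have [] := mF n.
    + exact/measurable_EFinP.
    + by apply: aeW => x _; apply: cvg_EFin; [exact: nearW|have [] := cF x].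
    + by apply: aeW => x n _ /=; rewrite lee_fin (le_trans (normr_Im _)).
  have [] // := @dominated_convergence _ _ _ mu setT measurableT
      (fun n => EFin \o (fun x => Im (F n x))) (EFin \o (fun x => Im (f x))) (EFin \o phi).
  + by move=> n; apply/measurable_EFinP; have [] := mF n.
  + exact/measurable_EFinP.
  + by apply: aeW => x _; apply: cvg_EFin; [exact: nearW|have [] := cF x].
  + by apply: aeW => x n _ /=; rewrite lee_fin (le_trans (normr_Im _)).
Qed.

End complex_integral.

(* The library states this for the other order of integration only. *)
Lemma integrable_fubini_G d1 d2 (T1 : measurableType d1) (T2 : measurableType d2)
  (R : realType) (m1 : {sigma_finite_measure set T1 -> \bar R})
  (m2 : {sigma_finite_measure set T2 -> \bar R}) (f : T1 * T2 -> \bar R) :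
  (m1 \x m2)%E.-integrable setT f -> m2.-integrable setT (fubini_G m1 f).
Proof.
move=> fi; have mf := measurable_int _ fi.
have /integrable21ltyP := mf => /(_ m1 m2)[/(_ fi) foo _].
apply/integrableP; split; first exact: (measurable_fubini_G fi).
apply: le_lt_trans foo; apply: ge0_le_integral => //.
- by apply: measurableT_comp => //; exact: (measurable_fubini_G fi).
- apply: (@measurable_fun_fubini_tonelli_G _ _ T1 T2 R m1 (abse \o f)) => //=.
  exact: measurableT_comp.
- move=> y _; apply: le_abse_integral => //.
  by apply: (measurableT_comp mf); exact: pair2_measurable.
Qed.

(** * Fubini's theorem for complex-valued functions *)

Section complex_fubini.
Context d1 d2 (T1 : measurableType d1) (T2 : measurableType d2) (R : realType).
Variables (m1 : {sigma_finite_measure set T1 -> \bar R})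
  (m2 : {sigma_finite_measure set T2 -> \bar R}).
Implicit Types f : T1 * T2 -> R[i].

Lemma cintegrable_prod12 f : cmeasurable f ->
  (\int[m1]_x \int[m2]_y (normc (f (x, y)))%:E < +oo)%E ->
  cintegrable (m1 \x m2)%E f.
Proof.
move=> mf foo; apply/cintegrableP; split=> //.
rewrite fubini_tonelli1//.
- exact/measurable_EFinP/measurable_normc.
- by move=> x; rewrite lee_fin normc_ge0.
Qed.

Lemma cintegrable_prod21 f : cmeasurable f ->
  (\int[m2]_y \int[m1]_x (normc (f (x, y)))%:E < +oo)%E ->
  cintegrable (m1 \x m2)%E f.
Proof.
move=> mf foo; apply/cintegrableP; split=> //.
rewrite fubini_tonelli2//.
- exact/measurable_EFinP/measurable_normc.
- by move=> x; rewrite lee_fin normc_ge0.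
Qed.

Lemma cintegrable_tensor (a : T1 -> R[i]) (b : T2 -> R[i]) :
  cintegrable m1 a -> cintegrable m2 b ->
  cintegrable (m1 \x m2)%E (fun z => a z.1 * b z.2).
Proof.
move=> ai bi; have ma := cintegrable_measurable ai.
have mb := cintegrable_measurable bi.
apply: cintegrable_prod12.
  by apply: cmeasurableM; apply: cmeasurable_comp.
have nb : measurable_fun setT (fun y => (normc (b y))%:E).
  exact/measurable_EFinP/measurable_normc.
have na : measurable_fun setT (fun y => (normc (a y))%:E).
  exact/measurable_EFinP/measurable_normc.
have I x : (\int[m2]_y (normc (a x * b y))%:E =
    (normc (a x))%:E * \int[m2]_y (normc (b y))%:E)%E.
  rewrite -ge0_integralZl//; last 2 first.
  - by move=> y _; rewrite lee_fin normc_ge0.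
  - by rewrite lee_fin normc_ge0.
  by apply: eq_integral => y _; rewrite Normc.normcM EFinM.
under eq_integral do rewrite /= I.
rewrite /= ge0_integralZr//; last 2 first.
- by move=> y _; rewrite lee_fin normc_ge0.
- by apply: integral_ge0 => y _; rewrite lee_fin normc_ge0.
have /cintegrableP[_ aoo] := ai; have /cintegrableP[_ boo] := bi.
by rewrite lte_mul_pinfty// ?ge0_fin_numE//;
  apply: integral_ge0 => y _; rewrite lee_fin normc_ge0.
Qed.

Section sections.
Variable f : T1 * T2 -> R[i].
Hypothesis fi : cintegrable (m1 \x m2)%E f.

Section section1.
Hypothesis fi1 : forall x, cintegrable m2 (fun y => f (x, y)).

(** Every section, and not just almost every one, is assumed integrable: each inner integral is then
    finite, [fine] loses nothing, and the complex iterated integral agrees everywhere with the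
    extended real one to which Fubini's theorem applies. *)
Lemma cfubini12 : cintegrable m1 (fun x => cintegral m2 (fun y => f (x, y))) /\
  cintegral m1 (fun x => cintegral m2 (fun y => f (x, y))) = cintegral (m1 \x m2)%E f.
Proof.
case: fi => fr fim.
have er x : (Re (cintegral m2 (fun y => f (x, y))))%:E =
    fubini_F m2 (EFin \o (fun z => Re (f z))) x.
  by rewrite /fubini_F EFin_Rintegral//; have [] := fi1 x.
have ei x : (Im (cintegral m2 (fun y => f (x, y))))%:E =
    fubini_F m2 (EFin \o (fun z => Im (f z))) x.
  by rewrite /fubini_F EFin_Rintegral//; have [] := fi1 x.
split.
  split; first by rewrite (funext er : EFin \o _ = _); exact: integrable_fubini_F fr.
  by rewrite (funext ei : EFin \o _ = _); exact: integrable_fubini_F fim.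
apply: complexP; congr fine.
- by rewrite -integral12_prod_meas1//; apply: eq_integral => x _; exact: er.
- by rewrite -integral12_prod_meas1//; apply: eq_integral => x _; exact: ei.
Qed.

End section1.

Section section2.
Hypothesis fi2 : forall y, cintegrable m1 (fun x => f (x, y)).

Lemma cfubini21 : cintegrable m2 (fun y => cintegral m1 (fun x => f (x, y))) /\
  cintegral m2 (fun y => cintegral m1 (fun x => f (x, y))) = cintegral (m1 \x m2)%E f.
Proof.
case: fi => fr fim.
have er y : (Re (cintegral m1 (fun x => f (x, y))))%:E =
    fubini_G m1 (EFin \o (fun z => Re (f z))) y.
  by rewrite /fubini_G EFin_Rintegral//; have [] := fi2 y.
have ei y : (Im (cintegral m1 (fun x => f (x, y))))%:E =
    fubini_G m1 (EFin \o (fun z => Im (f z))) y.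
  by rewrite /fubini_G EFin_Rintegral//; have [] := fi2 y.
split.
  split; first by rewrite (funext er : EFin \o _ = _); exact: (integrable_fubini_G fr).
  by rewrite (funext ei : EFin \o _ = _); exact: (integrable_fubini_G fim).
apply: complexP; congr fine.
- by rewrite -integral21_prod_meas1//; apply: eq_integral => x _; exact: er.
- by rewrite -integral21_prod_meas1//; apply: eq_integral => x _; exact: ei.
Qed.

End section2.

Lemma cfubini : (forall x, cintegrable m2 (fun y => f (x, y))) ->
  (forall y, cintegrable m1 (fun x => f (x, y))) ->
  cintegral m1 (fun x => cintegral m2 (fun y => f (x, y))) =
  cintegral m2 (fun y => cintegral m1 (fun x => f (x, y))).
Proof. by move=> /cfubini12[_ ->] /cfubini21[_ ->]. Qed.

End sections.

(** No integrability is required: the inner integral is the difference of the Tonelli integrals of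
    the positive and negative parts, both measurable, and [fine] is measurable, with value 0 where
    that difference is infinite. *)
Lemma cmeasurable_cintegral2 f : cmeasurable f ->
  cmeasurable (fun x => cintegral m2 (fun y => f (x, y))).
Proof.
have rm (h : T1 * T2 -> R) : measurable_fun setT h ->
    measurable_fun setT (fun x => \int[m2]_y h (x, y)).
  move=> mh; rewrite /Rintegral.
  have -> : (fun x => fine (\int[m2]_y (h (x, y))%:E)%E) = fine \o
      (fun x => \int[m2]_y ((EFin \o h)^\+ (x, y)) - \int[m2]_y ((EFin \o h)^\- (x, y)))%E.
    apply/funext => x /=; congr fine; rewrite [LHS]integralE.
    by congr (_ - _)%E; apply: eq_integral => y _; rewrite ?funeposE ?funenegE.
  apply: measurableT_comp; first exact: fine_measurable.
  apply: emeasurable_funB.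
  - apply: (@measurable_fun_fubini_tonelli_F _ _ T1 T2 R m2 ((EFin \o h)^\+)%E) => //.
    exact/measurable_funepos/measurable_EFinP.
  - apply: (@measurable_fun_fubini_tonelli_F _ _ T1 T2 R m2 ((EFin \o h)^\-)%E) => //.
    exact/measurable_funeneg/measurable_EFinP.
by move=> [mf1 mf2]; split; [exact: (rm (fun z => Re (f z)))|exact: (rm (fun z => Im (f z)))].
Qed.

End complex_fubini.

(** * Lebesgue measure on R^d *)

Section measurable_rV_arithmetic.
Context {R : realType}.

Lemma measurable_rV_coordT n (i : 'I_n) :
  measurable_fun setT (fun v : 'rV[R]_n => v ord0 i).
Proof. exact: measurable_rV_coord. Qed.

Lemma measurable_funD_rV d (T : measurableType d) n (f g : T -> 'rV[R]_n) :
  measurable_fun setT f -> measurable_fun setT g ->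
  measurable_fun setT (fun x => f x + g x).
Proof.
move=> mf mg; apply: measurable_fun_rV => i.
rewrite (_ : _ \o _ = (fun x => f x ord0 i + g x ord0 i)); last first.
  by apply/funext => x; rewrite /rV_coord /= mxE.
by apply: measurable_funD; apply: (measurableT_comp (@measurable_rV_coordT _ i)).
Qed.

Lemma measurable_funZ_rV d (T : measurableType d) n (a : R) (f : T -> 'rV[R]_n) :
  measurable_fun setT f -> measurable_fun setT (fun x => a *: f x).
Proof.
move=> mf; apply: measurable_fun_rV => i.
rewrite (_ : _ \o _ = (fun x => a * f x ord0 i)); last first.
  by apply/funext => x; rewrite /rV_coord /= mxE.
apply: measurable_funM => //.
by apply: (measurableT_comp (@measurable_rV_coordT _ i)).
Qed.

Lemma measurable_funB_rV d (T : measurableType d) n (f g : T -> 'rV[R]_n) :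
  measurable_fun setT f -> measurable_fun setT g ->
  measurable_fun setT (fun x => f x - g x).
Proof.
move=> mf mg; rewrite (_ : (fun x => _) = (fun x => f x + (-1) *: g x)).
  by apply: measurable_funD_rV => //; exact: measurable_funZ_rV.
by apply/funext => x; rewrite scaleN1r.
Qed.

Lemma measurable_fun_dot d (T : measurableType d) n (f g : T -> 'rV[R]_n) :
  measurable_fun setT f -> measurable_fun setT g ->
  measurable_fun setT (fun x => dot (f x) (g x)).
Proof.
move=> mf mg; apply: measurable_sum => i.
by apply: measurable_funM; apply: (measurableT_comp (@measurable_rV_coordT _ i)).
Qed.

Lemma measurable_box n (a b : 'rV[R]_n) :
  measurable [set y : 'rV[R]_n | forall i, a ord0 i < y ord0 i < b ord0 i].
Proof.
rewrite (_ : [set y | _] = \bigcap_(i in [set: 'I_n])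
    ((fun v : 'rV[R]_n => v ord0 i) @^-1` `]a ord0 i, b ord0 i[%classic)).
  apply: fin_bigcap_measurable => // i _.
  by rewrite -[X in measurable X]setTI; exact: measurable_rV_coordT.
apply/seteqP; split=> y /= H i; first by move=> _; rewrite /preimage /= in_itv/=.
by have := H i I; rewrite /= in_itv.
Qed.

(** An open set is the union of the boxes with rational corners that it contains. The pairs of
    corners are countable, and [pickle] enumerates them; codes of no pair, or of a box that leaves
    [U], give the empty set. *)
Lemma open_measurable_rV n (U : set 'rV[R]_n) : open U -> measurable U.
Proof.
move=> oU.
pose box (q : 'rV[rat]_n * 'rV[rat]_n) : set 'rV[R]_n :=
  [set y | forall i, (ratr (q.1 ord0 i) < y ord0 i < ratr (q.2 ord0 i))%R].
pose B k : set 'rV[R]_n :=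
  if unpickle k is Some q then if `[< box q `<=` U >] then box q else set0 else set0.
rewrite (_ : U = \bigcup_k B k).
  apply: bigcupT_measurable => k; rewrite /B; case: unpickle => [q|//].
  case: ifP => // _.
  rewrite (_ : box q = [set y : 'rV[R]_n | forall i,
    (map_mx ratr q.1 : 'rV[R]_n) ord0 i < y ord0 i < (map_mx ratr q.2 : 'rV[R]_n) ord0 i]).
    exact: measurable_box.
  by apply/seteqP; split=> y /= H i; have := H i; rewrite !mxE.
apply/seteqP; split=> [x Ux|x [k _]]; last first.
  by rewrite /B; case: unpickle => // q; case: ifPn => // /asboolP; apply.
have /nbhs_ballP[e /= e0 xeU] : nbhs x U by exact: open_nbhs_nbhs.
have /choice[a ha] i : exists q : rat, x ord0 i - e < ratr q < x ord0 i.
  have [|q] := @rat_in_itvoo R (x ord0 i - e) (x ord0 i); first by rewrite ltrBlDr ltrDl.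
  by rewrite in_itv /= => ?; exists q.
have /choice[b hb] i : exists q : rat, x ord0 i < ratr q < x ord0 i + e.
  have [|q] := @rat_in_itvoo R (x ord0 i) (x ord0 i + e); first by rewrite ltrDl.
  by rewrite in_itv /= => ?; exists q.
pose q : 'rV[rat]_n * 'rV[rat]_n := (\row_i a i, \row_i b i).
exists (pickle q) => //; rewrite /B pickleK.
have -> : `[< box q `<=` U >].
  apply/asboolP => y yq; apply: xeU; split=> // i j; rewrite ord1.
  have := yq j; rewrite /q /= !mxE => /andP[ay yb].
  have /andP[xa _] := ha j; have /andP[_ bx] := hb j.
  rewrite /ball /= ltr_distlC; apply/andP; split; lra.
move=> i /=; rewrite !mxE; have /andP[_ ->] := ha i; by have /andP[-> _] := hb i.
Qed.

Lemma continuous_measurable_rV n (f : 'rV[R]_n -> R) :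
  continuous f -> measurable_fun setT f.
Proof.
move=> /continuousP cf; apply: (measurability _ (RGenOpens.measurableE R)).
move=> _ [_ [a [b ->] <-]]; rewrite setTI; apply: open_measurable_rV.
exact/cf/interval_open.
Qed.

Lemma ccontinuous_cmeasurable n (f : 'rV[R]_n -> R[i]) :
  ccontinuous f -> cmeasurable f.
Proof. by move=> [c1 c2]; split; exact: continuous_measurable_rV. Qed.

End measurable_rV_arithmetic.

Section rV_cons_entries.
Context {R : realType} (n : nat).
Implicit Types (s : R) (v : 'rV[R]_n).

Lemma rV_consEl s v (o j : 'I_1) : rV_cons (s, v) o (lshift n j) = s.
Proof. by rewrite (ord1 o) /rV_cons /= [LHS]row_mxEl mxE. Qed.

Lemma rV_consEr s v (o : 'I_1) k : rV_cons (s, v) o (rshift 1 k) = v o k.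
Proof. by rewrite (ord1 o) /rV_cons /= [LHS]row_mxEr. Qed.

End rV_cons_entries.

(** * Affine substitutions and products of one-variable functions *)

Section lebesgue_affine.
Context {R : realType}.
Local Open Scope ereal_scope.
Notation leb := (@lebesgue_measure R).

Lemma measurable_affine1 (a b : R) : measurable_fun setT (fun x : R => a * x + b)%R.
Proof.
apply: measurable_funD; last exact: measurable_cst.
by apply: measurable_funM => //; exact: measurable_cst.
Qed.

(** By uniqueness of Lebesgue measure it is enough to test intervals []u, v]]. For [a < 0] the
    preimage is closed on the left and open on the right, which does not change its length. *)
Lemma lebesgue_measure_affine (a b : R) : a != 0%R -> forall A, measurable A ->
  leb A = `|a|%:E * leb ((fun x => a * x + b)%R @^-1` A).
Proof.
move=> a0.
have mphi : measurable_fun setT ((fun x => a * x + b)%R : measurableTypeR R -> measurableTypeR R).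
  exact: measurable_affine1.
pose nu := measure_function_pushforward__canonical__measure_function_Measure leb mphi.
have na : (0 <= `|a|)%R by [].
pose nu' := mscale (NngNum na) nu.
apply: (@lebesgue_measure_unique _ nu') => X [[u v] _ <-].
rewrite /nu' /= /mscale /= /pushforward.
case: (ltgtP a 0%R) a0 => // a0 _.
- rewrite (_ : _ @^-1` _ = `[((v - b) / a)%R, ((u - b) / a)%R[%classic); last first.
    apply/seteqP; split=> x /=; rewrite !in_itv /= ler_ndivrMr// ltr_ndivlMr// => /andP[h1 h2].
    by apply/andP; split; lra.
    by apply/andP; split; lra.
  rewrite !lebesgue_measure_itv /= !lte_fin ltr_ndivrMr// divfK ?lt_eqF//.
  rewrite ltrD2r; case: ifP => _; last by rewrite mule0.
  rewrite -!EFinB -EFinM ltr0_norm//; congr EFin.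
  by field; rewrite lt_eqF.
- rewrite (_ : _ @^-1` _ = `]((u - b) / a)%R, ((v - b) / a)%R]%classic); last first.
    apply/seteqP; split=> x /=; rewrite !in_itv /= ler_pdivlMr// ltr_pdivrMr// => /andP[h1 h2].
    by apply/andP; split; lra.
    by apply/andP; split; lra.
  rewrite !lebesgue_measure_itv /= !lte_fin ltr_pdivrMr// divfK ?gt_eqF//.
  rewrite ltrD2r; case: ifP => _; last by rewrite mule0.
  rewrite -!EFinB -EFinM gtr0_norm//; congr EFin.
  by field; rewrite gt_eqF.
Qed.

Lemma ge0_integral_affine1 (a b : R) (f : R -> \bar R) : a != 0%R ->
  measurable_fun setT f -> (forall x, 0 <= f x) ->
  \int[leb]_x f (a * x + b)%R = (`|a|^-1)%:E * \int[leb]_x f x.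
Proof.
move=> a0 mf f0.
have mphi : measurable_fun setT ((fun x => a * x + b)%R : measurableTypeR R -> measurableTypeR R).
  exact: measurable_affine1.
pose nu := measure_function_pushforward__canonical__measure_function_Measure leb mphi.
have na : (0 <= `|a|)%R by [].
have -> : \int[leb]_x f x = \int[mscale (NngNum na) nu]_x f x.
  by apply: eq_measure_integral => A mA _; exact: (lebesgue_measure_affine b a0).
rewrite ge0_integral_mscale//= muleA -EFinM mulVf ?normr_eq0// mul1e.
by rewrite ge0_integral_pushforward.
Qed.

Lemma ge0_integral_rV_cons n (f : 'rV[R]_n.+1 -> \bar R) :
  measurable_fun setT f -> (forall x, 0 <= f x) ->
  \int[lebesgue_rV n.+1]_x f x =
  \int[leb]_s \int[lebesgue_rV n]_v f (rV_cons (s, v)).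
Proof.
move=> mf f0.
transitivity (\int[pushforward (leb \x lebesgue_rV n) (@rV_cons R n)]_x f x) => //.
rewrite ge0_integral_pushforward//=; last exact: measurable_rV_cons.
rewrite fubini_tonelli1//=.
by apply: (measurableT_comp mf); exact: measurable_rV_cons.
Qed.

(** A homothety followed by a translation acts on each coordinate separately, hence commutes with
    splitting off the first one: the one-dimensional formula and induction give one factor [|a|^-1]
    per coordinate. On R^0 there is a single point. *)
Lemma ge0_integral_affine n (a : R) (b : 'rV[R]_n) (f : 'rV[R]_n -> \bar R) :
  a != 0%R -> measurable_fun setT f -> (forall x, 0 <= f x) ->
  \int[lebesgue_rV n]_x f (a *: x + b)%R = ((`|a| ^- n)%:E) * \int[lebesgue_rV n]_x f x.
Proof.
move=> a0; elim: n b f => [|n IH] b f mf f0.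
  rewrite expr0 invr1 mul1e; apply: eq_integral => x _; congr f.
  by apply/rowP => -[].
have mfc : measurable_fun setT (fun p => f (@rV_cons R n p)).
  by apply: (measurableT_comp mf); exact: measurable_rV_cons.
rewrite !ge0_integral_rV_cons//; last first.
  apply: (measurableT_comp mf); apply: measurable_funD_rV; last exact: measurable_cst.
  exact: measurable_funZ_rV.
pose b' : 'rV[R]_n := @rsubmx R 1 1 n b.
have e s v : (a *: rV_cons (s, v) + b = rV_cons (a * s + b ord0 ord0, a *: v + b'))%R.
  apply/rowP => i; case: (@split_ordP 1 n i) => [j ->|k ->].
    rewrite [LHS]mxE [X in (X + _)%R]mxE !rV_consEl (ord1 j);
    by congr (_ + b _ _)%R; exact: val_inj.
  by rewrite [LHS]mxE [X in (X + _)%R]mxE !rV_consEr !mxE.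
pose H (s : measurableTypeR R) := \int[lebesgue_rV n]_v f (rV_cons (s, v)).
have H0 s : 0 <= H s by exact: integral_ge0.
have mH : measurable_fun setT H.
  exact: (@measurable_fun_fubini_tonelli_F _ _ _ _ _ (lebesgue_rV n) (fun p => f (@rV_cons R n p))).
have mHa : measurable_fun setT (fun s : measurableTypeR R => H (a * s + b ord0 ord0)%R).
  by apply: (measurableT_comp mH); exact: measurable_affine1.
have k0 : (0 <= `|a| ^- n)%R by rewrite invr_ge0 exprn_ge0.
transitivity (\int[leb]_s ((`|a| ^- n)%:E * H (a * s + b ord0 ord0)%R)).
  apply: eq_integral => s _.
  rewrite -(IH b' (fun v => f (rV_cons ((a * s + b ord0 ord0)%R, v))))//.
    by apply: eq_integral => v _; rewrite e.
  by apply: (measurableT_comp mfc); exact: pair1_measurable.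
have -> : \int[leb]_s ((`|a| ^- n)%:E * H (a * s + b ord0 ord0)%R) =
    (`|a| ^- n)%:E * \int[leb]_s H (a * s + b ord0 ord0)%R.
  by apply: ge0_integralZl_EFin => // s _; exact: H0.
rewrite (ge0_integral_affine1 (b ord0 ord0) a0 mH H0) muleA -EFinM.
congr (_%:E * _).
by rewrite exprS; field; rewrite expf_neq0 ?normr_eq0.
Qed.

Local Close Scope ereal_scope.

Lemma cintegral_affine n (a : R) (b : 'rV[R]_n) (f : 'rV[R]_n -> R[i]) :
  a != 0 -> cintegrable (lebesgue_rV n) f ->
  cintegrable (lebesgue_rV n) (fun x => f (a *: x + b)) /\
  cintegral (lebesgue_rV n) (fun x => f (a *: x + b)) =
    (`|a| ^- n)%:C * cintegral (lebesgue_rV n) f.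
Proof.
move=> a0 fi; set mu := lebesgue_rV n.
have mphi : measurable_fun setT (fun x : 'rV[R]_n => a *: x + b).
  by apply: measurable_funD_rV; [exact: measurable_funZ_rV|exact: measurable_cst].
have k0 : 0 <= `|a| ^- n by rewrite invr_ge0 exprn_ge0.
have real (h : 'rV[R]_n -> R) : mu.-integrable setT (EFin \o h) ->
    \int[mu]_x h (a *: x + b) = `|a| ^- n * \int[mu]_x h x.
  move=> hi; have mh := measurable_int _ hi.
  have -> : \int[mu]_x h (a *: x + b) = fine ((`|a| ^- n)%:E * \int[mu]_x (h x)%:E)%E.
    congr fine; rewrite [LHS]integralE [X in (_ * X)%E]integralE muleBr//; last first.
      by rewrite fin_num_adde_defl// fin_numN; exact: (integrable_neg_fin_num measurableT hi).
    by congr (_ - _)%E; rewrite -(ge0_integral_affine b a0)//;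
      first [exact: measurable_funepos|exact: measurable_funeneg|
        by apply: eq_integral => x _; rewrite ?funeposE ?funenegE].
  by rewrite fineM//; exact: integrable_fin_num.
have /cintegrableP[mf foo] := fi.
split.
  apply/cintegrableP; split; first exact: (cmeasurable_comp mf).
  rewrite (@ge0_integral_affine _ a b (fun x => (normc (f x))%:E) a0).
  - rewrite lte_mul_pinfty ?lee_fin//.
  - exact/measurable_EFinP/measurable_normc.
  - by move=> x; rewrite lee_fin normc_ge0.
case: fi => fr fim.
apply: complexP; rewrite ?Re_mulc ?Im_mulc !(Re_cintegral, Im_cintegral) /=.
- by rewrite (real (fun x => Re (f x)))// mul0r subr0.
- by rewrite (real (fun x => Im (f x)))// mul0r addr0.
Qed.

Lemma cintegrable_rV_cons n (f : 'rV[R]_n.+1 -> R[i]) : cmeasurable f ->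
  cintegrable (leb \x lebesgue_rV n)%E (fun p => f (@rV_cons R n p)) ->
  cintegrable (lebesgue_rV n.+1) f.
Proof.
move=> mf /cintegrableP[mfc foo]; apply/cintegrableP; split=> //.
rewrite ge0_integral_rV_cons//.
- rewrite fubini_tonelli1// in foo.
  + exact/measurable_EFinP/measurable_normc.
  + by move=> x; rewrite lee_fin normc_ge0.
- exact/measurable_EFinP/measurable_normc.
- by move=> x; rewrite lee_fin normc_ge0.
Qed.

Lemma cintegral_rV_cons n (f : 'rV[R]_n.+1 -> R[i]) : cmeasurable f ->
  cintegrable (leb \x lebesgue_rV n)%E (fun p => f (@rV_cons R n p)) ->
  cintegral (lebesgue_rV n.+1) f =
  cintegral (leb \x lebesgue_rV n)%E (fun p => f (@rV_cons R n p)).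
Proof.
move=> [mf1 mf2] [fr fim]; apply: complexP; congr fine.
- transitivity (\int[pushforward (leb \x lebesgue_rV n) (@rV_cons R n)]_x (Re (f x))%:E)%E => //.
  rewrite (integral_pushforward (@measurable_rV_cons R n))//.
  exact/measurable_EFinP.
- transitivity (\int[pushforward (leb \x lebesgue_rV n) (@rV_cons R n)]_x (Im (f x))%:E)%E => //.
  rewrite (integral_pushforward (@measurable_rV_cons R n))//.
  exact/measurable_EFinP.
Qed.

Lemma cmeasurable_prod_coord n (F : 'I_n -> R -> R[i]) :
  (forall i, cmeasurable (F i : measurableTypeR R -> _)) ->
  cmeasurable (fun x : 'rV[R]_n => \prod_i F i (x ord0 i)).
Proof.
move=> mF; elim: (index_enum _) => [|i s IH].
  by under eq_fun do rewrite big_nil; exact: cmeasurable_cst.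
under eq_fun do rewrite big_cons; apply: cmeasurableM => //.
by apply: (cmeasurable_comp (mF i)); exact: measurable_rV_coordT.
Qed.

Lemma cintegral_prod_coord n (F : 'I_n -> R -> R[i]) :
  (forall i, cintegrable leb (F i)) ->
  cintegrable (lebesgue_rV n) (fun x => \prod_i F i (x ord0 i)) /\
  cintegral (lebesgue_rV n) (fun x => \prod_i F i (x ord0 i)) =
    \prod_i cintegral leb (F i).
Proof.
elim: n F => [|n IH] F Fi.
  (* On R^0 the measure is a unit mass, so the empty product integrates to 1. *)
  under eq_fun do rewrite big_ord0; rewrite big_ord0.
  have r (a : R) : (\int[lebesgue_rV 0]_x a%:E)%E = a%:E.
    by rewrite /= integral_dirac// diracE in_setT mul1e.
  split.
    apply/cintegrableP; split; first exact: cmeasurable_cst.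
    by rewrite (r (normc 1)) ltry.
  by apply: complexP; rewrite /= /Rintegral /= r.
pose F' (i : 'I_n) := F (lift ord0 i).
have [F'i F'E] := IH F' (fun i => Fi _).
have e p : \prod_i F i (@rV_cons R n p ord0 i) =
    F ord0 p.1 * \prod_i F' i (p.2 ord0 i).
  case: p => s v; rewrite big_ord_recl; congr (F _ _ * _).
    by rewrite (_ : ord0 = lshift n (ord0 : 'I_1)) ?rV_consEl//; exact: val_inj.
  apply: eq_bigr => i _; congr (F _ _).
  by rewrite (_ : lift ord0 i = rshift 1 i) ?rV_consEr//; exact: val_inj.
have mF i : cmeasurable (F i : measurableTypeR R -> _) := cintegrable_measurable (Fi i).
have ti := cintegrable_tensor (Fi ord0) F'i.
have ci : cintegrable (leb \x lebesgue_rV n)%E (fun p => \prod_i F i (@rV_cons R n p ord0 i)).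
  by rewrite (funext e).
split; first by apply: cintegrable_rV_cons => //; exact: cmeasurable_prod_coord.
rewrite cintegral_rV_cons//; last exact: cmeasurable_prod_coord.
rewrite big_ord_recl -F'E (funext e).
have [_ <-] := cfubini12 ti (fun s => cintegrableZ (F ord0 s) F'i).
transitivity (cintegral leb (fun s => cintegral (lebesgue_rV n) (fun v =>
  \prod_i F' i (v ord0 i)) * F ord0 s)).
  by apply: eq_cintegral => s; rewrite /= (cintegralZ (F ord0 s) F'i) mulrC.
by rewrite cintegralZ// mulrC.
Qed.

End lebesgue_affine.

(** * The Laplace density and its Fourier transform *)

Section one_dimensional_integrals.
Context {R : realType}.
Notation leb := (@lebesgue_measure R).

Lemma ge0_symfun_integrable (f : R -> R) (l : R) : (forall x, 0 <= f x) ->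
  continuous f -> (forall x, f (- x) = f x) ->
  (\int[leb]_(x in `[0%R, +oo[) (f x)%:E = l%:E)%E ->
  leb.-integrable setT (EFin \o f) /\ \int[leb]_x f x = 2 * l.
Proof.
move=> f0 cf ef fl.
have e : (\int[leb]_x (f x)%:E = (2 * l)%:E)%E.
  rewrite ge0_symfun_integralT//; last by move=> x /=; rewrite ef.
  by rewrite -set_itvcy fl.
split; last by rewrite /Rintegral e.
have mf : measurable_fun setT f := continuous_measurable_fun cf.
apply/integrableP; split; first exact/measurable_EFinP.
under eq_integral do rewrite /= ger0_norm//.
by rewrite e ltry.
Qed.

Lemma cauchy_density_integral :
  leb.-integrable setT (EFin \o (fun x : R => (1 + x ^+ 2)^-1)) /\
  \int[leb]_x (1 + x ^+ 2)^-1 = pi.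
Proof.
have [||||i ->] := @ge0_symfun_integrable (fun x : R => (1 + x ^+ 2)^-1) (pi / 2).
- by move=> x; rewrite invr_ge0 addr_ge0// sqr_ge0.
- exact: continuous_oneDsqrV.
- by move=> x; rewrite sqrrN.
- exact: integral0y_oneDsqr.
- by split=> //; rewrite mulrC divfK.
Qed.

(** An antiderivative of exp (- e s) (1 + cos (b s)). The added 1 makes the integrand nonnegative,
    as the fundamental theorem of calculus on a half-line requires in the form used for
    [laplace_fourier]. *)
Lemma is_derive_laplace (e b x : R) : 0 < e ->
  is_derive x 1 (fun s : R => expR (- e * s) *
    (- e^-1 + (b * sin (b * s) - e * cos (b * s)) / (e ^+ 2 + b ^+ 2)))
    (expR (- e * x) * (1 + cos (b * x))).
Proof.
move=> e0.
have D0 : e ^+ 2 + b ^+ 2 != 0 by rewrite gt_eqF// ltr_pwDl ?exprn_gt0 ?sqr_ge0.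
have hl (k : R) : is_derive x 1 (fun s : R => k * s) k.
  have h := @is_deriveZ R R R id k x 1 1 (is_derive_id x 1).
  by apply: (is_derive_eq h); rewrite [LHS]mulr1.
have h1 := hl (- e); have h2 := hl b.
apply: is_derive_eq; rewrite /GRing.scale /=; field.
by rewrite D0 gt_eqF.
Qed.

(** Reflection, the affine substitution of slope -1, exchanges the positive and the negative
    part. *)
Lemma odd_Rintegral (h : R -> R) : leb.-integrable setT (EFin \o h) ->
  (forall x, h (- x) = - h x) -> \int[leb]_x h x = 0.
Proof.
move=> hi oh; rewrite /Rintegral integralE.
have mh := measurable_int _ hi.
have -> : (\int[leb]_x (EFin \o h)^\+ x = \int[leb]_x (EFin \o h)^\- x)%E.
  rewrite -[LHS]mul1e -[X in (X%:E * _)%E]invr1 -normrN1 -(ge0_integral_affine1 0)//.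
  - by apply: eq_integral => x _; rewrite mulN1r addr0 funeposE funenegE /= oh.
  - exact: measurable_funepos.
by rewrite subee// (integrable_neg_fin_num measurableT hi).
Qed.

(** The real part is a difference of two nonnegative even integrals, each computed on the half-line
    and doubled; the imaginary part is odd. *)
Lemma laplace_fourier (e b : R) : 0 < e ->
  let F := fun s : R => (expR (- e * `|s|))%:C * expi (b * s) in
  cintegrable leb F /\ cintegral leb F = (2 * e / (e ^+ 2 + b ^+ 2))%:C.
Proof.
move=> e0 F.
have D0 (c : R) : 0 < e ^+ 2 + c ^+ 2 by rewrite ltr_pwDl ?exprn_gt0 ?sqr_ge0.
have lap c : leb.-integrable setT (EFin \o (fun s : R => expR (- e * `|s|) * (1 + cos (c * s)))) /\
    \int[leb]_s (expR (- e * `|s|) * (1 + cos (c * s))) = 2 * (e^-1 + e / (e ^+ 2 + c ^+ 2)).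
  apply: ge0_symfun_integrable.
  - by move=> x; rewrite mulr_ge0 ?expR_ge0// -lerBlDl sub0r cos_geN1.
  - move=> x; apply: cvgM.
      apply: (continuous_comp (f := fun s => - e * `|s|)); last exact: continuous_expR.
      by apply: cvgM; [exact: cvg_cst|exact: norm_continuous].
    apply: cvgD; first exact: cvg_cst.
    apply: (continuous_comp (f := fun s => c * s)); last exact: continuous_cos.
    by apply: cvgM; [exact: cvg_cst|exact: cvg_id].
  - by move=> x; rewrite normrN mulrN cosN.
  have dF x := is_derive_laplace c x e0.
  transitivity (\int[leb]_(x in `[0%R, +oo[) (expR (- e * x) * (1 + cos (c * x)))%:E)%E.
    apply: eq_integral => x; rewrite inE /= in_itv /= andbT => x0.
    by rewrite ger0_norm.
  rewrite (ge0_continuous_FTC2y (l := 0) (F := fun s : R => expR (- e * s) *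
    (- e^-1 + (c * sin (c * s) - e * cos (c * s)) / (e ^+ 2 + c ^+ 2)))).
  - rewrite !mulr0 expR0 sin0 cos0 mul1r -EFinB; congr EFin.
    by field; rewrite !gt_eqF.
  - by move=> x _; rewrite mulr_ge0 ?expR_ge0// -lerBlDl sub0r cos_geN1.
  - apply: continuous_subspaceT => x; apply: cvgM.
      apply: (continuous_comp (f := fun s => - e * s)); last exact: continuous_expR.
      by apply: cvgM; [exact: cvg_cst|exact: cvg_id].
    apply: cvgD; first exact: cvg_cst.
    apply: (continuous_comp (f := fun s => c * s)); last exact: continuous_cos.
    by apply: cvgM; [exact: cvg_cst|exact: cvg_id].
  - pose M := e^-1 + (`|c| + e) / (e ^+ 2 + c ^+ 2).
    have hM (x : R) : `|- e^-1 + (c * sin (c * x) - e * cos (c * x)) / (e ^+ 2 + c ^+ 2)| <= M.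
      have hD : `|(e ^+ 2 + c ^+ 2)^-1| = (e ^+ 2 + c ^+ 2)^-1 by rewrite ger0_norm// invr_ge0 ltW.
      apply: (le_trans (ler_normD _ _)); rewrite normrN normrM hD; apply: lerD.
        by rewrite ger0_norm// invr_ge0 ltW.
      apply: ler_wpM2r; first by rewrite invr_ge0 ltW.
      apply: (le_trans (ler_normB _ _)); rewrite !normrM (ger0_norm (ltW e0)); apply: lerD.
        by rewrite ler_piMr// ler_norml sin_geN1 sin_le1.
      by apply: ler_piMr; [exact: ltW|exact: cos_max].
    have l0 : expR (- e * x) @[x --> +oo] --> (0 : R).
      rewrite (_ : (fun x => _) = (fun z => expR (- z)) \o (fun z => e * z)); last first.
        by apply: eq_fun => x; rewrite mulNr.
      apply: (@cvg_comp _ _ _ _ _ _ (pinfty_nbhs R)); last exact: cvgr_expR.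
      exact: gt0_cvgMry.
    have lM : expR (- e * x) * M @[x --> +oo] --> (0 : R).
      by rewrite -(mul0r M); apply: cvgM => //; exact: cvg_cst.
    apply: (@squeeze_cvgr _ _ _ _ (fun x => - (expR (- e * x) * M)) (fun x => expR (- e * x) *
      M)) => //.
    + apply: nearW => x; rewrite -ler_norml normrM ger0_norm ?expR_ge0// ler_wpM2l ?expR_ge0//.
    + by rewrite -oppr0; exact: cvgN.
  - by move=> x _; exact: ex_derive.
  - apply: cvg_at_right_filter; have [df0 _] := dF 0.
    by move/derivable1_diffP/differentiable_continuous : df0.
  - by move=> x _; rewrite derive1E; exact: derive_val.
(* At frequency 0 the integrand is 2 exp (- e |s|). Half of this case is the integral of the
   exponential alone, which is then subtracted from the case of frequency [b]. *)
have [i0 E0] := lap 0; have [ib Eb] := lap b.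
have iexp : leb.-integrable setT (EFin \o (fun s : R => expR (- e * `|s|))).
  have := real_integrableZ (2^-1) i0; congr (integrable _ _ _).
  by apply/funext => s /=; rewrite mul0r cos0; congr EFin; field.
have Eexp : \int[leb]_s expR (- e * `|s|) = 2 / e.
  transitivity (2^-1 * \int[leb]_s (expR (- e * `|s|) * (1 + cos (0 * s)))).
    by rewrite -RintegralZl//; apply: eq_Rintegral => s _; rewrite mul0r cos0; field.
  by rewrite E0; field; rewrite gt_eqF.
have mexp : measurable_fun setT (fun s : R => expR (- e * `|s|)).
  by apply/measurable_EFinP; exact: (measurable_int leb).
have mb : measurable_fun setT (fun s : R => b * s) by exact: mulrl_measurable.
have Fi : cintegrable leb F.
  apply: le_cintegrable iexp _.
    by apply: cmeasurableM; [exact: cmeasurable_real|exact: cmeasurable_expi].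
  by move=> s; rewrite Normc.normcM normc_expi mulr1 normc_real ger0_norm ?expR_ge0.
split=> //; case: Fi => Fr Fim.
apply: complexP; rewrite ?Re_cintegral ?Im_cintegral /=.
- transitivity (\int[leb]_s (expR (- e * `|s|) * (1 + cos (b * s)) - expR (- e * `|s|))).
    by apply: eq_Rintegral => s _; ring.
  by rewrite RintegralB// Eb Eexp; field; rewrite !gt_eqF.
- apply: odd_Rintegral => //= s.
  by rewrite /= normrN mulrN sinN !mul0r; ring.
Qed.

End one_dimensional_integrals.

(** * Rapid decay and Schwartz functions *)

Section weight.
Context {R : realType} {d : nat}.
Local Notation V := 'rV[R]_d.
Implicit Types (x y : V) (f : V -> R[i]).

(** The l^1 norm is chosen because the powers of this weight expand into absolute values of
    monomials, which matches the seminorms of [schwartz], and because 1 + |x|_1 is submultiplicative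
    under addition. *)
Definition wt x : R := 1 + \sum_i `|x ord0 i|.

Lemma wt_ge1 x : 1 <= wt x.
Proof. by rewrite lerDl sumr_ge0. Qed.

Lemma wt_gt0 x : 0 < wt x. Proof. exact: lt_le_trans (wt_ge1 x). Qed.

Lemma wt_ge0 x : 0 <= wt x. Proof. exact/ltW/wt_gt0. Qed.

Lemma wtX_gt0 x N : 0 < wt x ^+ N. Proof. by rewrite exprn_gt0// wt_gt0. Qed.

Lemma wt_coord x i : `|x ord0 i| <= wt x.
Proof.
rewrite /wt (bigD1 i)//= addrCA lerDl addr_ge0// sumr_ge0//.
Qed.

Lemma wtN x : wt (- x) = wt x.
Proof. by congr (1 + _); apply: eq_bigr => i _; rewrite mxE normrN. Qed.

Lemma wtD x y : wt (x + y) <= wt x * wt y.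
Proof.
have sx : 0 <= \sum_i `|x ord0 i| by rewrite sumr_ge0.
have sy : 0 <= \sum_i `|y ord0 i| by rewrite sumr_ge0.
apply: (@le_trans _ _ (1 + (\sum_i `|x ord0 i| + \sum_i `|y ord0 i|))).
  rewrite lerD2l -big_split /=; apply: ler_sum => i _.
  by rewrite mxE; exact: ler_normD.
by rewrite /wt; nra.
Qed.

Lemma wt_basis (s : R) (i : 'I_d) : `|s| <= 1 -> wt (s *: basis_vec i) <= 2.
Proof.
move=> s1; rewrite /wt (bigD1 i)//= big1 => [|j ji].
  by rewrite /basis_vec !mxE !eqxx mulr1 addr0 (_ : 2 = 1 + 1)// lerD2l.
by rewrite /basis_vec !mxE eqxx /= (negbTE ji) mulr0 normr0.
Qed.

Lemma measurable_wt : measurable_fun setT wt.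
Proof.
apply: measurable_funD; first exact: measurable_cst.
apply: measurable_sum => i; apply: measurableT_comp => //.
exact: measurable_rV_coordT.
Qed.

(** The exponent comes from a comparison with a product of Cauchy densities: each of the [d] factors
    1 + x_i^2 is at most [wt x ^+ 2]. *)
Lemma integrable_wt : (lebesgue_rV d).-integrable setT (EFin \o (fun x => (wt x ^+ (2 * d))^-1)).
Proof.
have [i1 _] := @cauchy_density_integral R.
have ci : cintegrable (@lebesgue_measure R) (fun s : R => ((1 + s ^+ 2)^-1)%:C).
  apply: (le_cintegrable _ i1) => [|s].
    by apply: cmeasurable_real; apply/measurable_EFinP; exact: (measurable_int _ i1).
  by rewrite normc_real ger0_norm// invr_ge0 addr_ge0// sqr_ge0.
have [[pr _] _] := @cintegral_prod_coord R d (fun=> fun s : R => ((1 + s ^+ 2)^-1)%:C) (fun=> ci).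
apply: (le_real_integrable _ pr) => [|x].
  have mX : measurable_fun setT (fun x => wt x ^+ (2 * d)).
    by apply: measurable_funX; exact: measurable_wt.
  rewrite (_ : (fun x => _) = (fun y : R => y `^ (-1)) \o (fun x => wt x ^+ (2 * d))).
    by apply: (measurableT_comp (measurable_powR (-1))).
  by apply/funext => x /=; rewrite powR_inv1// exprn_ge0 ?wt_ge0.
rewrite -rmorph_prod /= prodfV ger0_norm; last by rewrite invr_ge0 exprn_ge0 ?wt_ge0.
rewrite lef_pV2 ?posrE ?wtX_gt0 ?prodr_gt0//; last first.
  by move=> i _; rewrite ltr_pwDl ?sqr_ge0.
rewrite exprM -[X in _ ^+ X]card_ord -prodr_const; apply: ler_prod => i _.
rewrite addr_ge0 ?sqr_ge0//=.
have := wt_coord x i; have := wt_ge1 x; have : 0 <= `|x ord0 i| by [].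
have e : wt x = 1 + `|x ord0 i| + (\sum_(j | j != i) `|x ord0 j|).
  by rewrite /wt (bigD1 i)//= addrA.
have : 0 <= \sum_(j | j != i) `|x ord0 j| by rewrite sumr_ge0.
rewrite e -[x ord0 i ^+ 2]real_normK ?num_real//; nra.
Qed.

Definition decays f := forall N : nat, exists C : R, forall x,
  wt x ^+ N * normc (f x) <= C.

Lemma decays_bound f N : decays f ->
  exists2 C : R, 0 <= C & forall x, normc (f x) <= C * (wt x ^+ N)^-1.
Proof.
move=> /(_ N)[C hC]; exists C => [|x].
  by apply: le_trans (hC 0); rewrite mulr_ge0 ?normc_ge0// exprn_ge0 ?wt_ge0.
by rewrite ler_pdivlMr ?wtX_gt0// mulrC.
Qed.

Lemma decays_bounded f : decays f -> exists2 C : R, 0 <= C & forall x, normc (f x) <= C.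
Proof. by move=> /(decays_bound 0)[C C0 hC]; exists C => // x; have := hC x;
  rewrite expr0 invr1 mulr1. Qed.

Lemma integrable_wtZ (C : R) : (lebesgue_rV d).-integrable setT (EFin \o (fun x => C *
  (wt x ^+ (2 * d))^-1)).
Proof. exact/real_integrableZ/integrable_wt. Qed.

Lemma decays_integrable f : cmeasurable f -> decays f -> cintegrable (lebesgue_rV d) f.
Proof.
move=> mf /(decays_bound (2 * d))[C C0 hC].
exact: le_cintegrable mf (integrable_wtZ C) hC.
Qed.

(* Bounds against all monomials are the same as bounds against all powers of the weight. *)
Lemma monomial_decays f :
  (forall r, exists C : R, forall x, `|monomial r x| * normc (f x) <= C) -> decays f.
Proof.
move=> H N; suff: forall r, exists C : R, forall x,
  wt x ^+ N * (`|monomial r x| * normc (f x)) <= C.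
  move=> /(_ [::])[C hC]; exists C => x; have := hC x.
  by rewrite /monomial big_nil normr1 mul1r.
elim: N => [|N IH] r.
  by have [C hC] := H r; exists C => x; rewrite expr0 mul1r.
have [C hC] := IH r.
have /choice[D hD] i := IH (i :: r).
exists (C + \sum_i D i) => x.
rewrite exprSr -mulrA [wt x * _]mulrC mulrA /wt -/(wt x) mulrDr mulr1 mulr_sumr.
apply: lerD; first exact: hC.
apply: ler_sum => i _; apply: le_trans (hD i x).
rewrite /monomial big_cons normrM -!mulrA ler_wpM2l ?exprn_ge0 ?wt_ge0//.
by rewrite [normc _ * _]mulrC mulrCA.
Qed.

Lemma monomial_le_wt r x : `|monomial r x| <= wt x ^+ size r.
Proof.
rewrite /monomial; elim: r => [|i r IH]; first by rewrite big_nil normr1 expr0.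
by rewrite big_cons normrM exprS ler_pM// wt_coord.
Qed.

Lemma decaysD f g : decays f -> decays g -> decays (fun x => f x + g x).
Proof.
move=> hf hg N; have [C hC] := hf N; have [D hD] := hg N; exists (C + D) => x.
by apply: le_trans (lerD (hC x) (hD x)); rewrite -mulrDr ler_wpM2l ?normcD// exprn_ge0 ?wt_ge0.
Qed.

Lemma decaysM (m : V -> R[i]) (k : nat) (M : R) f :
  (forall x, normc (m x) <= M * wt x ^+ k) -> decays f -> decays (fun x => m x * f x).
Proof.
move=> hm hf N; have [C hC] := hf (N + k)%N; exists (`|M| * C) => x.
rewrite Normc.normcM; apply: le_trans (ler_wpM2l (normr_ge0 M) (hC x)).
have w0 := @exprn_ge0 _ N _ (wt_ge0 x).
have hm' : normc (m x) <= `|M| * wt x ^+ k.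
  by apply: le_trans (hm x) _; rewrite ler_wpM2r ?exprn_ge0 ?wt_ge0// ler_norm.
have -> : `|M| * (wt x ^+ (N + k) * normc (f x)) =
    wt x ^+ N * (`|M| * wt x ^+ k * normc (f x)) by rewrite exprD; ring.
by rewrite ler_wpM2l// ler_wpM2r ?normc_ge0.
Qed.

Lemma decays_conj f : decays f -> decays (fun x => conjc (f x)).
Proof. by move=> hf N; have [C hC] := hf N; exists C => x; rewrite normc_conj. Qed.

Lemma decays_shift f a : decays f -> decays (fun x => f (x - a)).
Proof.
move=> hf N; have [C hC] := hf N; exists (wt a ^+ N * C) => x.
apply: le_trans (ler_wpM2l _ (hC (x - a))); last by rewrite exprn_ge0 ?wt_ge0.
rewrite mulrA ler_wpM2r ?normc_ge0// -exprMn lerXn2r ?nnegrE ?mulr_ge0 ?wt_ge0//.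
by rewrite -[x in wt x](subrKC a); exact: wtD.
Qed.

End weight.

(** * Derivatives from quadratic remainder bounds *)

Section directional_derivative.
Context {R : realType} {d : nat}.
Local Notation V := 'rV[R]_d.
Implicit Types (x y v : V) (h : V -> R).

(** The difference quotient is within [C * |s|] of [D]. An inequality of this kind survives
    integration over a parameter, which is how derivatives are taken under the integral sign in
    [fourier_cis_derive]. *)
Lemma is_derive_quadratic h x v (D C : R) :
  (forall s : R, `|s| <= 1 -> `|h (x + s *: v) - h x - s * D| <= C * s ^+ 2) ->
  is_derive x v h D.
Proof.
move=> H.
have C0 : 0 <= C.
  by have := H 1; rewrite normr1 lexx expr1n mulr1 => /(_ isT); apply: le_trans.
have cv : (fun s : R => s^-1 *: ((h \o shift x) (s *: v) - h x)) @ 0^' --> D.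
  apply/cvgrPdist_le => e e0; near=> s.
  have s0 : s != 0 by near: s; exact: nbhs_dnbhs_neq.
  have s1 : `|s| <= 1.
    by near: s; apply: dnbhs0_le.
  (* [C + 1] instead of [C], which may be 0. *)
  have se : `|s| <= e / (C + 1).
    by near: s; apply: dnbhs0_le; rewrite divr_gt0// ltr_wpDl.
  rewrite /= [s *: v + x]addrC.
  have -> : D - s^-1 *: (h (x + s *: v) - h x) = - (s^-1 * (h (x + s *: v) - h x - s * D)).
    by rewrite /GRing.scale /=; field.
  rewrite normrN normrM normfV ler_pdivrMl ?normr_gt0//.
  apply: le_trans (H s s1) _; rewrite -[s ^+ 2]real_normK ?num_real//.
  rewrite expr2 mulrCA ler_wpM2l// mulrC.
  move: se; rewrite ler_pdivlMr ?ltr_wpDl// => se.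
  by apply: le_trans se; rewrite ler_wpM2l// lerDl.
by apply: DeriveDef; [apply/cvg_ex; exists D|exact: cvg_lim].
Unshelve. all: by end_near. Qed.

Lemma is_derive_line h x v (s : R) : derivable h (x + s *: v) v ->
  is_derive s 1 (fun t : R => h (x + t *: v)) ('D_v h (x + s *: v)).
Proof.
move=> dh.
have e : (fun t : R => t^-1 *: (((fun t => h (x + t *: v)) \o shift s) (t *: 1) - h (x + s *: v))) =
         (fun t : R => t^-1 *: ((h \o shift (x + s *: v)) (t *: v) - h (x + s *: v))).
  apply/funext => t /=; congr (_ *: (h _ - _)).
  by rewrite [t *: 1]mulr1 scalerDl addrCA.
by split; rewrite /derivable /derive e.
Qed.

End directional_derivative.

(** * Mean value inequality and remainders of the complex exponential *)

Section mean_value.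
Context {R : realType}.

Lemma mean_value_bound (h dh : R -> R) (a K : R) :
  (forall t : R, is_derive t 1 h (dh t)) -> (forall t, `|t| <= `|a| -> `|dh t| <= K) ->
  `|h a - h 0| <= K * `|a|.
Proof.
move=> hd hK.
have ch : continuous h.
  move=> t; apply: differentiable_continuous; apply/derivable1_diffP.
  by have [] := hd t.
have [a0|a0] := leP 0 a.
  have [|c] := MVT_segment a0 (fun t _ => hd t); first exact: continuous_subspaceT.
  rewrite in_itv /= => /andP[c0 ca] ->; rewrite subr0 normrM ler_wpM2r//.
  by apply: hK; rewrite !ger0_norm.
have [|c] := MVT_segment (ltW a0) (fun t _ => hd t); first exact: continuous_subspaceT.
rewrite in_itv /= => /andP[ca c0] e; rewrite distrC e sub0r normrM normrN ler_wpM2r//.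
by apply: hK; rewrite !ler0_norm// ?(ltW a0)// lerN2.
Qed.

Lemma normr_sin_le (a : R) : `|sin a| <= `|a|.
Proof.
have := @mean_value_bound sin cos a 1 (fun t => is_derive_sin t) (fun t _ => cos_max t).
by rewrite sin0 subr0 mul1r.
Qed.

Lemma normr_cosB1_le (a : R) : `|cos a - 1| <= a ^+ 2.
Proof.
have := @mean_value_bound cos (fun t => - sin t) a `|a| (fun t => is_derive_cos t).
rewrite cos0 -expr2 real_normK ?num_real//; apply=> t ta.
by rewrite normrN (le_trans (normr_sin_le t)).
Qed.

Lemma normr_sinB_le (a : R) : `|sin a - a| <= 2 * a ^+ 2.
Proof.
have hd (t : R) : is_derive t 1 (fun t : R => sin t - t) (cos t - 1).
  by apply: is_derive_eq.
have := @mean_value_bound (fun t => sin t - t) (fun t => cos t - 1) a (2 * `|a|) hd.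
rewrite sin0 !subr0 -mulrA -expr2 real_normK ?num_real//; apply=> t ta.
have := @mean_value_bound cos (fun t => - sin t) t 1 (fun t => is_derive_cos t).
rewrite cos0 mul1r => /(_ _)/le_trans; apply.
  by move=> s _; rewrite normrN sin_max.
by rewrite (le_trans ta)// ler_peMl// ler1n.
Qed.

(** The chord from 1 to e^(i a) has length 2 |sin (a / 2)|. *)
Lemma normc_expiB1 (a : R) : normc (expi a - 1) <= `|a|.
Proof.
have e : normc (expi a - 1) ^+ 2 = (2 * sin (a / 2)) ^+ 2.
  have := cos2Dsin2 (a / 2).
  have -> : expi a = expi (a / 2) * expi (a / 2) by rewrite -expiD -splitr.
  rewrite sqr_normc !ReImE /=.
  set c := cos (a / 2); set s := sin (a / 2) => cs.
  have -> : c * c = 1 - s ^+ 2 by rewrite -cs; ring.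
  transitivity ((1 - s ^+ 2 - s * s - 1) ^+ 2 + 4 * (c ^+ 2) * s ^+ 2); first by ring.
  have -> : c ^+ 2 = 1 - s ^+ 2 by rewrite -cs; ring.
  by ring.
have -> : normc (expi a - 1) = `|2 * sin (a / 2)|.
  by rewrite -sqrtr_sqr -e sqrtr_sqr ger0_norm ?normc_ge0.
rewrite normrM ger0_norm//.
by have := normr_sin_le (a / 2); rewrite normrM [`|2^-1|]ger0_norm ?invr_ge0//; lra.
Qed.

Lemma normc_expiB (a b : R) : normc (expi a - expi b) <= `|a - b|.
Proof.
have -> : expi a - expi b = expi b * (expi (a - b) - 1).
  by rewrite mulrBr mulr1 -expiD subrKC.
by rewrite Normc.normcM normc_expi mul1r normc_expiB1.
Qed.

(** The 3 is the sum of the constant 1 for the cosine and 2 for the sine. *)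
Lemma normc_expi_quadratic (a : R) : normc (expi a - 1 - (0 +i* a)) <= 3 * a ^+ 2.
Proof.
apply: le_trans (normc_le_ReIm _) _; rewrite !ReImE /= !subr0.
have := normr_cosB1_le a; have := normr_sinB_le a; lra.
Qed.

End mean_value.

(** * Partial derivatives and continuity of complex-valued functions *)

Section complex_derivative.
Context {R : realType} {d : nat}.
Local Notation V := 'rV[R]_d.
Implicit Types (f g : V -> R[i]) (x : V) (i : 'I_d).

Definition cis_derive f x i (D : R[i]) :=
  is_derive x (basis_vec i) (fun y => Re (f y)) (Re D) /\
  is_derive x (basis_vec i) (fun y => Im (f y)) (Im D).

Lemma cderivableP f x i : cderivable f x i <-> cis_derive f x i (cpartial i f x).
Proof. by split=> [[d1 d2]|[[d1 _] [d2 _]]]; split. Qed.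

Lemma cpartialE f i (D : V -> R[i]) : (forall x, cis_derive f x i (D x)) ->
  (forall x, cderivable f x i) /\ cpartial i f = D.
Proof.
move=> H; split; first by move=> x; have [[d1 _] [d2 _]] := H x.
by apply/funext => x; have [[_ e1] [_ e2]] := H x; apply: complexP.
Qed.

Lemma cis_derive_quadratic f x i (D : R[i]) (C : R) :
  (forall s : R, `|s| <= 1 ->
    normc (f (x + s *: basis_vec i) - f x - s%:C * D) <= C * s ^+ 2) ->
  cis_derive f x i D.
Proof.
move=> H; split; apply: (@is_derive_quadratic _ _ _ _ _ _ C) => s s1.
- apply: le_trans (H s s1); apply: le_trans (normr_Re _).
  by rewrite !ReImE /= mul0r subr0.
- apply: le_trans (H s s1); apply: le_trans (normr_Im _).
  by rewrite !ReImE /= mul0r addr0.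
Qed.

Lemma cis_deriveD f g x i Df Dg : cis_derive f x i Df -> cis_derive g x i Dg ->
  cis_derive (fun y => f y + g y) x i (Df + Dg).
Proof.
move=> [f1 f2] [g1 g2]; split; rewrite !ReImE.
- rewrite (_ : (fun y => _) = (fun y => Re (f y)) + (fun y => Re (g y))).
    exact: is_deriveD.
  by apply/funext => y; rewrite ReD.
- rewrite (_ : (fun y => _) = (fun y => Im (f y)) + (fun y => Im (g y))).
    exact: is_deriveD.
  by apply/funext => y; rewrite ImD.
Qed.

Lemma cis_deriveM f g x i Df Dg : cis_derive f x i Df -> cis_derive g x i Dg ->
  cis_derive (fun y => f y * g y) x i (Df * g x + f x * Dg).
Proof.
move=> [f1 f2] [g1 g2]; split; rewrite !ReImE.
- rewrite (_ : (fun y => _) = (fun y => Re (f y)) * (fun y => Re (g y)) -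
      (fun y => Im (f y)) * (fun y => Im (g y))).
    apply: (is_derive_eq (is_deriveB (is_deriveM f1 g1) (is_deriveM f2 g2))).
    by rewrite /GRing.scale /=; ring.
  by apply/funext => y; rewrite Re_mulc.
- rewrite (_ : (fun y => _) = (fun y => Re (f y)) * (fun y => Im (g y)) +
      (fun y => Im (f y)) * (fun y => Re (g y))).
    apply: (is_derive_eq (is_deriveD (is_deriveM f1 g2) (is_deriveM f2 g1))).
    by rewrite /GRing.scale /=; ring.
  by apply/funext => y; rewrite Im_mulc.
Qed.

Lemma cis_derive_conj f x i D : cis_derive f x i D ->
  cis_derive (fun y => conjc (f y)) x i (conjc D).
Proof.
move=> [f1 f2]; split; rewrite !ReImE.
- by rewrite (_ : (fun y => _) = (fun y => Re (f y)))//; apply/funext => y; rewrite Re_conjc.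
- rewrite (_ : (fun y => _) = - (fun y => Im (f y))); first exact: is_deriveN.
  by apply/funext => y; rewrite Im_conjc.
Qed.

Lemma cis_derive_shift f x i a D : cis_derive f (x - a) i D ->
  cis_derive (fun y => f (y - a)) x i D.
Proof.
have sh (h : V -> R) (l : R) : is_derive (x - a) (basis_vec i) h l ->
    is_derive x (basis_vec i) (fun y => h (y - a)) l.
  have e : (fun t : R => t^-1 *: (((fun y =>
    h (y - a)) \o shift x) (t *: basis_vec i) - h (x - a))) =
         (fun t : R => t^-1 *: ((h \o shift (x - a)) (t *: basis_vec i) - h (x - a))).
    by apply/funext => t /=; rewrite addrA.
  by move=> [d1 d2]; split; rewrite /derivable /derive e.
by move=> [f1 f2]; split; exact: (sh (fun y => _)).
Qed.

Lemma cis_derive_coord x i j :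
  cis_derive (fun y => (y ord0 j)%:C) x i (i == j)%:R.
Proof.
apply: (@cis_derive_quadratic _ _ _ _ 0) => s _.
rewrite /basis_vec !mxE eqxx /= eq_sym mul0r.
rewrite [X in normc X](_ : _ = 0) ?Normc.normc0//.
by case: eqP => _; apply: complexP; rewrite !ReImE /=; ring.
Qed.

Lemma cis_derive_expi (w : V) x i :
  cis_derive (fun y => expi (dot w y)) x i ((0 +i* w ord0 i) * expi (dot w x)).
Proof.
apply: (@cis_derive_quadratic _ _ _ _ (3 * w ord0 i ^+ 2)) => s _.
have -> : dot w (x + s *: basis_vec i) = dot w x + s * w ord0 i.
  rewrite /dot (bigD1 i)//= [in RHS](bigD1 i)//= !mxE !eqxx /= mulr1.
  rewrite (eq_bigr (fun j => w ord0 j * x ord0 j)); first by ring.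
  by move=> j ji; rewrite !mxE eqxx /= (negbTE ji) mulr0 addr0.
rewrite expiD.
have -> : expi (dot w x) * expi (s * w ord0 i) - expi (dot w x) -
   s%:C * ((0 +i* w ord0 i) * expi (dot w x)) =
   expi (dot w x) * (expi (s * w ord0 i) - 1 - (0 +i* (s * w ord0 i))).
  by apply: complexP; rewrite !ReImE /=; ring.
rewrite Normc.normcM normc_expi mul1r.
apply: le_trans (normc_expi_quadratic _) _.
by rewrite exprMn [s ^+ 2 * _]mulrC mulrA lexx.
Qed.

Lemma cis_derive_cst (a : R[i]) x i : cis_derive (fun=> a) x i 0.
Proof. by split; exact: is_derive_cst. Qed.

End complex_derivative.

Section complex_continuity.
Context {R : realType} {d : nat}.
Local Notation V := 'rV[R]_d.
Implicit Types (f g : V -> R[i]) (x : V) (i : 'I_d).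

Lemma lipschitz_continuous_rV (h : V -> R) (L : R) : 0 <= L ->
  (forall x y, `|h x - h y| <= L * \sum_i `|x ord0 i - y ord0 i|) -> continuous h.
Proof.
move=> L0 H; move=> x A /= /(nbhs_ballP (h x))[e /= e0 hA].
(* Balls are those of the maximum norm, so the l^1 distance is at most [d] times the radius. Halving
   [e] makes the final inequality strict, and the added 1 keeps the denominator positive. *)
apply/nbhs_ballP; exists (e / 2 / (L * d%:R + 1)) => /=.
  by rewrite !divr_gt0// ltr_wpDl// mulr_ge0.
move=> y [_ xy] /=; apply: hA; rewrite /ball /=.
apply: le_lt_trans (H x y) _.
apply: (@le_lt_trans _ _ (e / 2)); last by rewrite ltr_pdivrMr// ltr_pMr// ltr1n.
have D0 : 0 < L * d%:R + 1 by rewrite ltr_wpDl// mulr_ge0.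
apply: (@le_trans _ _ (L * (d%:R * (e / 2 / (L * d%:R + 1))))).
  rewrite ler_wpM2l//.
  apply: (@le_trans _ _ (\sum_(i < d) (e / 2 / (L * d%:R + 1)))).
    by apply: ler_sum => i _; apply: ltW; have := xy ord0 i.
  by rewrite sumr_const card_ord mulr_natl.
have -> : L * (d%:R * (e / 2 / (L * d%:R + 1))) = e / 2 * (L * d%:R / (L * d%:R + 1)).
  by field; rewrite gt_eqF.
apply: ler_piMr; first by rewrite divr_ge0// ltW.
by rewrite ler_pdivrMr// mul1r lerDl.
Qed.

Lemma lipschitz_ccontinuous f (L : R) : 0 <= L ->
  (forall x y, normc (f x - f y) <= L * \sum_i `|x ord0 i - y ord0 i|) -> ccontinuous f.
Proof.
move=> L0 H; split; apply: (lipschitz_continuous_rV L0) => x y;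
  apply: le_trans (H x y).
- by rewrite -ReN -ReD normr_Re.
- by rewrite -ImN -ImD normr_Im.
Qed.

Lemma ccontinuousD f g : ccontinuous f -> ccontinuous g -> ccontinuous (fun x => f x + g x).
Proof.
move=> [f1 f2] [g1 g2]; split.
- by under eq_fun do rewrite ReD; move=> x; exact: continuousD (f1 x) (g1 x).
- by under eq_fun do rewrite ImD; move=> x; exact: continuousD (f2 x) (g2 x).
Qed.

Lemma ccontinuousM f g : ccontinuous f -> ccontinuous g -> ccontinuous (fun x => f x * g x).
Proof.
move=> [f1 f2] [g1 g2]; split.
- under eq_fun do rewrite Re_mulc; move=> x.
  exact: continuousB (continuousM (f1 x) (g1 x)) (continuousM (f2 x) (g2 x)).
- under eq_fun do rewrite Im_mulc; move=> x.
  exact: continuousD (continuousM (f1 x) (g2 x)) (continuousM (f2 x) (g1 x)).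
Qed.

Lemma ccontinuous_conj f : ccontinuous f -> ccontinuous (fun x => conjc (f x)).
Proof.
move=> [f1 f2]; split; first by under eq_fun do rewrite Re_conjc.
by under eq_fun do rewrite Im_conjc; move=> x; exact: continuousN (f2 x).
Qed.

Lemma ccontinuous_affine f (a : R) (b : V) : ccontinuous f -> ccontinuous (fun x => f (a *: x + b)).
Proof.
have ca : continuous (fun x : V => a *: x + b).
  move=> x; apply: (continuousD (f := fun y : V => a *: y) (g := fun=> b)).
    by apply: continuousZl_tmp.
  exact: cst_continuous.
move=> [f1 f2]; split=> x.
- exact: (continuous_comp (g := fun y => Re (f y)) (ca x) (f1 _)).
- exact: (continuous_comp (g := fun y => Im (f y)) (ca x) (f2 _)).
Qed.

Lemma ccontinuous_shift f a : ccontinuous f -> ccontinuous (fun x => f (x - a)).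
Proof.
move=> /(ccontinuous_affine 1 (- a)); congr ccontinuous.
by apply/funext => x; rewrite scale1r.
Qed.

Lemma ccontinuous_cst (a : R[i]) : ccontinuous (fun _ : V => a).
Proof. by split; exact: cst_continuous. Qed.

Lemma ccontinuous_coord i : ccontinuous (fun x => (x ord0 i)%:C).
Proof.
apply: (@lipschitz_ccontinuous _ 1) => // x y.
have -> : (x ord0 i)%:C - (y ord0 i)%:C = (x ord0 i - y ord0 i)%:C by rewrite rmorphB.
rewrite normc_real mul1r (bigD1 i)//= lerDl sumr_ge0//.
Qed.

Lemma dotBr (w x y : V) : dot w (x - y) = dot w x - dot w y.
Proof. by rewrite /dot -sumrB; apply: eq_bigr => i _; rewrite !mxE mulrBr. Qed.

Lemma dotDr (w x y : V) : dot w (x + y) = dot w x + dot w y.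
Proof. by rewrite /dot -big_split; apply: eq_bigr => i _; rewrite !mxE mulrDr. Qed.

Lemma dotC (x y : V) : dot x y = dot y x.
Proof. by apply: eq_bigr => i _; rewrite mulrC. Qed.

Lemma dotDl (w x y : V) : dot (x + y) w = dot x w + dot y w.
Proof. by rewrite dotC dotDr !(dotC w). Qed.

Lemma dotNr (w x : V) : dot w (- x) = - dot w x.
Proof. by rewrite /dot -sumrN; apply: eq_bigr => i _; rewrite !mxE mulrN. Qed.

Lemma dotNl (w x : V) : dot (- x) w = - dot x w.
Proof. by rewrite dotC dotNr dotC. Qed.

Lemma dotZr (a : R) (w x : V) : dot w (a *: x) = a * dot w x.
Proof. by rewrite /dot mulr_sumr; apply: eq_bigr => i _; rewrite !mxE mulrCA. Qed.

Lemma dotZl (a : R) (w x : V) : dot (a *: x) w = a * dot x w.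
Proof. by rewrite dotC dotZr dotC. Qed.

Lemma dot0l (x : V) : dot 0 x = 0.
Proof. by rewrite /dot big1// => i _; rewrite mxE mul0r. Qed.

Lemma normr_dot (w x : V) : `|dot w x| <= wt w * \sum_i `|x ord0 i|.
Proof.
apply: le_trans (ler_norm_sum _ _ _) _; rewrite mulr_sumr; apply: ler_sum => i _.
by rewrite normrM ler_wpM2r// wt_coord.
Qed.

Lemma ccontinuous_expi (w : V) : ccontinuous (fun x => expi (dot w x)).
Proof.
apply: (@lipschitz_ccontinuous _ (wt w)); first exact: wt_ge0.
move=> x y; apply: le_trans (normc_expiB _ _) _; rewrite -dotBr.
apply: le_trans (normr_dot _ _) _; rewrite ler_wpM2l ?wt_ge0//.
by apply: ler_sum => i _; rewrite !mxE.
Qed.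

End complex_continuity.

(** * Stability of the Schwartz class *)

Section schwartz_closure.
Context {R : realType} {d : nat}.
Local Notation V := 'rV[R]_d.
Implicit Types (f g : V -> R[i]) (x : V) (i : 'I_d).

Lemma cpartials_rcons f s i : cpartials (rcons s i) f = cpartials s (cpartial i f).
Proof. by rewrite /cpartials foldr_rcons. Qed.

Lemma schwartz_bound f r s : schwartz f ->
  exists C : R, forall x, `|monomial r x| * normc (cpartials s f x) <= C.
Proof.
move=> [_ /(_ (maxn (size r) (size s)))]; rewrite /schwartz_norm.
set S := [set y | _] => Soo.
have S_le x : ((`|monomial r x| * normc (cpartials s f x))%:E <= ereal_sup S)%E.
  apply: ereal_sup_ubound; exists r, s, x; split; [exact: leq_maxl|exact: leq_maxr|].
  by rewrite Normc.normcM normc_real.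
exists (fine (ereal_sup S)) => x; rewrite -lee_fin fineK//.
by rewrite fin_numE (lt_eqF Soo) andbT gt_eqF// (lt_le_trans _ (S_le 0))// ltNyr.
Qed.

Lemma schwartz_cpartials_decays f s : schwartz f -> decays (cpartials s f).
Proof. by move=> hf; apply: monomial_decays => r; exact: schwartz_bound. Qed.

Lemma schwartz_decays f : schwartz f -> decays f.
Proof. exact: (@schwartz_cpartials_decays _ [::]). Qed.

(** There are finitely many words of length at most [N] over a finite alphabet; the bound is built
    by recursion on the first letter. It turns a bound for each derivative into one for all
    derivatives of bounded order, as a Schwartz norm demands. *)
Lemma words_ubound (B : seq 'I_d -> R) N :
  exists C : R, forall s, (size s <= N)%N -> B s <= C.
Proof.
elim: N B => [|N IH] B.
  by exists (B [::]) => s; rewrite leqn0 => /nilP ->.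
have /choice[C hC] i := IH (fun s => B (i :: s)).
exists (`|B [::]| + \sum_i `|C i|) => -[_|i s].
  by rewrite (le_trans (ler_norm _))// lerDl sumr_ge0.
rewrite ltnS => /hC h; apply: le_trans (h i) _.
rewrite (bigD1 i)//= addrCA (le_trans (ler_norm _))// lerDl addr_ge0//.
by rewrite sumr_ge0.
Qed.

(* A class of rapidly decreasing functions that is stable under partial derivatives
   consists of Schwartz functions. *)
Lemma schwartz_coind (W : (V -> R[i]) -> Prop) :
  (forall f, W f -> ccontinuous f) ->
  (forall f x i, W f -> cderivable f x i) ->
  (forall f, W f -> decays f) ->
  (forall f i, W f -> W (cpartial i f)) ->
  forall f, W f -> schwartz f.
Proof.
move=> Wc Wd Wdec Wp f Wf.
have Ws s : W (cpartials s f) by elim: s => //= i s IH; exact: Wp.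
split; first by move=> s; split; [exact: Wc|move=> x i; exact: Wd].
move=> N.
have /choice[B hB] s : exists C : R, forall x, wt x ^+ N * normc (cpartials s f x) <= C.
  exact: Wdec.
have [C hC] := words_ubound B N.
apply: (@le_lt_trans _ _ C%:E); last exact: ltry.
apply: ge_ereal_sup => _ [r [s [x [rN sN ->]]]].
rewrite lee_fin; apply: le_trans (hC s sN); apply: le_trans (hB s x).
rewrite Normc.normcM normc_real ler_wpM2r ?normc_ge0//.
apply: le_trans (monomial_le_wt r x) _.
exact: ler_weXn2l (wt_ge1 x) _ _ rN.
Qed.

(** The invariant class fed to [schwartz_coind]. It is closed under all the operations at once
    because differentiating a product with a coordinate or an exponential produces a sum of
    generators; every stability property of the Schwartz class then follows from one induction.
    Scalars are covered by [sgen_expi] at frequency 0. *)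
Inductive schwartz_gen : (V -> R[i]) -> Prop :=
| sgen_base f : schwartz f -> schwartz_gen f
| sgenD f g : schwartz_gen f -> schwartz_gen g -> schwartz_gen (fun x => f x + g x)
| sgen_coord j f : schwartz_gen f -> schwartz_gen (fun x => (x ord0 j)%:C * f x)
| sgen_expi (a : R[i]) (w : V) f : schwartz_gen f ->
    schwartz_gen (fun x => (a * expi (dot w x)) * f x)
| sgen_shift a f : schwartz_gen f -> schwartz_gen (fun x => f (x - a))
| sgen_conj f : schwartz_gen f -> schwartz_gen (fun x => conjc (f x)).

Lemma sgenZ (a : R[i]) f : schwartz_gen f -> schwartz_gen (fun x => a * f x).
Proof.
move=> hf; have := sgen_expi a 0 hf; congr schwartz_gen; apply/funext => x.
by rewrite dot0l expi0 mulr1.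
Qed.

Lemma schwartz_gen_props f : schwartz_gen f ->
  [/\ ccontinuous f, forall x i, cderivable f x i, decays f &
      forall i, schwartz_gen (cpartial i f)].
Proof.
elim=> {f}.
- move=> f hf; split.
  + by have [/(_ [::])[]] := hf.
  + by have [/(_ [::])[]] := hf.
  + exact: schwartz_decays.
  + move=> i; apply: sgen_base; case: hf => sf nf; split.
      by move=> s; rewrite -cpartials_rcons; exact: sf.
    (* A derivative of order at most [N] of a partial derivative is one of order at most [N.+1] of
       [f], taken along [rcons s i]. *)
    move=> N; apply: le_lt_trans (nf N.+1).
    apply: ge_ereal_sup => _ [r [s [x [rN sN ->]]]].
    apply: ereal_sup_ubound; exists r, (rcons s i), x; split.
    * exact: leq_trans rN _.
    * by rewrite size_rcons.
    * by rewrite cpartials_rcons.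
- move=> f g Gf [cf df ef pf] Gg [cg dg eg pg].
  have P i := @cpartialE _ _ (fun x => f x + g x) i _ (fun x =>
    cis_deriveD ((cderivableP _ _ _).1 (df x i)) ((cderivableP _ _ _).1 (dg x i))).
  split; [exact: ccontinuousD|by move=> x i; have [] := P i|exact: decaysD|].
  by move=> i; have [_ ->] := P i; apply: sgenD.
- move=> j f Gf [cf df ef pf].
  have P i := @cpartialE _ _ (fun x => (x ord0 j)%:C * f x) i _ (fun x =>
    cis_deriveM (cis_derive_coord x i j) ((cderivableP _ _ _).1 (df x i))).
  split.
  + by apply: ccontinuousM => //; exact: ccontinuous_coord.
  + by move=> x i; have [] := P i.
  + apply: (@decaysM _ _ _ 1 1) ef => x.
    by rewrite mul1r expr1 normc_real wt_coord.
  + by move=> i; have [_ ->] := P i; apply: sgenD; [exact: sgenZ|exact: sgen_coord].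
- move=> a w f Gf [cf df ef pf].
  have P i := @cpartialE _ _ (fun x => (a * expi (dot w x)) * f x) i _ (fun x =>
    cis_deriveM (cis_deriveM (cis_derive_cst a x i) (cis_derive_expi w x i))
     ((cderivableP _ _ _).1 (df x i))).
  split.
  + apply: ccontinuousM => //; apply: ccontinuousM; last exact: ccontinuous_expi.
    exact: ccontinuous_cst.
  + by move=> x i; have [] := P i.
  + apply: (@decaysM _ _ _ 0 (normc a)) ef => x.
    by rewrite expr0 mulr1 Normc.normcM normc_expi mulr1.
  + move=> i; have [_ ->] := P i; apply: sgenD; last by apply: sgen_expi; exact: pf.
    have := sgen_expi (a * (0 +i* w ord0 i)) w Gf; congr schwartz_gen.
    by apply/funext => x; rewrite mul0r add0r mulrA.
- move=> a f Gf [cf df ef pf].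
  have P i := @cpartialE _ _ (fun x => f (x - a)) i _ (fun x =>
    cis_derive_shift ((cderivableP _ _ _).1 (df (x - a) i))).
  split; [exact: ccontinuous_shift|by move=> x i; have [] := P i|exact: decays_shift|].
  by move=> i; have [_ ->] := P i; exact: (sgen_shift a (pf i)).
- move=> f Gf [cf df ef pf].
  have P i := @cpartialE _ _ (fun x => conjc (f x)) i _ (fun x =>
    cis_derive_conj ((cderivableP _ _ _).1 (df x i))).
  split; [exact: ccontinuous_conj|by move=> x i; have [] := P i|exact: decays_conj|].
  by move=> i; have [_ ->] := P i; exact: (sgen_conj (pf i)).
Qed.

Lemma schwartz_genP f : schwartz_gen f -> schwartz f.
Proof.
apply: schwartz_coind => {}f.
- by move=> /schwartz_gen_props[].
- by move=> x i /schwartz_gen_props[].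
- by move=> /schwartz_gen_props[].
- by move=> i /schwartz_gen_props[].
Qed.

Lemma schwartzZ (a : R[i]) f : schwartz f -> schwartz (fun x => a * f x).
Proof. by move=> hf; apply/schwartz_genP/sgenZ/sgen_base. Qed.

Lemma schwartz_coord j f : schwartz f -> schwartz (fun x => (x ord0 j)%:C * f x).
Proof. by move=> hf; apply/schwartz_genP/sgen_coord/sgen_base. Qed.

Lemma schwartz_expi (a : R[i]) (w : V) f : schwartz f ->
  schwartz (fun x => (a * expi (dot w x)) * f x).
Proof. by move=> hf; apply/schwartz_genP/sgen_expi/sgen_base. Qed.

Lemma schwartz_shift a f : schwartz f -> schwartz (fun x => f (x - a)).
Proof. by move=> hf; apply/schwartz_genP/sgen_shift/sgen_base. Qed.

Lemma schwartz_conj f : schwartz f -> schwartz (fun x => conjc (f x)).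
Proof. by move=> hf; apply/schwartz_genP/sgen_conj/sgen_base. Qed.

Lemma schwartz_cpartial i f : schwartz f -> schwartz (cpartial i f).
Proof. by move=> /sgen_base/schwartz_gen_props[_ _ _ /(_ i)/schwartz_genP]. Qed.

Lemma schwartz_ccontinuous f : schwartz f -> ccontinuous f.
Proof. by move=> [/(_ [::])[]]. Qed.

Lemma schwartz_cderivable f x i : schwartz f -> cderivable f x i.
Proof. by move=> [/(_ [::])[_]]. Qed.

Lemma schwartz_cmeasurable f : schwartz f -> cmeasurable f.
Proof. by move=> hf; exact/ccontinuous_cmeasurable/schwartz_ccontinuous. Qed.

Lemma schwartz_integrable f : schwartz f -> cintegrable (lebesgue_rV d) f.
Proof.
by move=> hf; apply: decays_integrable; [exact: schwartz_cmeasurable|exact: schwartz_decays].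
Qed.

End schwartz_closure.

(** * The Fourier transform of Schwartz functions *)

Section taylor.
Context {R : realType} {d : nat}.
Local Notation V := 'rV[R]_d.

Lemma wt_shift_le (x : V) (t : R) i N : `|t| <= 1 ->
  (wt (x + t *: basis_vec i) ^+ N)^-1 <= 2 ^+ N * (wt x ^+ N)^-1.
Proof.
move=> t1; rewrite ler_pdivlMr ?wtX_gt0// mulrC ler_pdivrMr ?wtX_gt0// -exprMn.
rewrite lerXn2r ?nnegrE ?mulr_ge0 ?wt_ge0//.
rewrite -[x in leLHS](addrK (t *: basis_vec i)).
apply: le_trans (wtD _ _) _; rewrite mulrC ler_wpM2r ?wt_ge0//.
by rewrite wtN wt_basis.
Qed.

(** The mean value inequality is applied twice on the line through [x] in the direction of the
    [i]-th basis vector, first to [h1] and then to [h] minus its linear part. Comparing the weight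
    at an intermediate point with that at [x] costs [2 ^+ N]. *)
Lemma taylor_real (h h1 h2 : V -> R) (C : R) N i :
  (forall x, is_derive x (basis_vec i) h (h1 x)) ->
  (forall x, is_derive x (basis_vec i) h1 (h2 x)) ->
  0 <= C -> (forall x, `|h2 x| <= C * (wt x ^+ N)^-1) ->
  forall x (s : R), `|s| <= 1 ->
  `|h (x + s *: basis_vec i) - h x - s * h1 x| <= (C * (2 ^+ N * (wt x ^+ N)^-1)) * s ^+ 2.
Proof.
move=> d1 d2 C0 hC x s s1; set K := (C * _).
set e := basis_vec i.
have l1 (t : R) : is_derive t 1 (fun t : R => h (x + t *: e)) (h1 (x + t *: e)).
  have [dx ex] := d1 (x + t *: e); rewrite -ex; exact: is_derive_line.
have l2 (t : R) : is_derive t 1 (fun t : R => h1 (x + t *: e)) (h2 (x + t *: e)).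
  have [dx ex] := d2 (x + t *: e); rewrite -ex; exact: is_derive_line.
have b1 (t : R) : `|t| <= `|s| -> `|h1 (x + t *: e) - h1 x| <= K * `|s|.
  move=> ts; have := @mean_value_bound _ _ _ t K l2.
  rewrite scale0r addr0 => /(_ _)/le_trans; apply.
    move=> r rt; apply: le_trans (hC _) _; rewrite ler_wpM2l//.
    by apply: wt_shift_le; rewrite (le_trans rt)// (le_trans ts).
  by rewrite ler_wpM2l// /K !mulr_ge0 ?exprn_ge0// invr_ge0 exprn_ge0 ?wt_ge0.
have l3 (t : R) : is_derive t 1 (fun t : R => h (x + t *: e) - t * h1 x) (h1 (x + t *: e) - h1 x).
  have := l1 t => l1t; apply: is_derive_eq; rewrite /GRing.scale /=; ring.
have := @mean_value_bound _ _ _ s (K * `|s|) l3 b1.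
rewrite scale0r addr0 mul0r subr0 -mulrA -expr2 real_normK ?num_real//.
by rewrite [_ - s * _ - _]addrAC.
Qed.

(** The remainder keeps a decaying weight in [x], so that it can be integrated over the whole space.
    The leading 2 accounts for the real and the imaginary part. *)
Lemma schwartz_taylor (f : V -> R[i]) i N : schwartz f ->
  exists2 C : R, 0 <= C & forall x (s : R), `|s| <= 1 ->
  normc (f (x + s *: basis_vec i) - f x - s%:C * cpartial i f x) <=
    C * (wt x ^+ N)^-1 * s ^+ 2.
Proof.
move=> hf; have hf1 := schwartz_cpartial i hf; have hf2 := schwartz_cpartial i hf1.
have [C C0 hC] := decays_bound N (schwartz_decays hf2).
exists (2 * C * 2 ^+ N) => [|x s s1]; first by rewrite !mulr_ge0 ?exprn_ge0.
have D1 y := (cderivableP f y i).1 (schwartz_cderivable y i hf).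
have D2 y := (cderivableP _ y i).1 (schwartz_cderivable y i hf1).
apply: le_trans (normc_le_ReIm _) _; rewrite !ReImE /= mul0r mul0r subr0 addr0.
have tr := @taylor_real _ _ _ C N i (fun y => (D1 y).1) (fun y => (D2 y).1) C0
  (fun y => le_trans (normr_Re _) (hC y)) x s s1.
have ti := @taylor_real _ _ _ C N i (fun y => (D1 y).2) (fun y => (D2 y).2) C0
  (fun y => le_trans (normr_Im _) (hC y)) x s s1.
apply: le_trans (lerD tr ti) _.
by rewrite le_eqVlt; apply/orP; left; apply/eqP; ring.
Qed.

Lemma le_small0 (a K : R) : (forall s, 0 < s -> s <= 1 -> a <= K * s) -> a <= 0.
Proof.
move=> H; rewrite leNgt; apply/negP => a0.
have K0 : a <= K by have := H 1; rewrite mulr1; apply.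
have Kp : 0 < K by exact: lt_le_trans K0.
(* This point is at most 1 because [a <= K], and it yields [a <= a / 2]. *)
have := H (a / (2 * K)).
rewrite divr_gt0 ?mulr_gt0// => /(_ isT).
have -> : a / (2 * K) <= 1 by rewrite ler_pdivrMr ?mulr_gt0// mul1r; lra.
move=> /(_ isT); have -> : K * (a / (2 * K)) = a / 2 by field; rewrite gt_eqF.
lra.
Qed.

End taylor.

Section fourier_schwartz.
Context {R : realType} {d : nat} (hbar : R) (hbar_gt0 : 0 < hbar).
Local Notation V := 'rV[R]_d.
Local Notation mu := (lebesgue_rV d).
Implicit Types (f g : V -> R[i]) (x xi : V) (i : 'I_d).

Local Notation cn := (normalization d hbar : R[i]).

Lemma dot_basis x (s : R) i : dot x (s *: basis_vec i) = s * x ord0 i.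
Proof.
rewrite /dot (bigD1 i)//= big1 => [|j ji]; rewrite !mxE eqxx /=.
  by rewrite eqxx mulr1 addr0 mulrC.
by rewrite (negbTE ji) !mulr0.
Qed.

Lemma measurable_phase (xi : V) : measurable_fun setT (fun x => - (dot xi x / hbar)).
Proof.
apply: measurable_funN; apply: measurable_funM; last exact: measurable_cst.
by apply: (@measurable_fun_dot _ _ _ _ (fun=> xi) (fun x => x));
  [exact: measurable_cst|exact: measurable_id].
Qed.

Lemma cmeasurable_phase (xi : V) : cmeasurable (fun x => expi (- (dot xi x / hbar))).
Proof. by apply: cmeasurable_expi; exact: measurable_phase. Qed.

Lemma fourier_integrable f xi : cintegrable mu f ->
  cintegrable mu (fun x => expi (- (dot xi x / hbar)) * f x).
Proof.
apply: (@cintegrableMl _ _ _ _ _ 1); first exact: cmeasurable_phase.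
by move=> x; rewrite normc_expi.
Qed.

Lemma fourier_bound f xi : cintegrable mu f ->
  normc (fourier hbar f xi) <= normc cn * \int[mu]_x normc (f x).
Proof.
move=> fi; rewrite /fourier Normc.normcM ler_wpM2l ?normc_ge0//.
apply: (le_normc_cintegral (fourier_integrable xi fi) (cintegrable_normc fi)) => x.
by rewrite Normc.normcM normc_expi mul1r.
Qed.

Lemma fourierZ (a : R[i]) f xi : cintegrable mu f ->
  fourier hbar (fun x => a * f x) xi = a * fourier hbar f xi.
Proof.
move=> fi; rewrite /fourier mulrCA; congr (_ * _).
rewrite -cintegralZ; last exact: fourier_integrable.
by apply: eq_cintegral => x; rewrite mulrCA.
Qed.

Lemma wtX_decays f k : decays f -> decays (fun x => (wt x ^+ k)%:C * f x).
Proof.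
by apply: (@decaysM _ _ _ k 1) => x; rewrite normc_real mul1r ger0_norm// exprn_ge0 ?wt_ge0.
Qed.

Lemma wtX_integrable f k : cmeasurable f -> decays f ->
  mu.-integrable setT (EFin \o (fun x => wt x ^+ k * normc (f x))).
Proof.
move=> mf df.
have : cintegrable mu (fun x => (wt x ^+ k)%:C * f x).
  apply: decays_integrable; last exact: wtX_decays.
  apply: cmeasurableM => //; apply: cmeasurable_real.
  by apply: measurable_funX; exact: measurable_wt.
move=> /cintegrable_normc; congr (integrable _ _ _); apply/funext => x /=.
by rewrite Normc.normcM normc_real ger0_norm// exprn_ge0 ?wt_ge0.
Qed.

(** The transform is Lipschitz, with a constant proportional to the integral of [wt * |f|] divided
    by [hbar]. *)
Lemma fourier_ccontinuous f : cmeasurable f -> decays f -> ccontinuous (fourier hbar f).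
Proof.
move=> mf df; have fi := decays_integrable mf df.
have wi := wtX_integrable 1 mf df.
apply: (@lipschitz_ccontinuous _ _ _ (normc cn * \int[mu]_x (hbar^-1 * (wt x ^+ 1 * normc (f x))))).
  rewrite mulr_ge0 ?normc_ge0// Rintegral_ge0// => x _.
  by rewrite !mulr_ge0 ?invr_ge0 ?(ltW hbar_gt0) ?normc_ge0// exprn_ge0 ?wt_ge0.
move=> xi eta; rewrite /fourier -mulrBr -cintegralB; [|exact: fourier_integrable..].
rewrite Normc.normcM -mulrA ler_wpM2l ?normc_ge0//.
set S := \sum_i _.
have S0 : 0 <= S by rewrite sumr_ge0.
have wi' := real_integrableZ hbar^-1 wi.
rewrite mulrC -RintegralZl//.
apply: le_normc_cintegral.
- by apply: cintegrableB; exact: fourier_integrable.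
- exact: real_integrableZ.
move=> x; rewrite -mulrBl Normc.normcM expr1 2!mulrA ler_wpM2r ?normc_ge0//.
apply: le_trans (normc_expiB _ _) _.
have -> : - (dot xi x / hbar) - - (dot eta x / hbar) = - (dot (xi - eta) x / hbar).
  by rewrite dotDl dotNl; ring.
rewrite normrN normrM [`|hbar^-1|]ger0_norm ?invr_ge0 ?(ltW hbar_gt0)//.
rewrite mulrAC ler_wpM2r ?invr_ge0 ?(ltW hbar_gt0)// dotC mulrC.
apply: le_trans (normr_dot _ _) _; rewrite ler_wpM2l ?wt_ge0//.
by apply: ler_sum => i _; rewrite !mxE.
Qed.

(** Differentiation under the integral sign: the remainder of the exponential is quadratic in the
    increment, with a coefficient dominated by [wt x ^+ 2], and [f] has a finite moment of that
    order. *)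
Lemma fourier_cis_derive f xi i : cmeasurable f -> decays f ->
  cis_derive (fourier hbar f) xi i
    (fourier hbar (fun x => (0 +i* (- hbar^-1)) * ((x ord0 i)%:C * f x)) xi).
Proof.
move=> mf df; have fi := decays_integrable mf df.
have wi := wtX_integrable 2 mf df.
set g := fun x => _.
have gi : cintegrable mu g.
  apply: cintegrableZ; apply: decays_integrable.
    apply: cmeasurableM => //; apply: cmeasurable_real; exact: measurable_rV_coordT.
  by apply: (@decaysM _ _ _ 1 1) df => x; rewrite mul1r expr1 normc_real wt_coord.
apply: (@cis_derive_quadratic _ _ _ _ _ _
   (normc cn * \int[mu]_x (3 * hbar^-1 ^+ 2 * (wt x ^+ 2 * normc (f x))))) => s _.
rewrite /fourier mulrCA -mulrBr -mulrBr -cintegralZ; last exact: fourier_integrable.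
rewrite -cintegralB; [|exact: fourier_integrable..].
rewrite -cintegralB; last 2 first.
- by apply: cintegrableB; exact: fourier_integrable.
- by apply: cintegrableZ; exact: fourier_integrable.
rewrite Normc.normcM -mulrA ler_wpM2l ?normc_ge0//.
have wi' := real_integrableZ (3 * hbar^-1 ^+ 2) wi.
rewrite mulrC -RintegralZl//.
apply: le_normc_cintegral.
- apply: cintegrableB; first by apply: cintegrableB; exact: fourier_integrable.
  by apply: cintegrableZ; exact: fourier_integrable.
- exact: real_integrableZ.
move=> x.
have -> : - (dot (xi + s *: basis_vec i) x / hbar) = - (dot xi x / hbar) + - (s * x ord0 i / hbar).
  by rewrite dotDl [dot (s *: _) _]dotC dot_basis; ring.
rewrite expiD.
have -> : expi (- (dot xi x / hbar)) * expi (- (s * x ord0 i / hbar)) * f x -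
  expi (- (dot xi x / hbar)) * f x - s%:C * (expi (- (dot xi x / hbar)) * g x) =
  expi (- (dot xi x / hbar)) * (f x * (expi (- (s * x ord0 i / hbar)) - 1 -
    (0 +i* (- (s * x ord0 i / hbar))))).
  have -> : 0 +i* (- (s * x ord0 i / hbar)) = s%:C * ((0 +i* (- hbar^-1)) * (x ord0 i)%:C).
    by apply: complexP; rewrite !ReImE /=; ring.
  by rewrite /g; ring.
rewrite !Normc.normcM normc_expi mul1r mulrC.
rewrite !mulrA ler_wpM2r ?normc_ge0//.
apply: le_trans (normc_expi_quadratic _) _.
have -> : 3 * (- (s * x ord0 i / hbar)) ^+ 2 = s ^+ 2 * 3 * hbar^-1 ^+ 2 * (x ord0 i) ^+ 2 by ring.
have -> : s ^+ 2 * 3 / hbar / hbar * wt x * wt x = s ^+ 2 * 3 * hbar^-1 ^+ 2 * wt x ^+ 2 by ring.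
apply: (ler_wpM2l (mulr_ge0 (mulr_ge0 (sqr_ge0 s) (ler0n _ 3)) (sqr_ge0 _))).
by rewrite -[x ord0 i ^+ 2]real_normK ?num_real// lerXn2r ?nnegrE ?wt_ge0// wt_coord.
Qed.

Lemma fourier_shift f a xi : cintegrable mu f ->
  fourier hbar (fun x => f (x - a)) xi = expi (- (dot xi a / hbar)) * fourier hbar f xi.
Proof.
move=> fi; rewrite /fourier mulrCA; congr (_ * _).
have e x : expi (- (dot xi (x + a) / hbar)) * f x =
    expi (- (dot xi a / hbar)) * (expi (- (dot xi x / hbar)) * f x).
  by rewrite dotDr mulrA -expiD; congr (expi _ * _); ring.
have ci : cintegrable mu (fun x => expi (- (dot xi (x + a) / hbar)) * f x).
  by rewrite (funext e); apply: cintegrableZ; exact: fourier_integrable.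
have [_] := cintegral_affine (- a) (oner_neq0 R) ci.
rewrite normr1 expr1n invr1 mul1r => H.
rewrite -cintegralZ; last exact: fourier_integrable.
rewrite -(eq_cintegral _ e) -H; apply: eq_cintegral => x.
by rewrite scale1r subrK.
Qed.

(** In place of an integration by parts, the transform of [f (. + s e_i)] is expanded in two ways:
    exactly, as a phase times the transform of [f], and through the Taylor bound, whose remainder is
    integrable. Hence [s] times the discrepancy is O(s^2), and dividing by [s] shows that it
    vanishes. *)
Lemma fourier_cpartial f i xi : schwartz f ->
  fourier hbar (cpartial i f) xi = (0 +i* (xi ord0 i / hbar)) * fourier hbar f xi.
Proof.
move=> hf; have fi := schwartz_integrable hf.
have pi := schwartz_integrable (schwartz_cpartial i hf).
have [C C0 hC] := schwartz_taylor i (2 * d) hf.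
have wi := real_integrableZ C (@integrable_wt R d).
apply/eqP; rewrite -subr_eq0 -normr_eq0; apply/eqP.
set Ff := fourier hbar f xi; set Fp := fourier hbar _ xi.
set z := (0 +i* (xi ord0 i / hbar)).
suff: normc (Fp - z * Ff) <= 0.
  by move=> h; rewrite normc_def -normcE; congr (_%:C); apply/eqP; rewrite eq_le h normc_ge0.
apply: (@le_small0 _ _ (normc cn * \int[mu]_x (C * (wt x ^+ (2 * d))^-1) +
   3 * (xi ord0 i / hbar) ^+ 2 * normc Ff)) => s s0 s1.
have ns : `|s| <= 1 by rewrite ger0_norm// ltW.
have fsi : cintegrable mu (fun x => f (x - - (s *: basis_vec i))).
  by apply: schwartz_integrable; exact: schwartz_shift.
have hA : normc (expi (s * xi ord0 i / hbar) * Ff - Ff - s%:C * Fp) <=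
    normc cn * \int[mu]_x (C * (wt x ^+ (2 * d))^-1) * s ^+ 2.
  have -> : expi (s * xi ord0 i / hbar) * Ff =
    fourier hbar (fun x => f (x - - (s *: basis_vec i))) xi.
    by rewrite fourier_shift// dotNr dot_basis; congr (expi _ * _); ring.
  rewrite /Ff /Fp /fourier mulrCA -mulrBr -mulrBr -cintegralZ; last exact: fourier_integrable.
  rewrite -cintegralB; [|exact: fourier_integrable..].
  rewrite -cintegralB; last 2 first.
  - by apply: cintegrableB; exact: fourier_integrable.
  - by apply: cintegrableZ; exact: fourier_integrable.
  rewrite Normc.normcM -mulrA ler_wpM2l ?normc_ge0//.
  rewrite mulrC -RintegralZl//.
  apply: le_normc_cintegral.
  - apply: cintegrableB; first by apply: cintegrableB; exact: fourier_integrable.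
    by apply: cintegrableZ; exact: fourier_integrable.
  - exact: real_integrableZ.
  move=> x; rewrite opprK.
  have -> : expi (- (dot xi x / hbar)) * f (x + s *: basis_vec i) -
    expi (- (dot xi x / hbar)) * f x - s%:C * (expi (- (dot xi x / hbar)) * cpartial i f x) =
    expi (- (dot xi x / hbar)) * (f (x + s *: basis_vec i) - f x - s%:C * cpartial i f x) by ring.
  rewrite Normc.normcM normc_expi mul1r [X in _ <= X]mulrC; exact: hC.
have hB : normc ((expi (s * xi ord0 i / hbar) - 1 - (0 +i* (s * xi ord0 i / hbar))) * Ff) <=
    3 * (xi ord0 i / hbar) ^+ 2 * normc Ff * s ^+ 2.
  rewrite Normc.normcM; apply: le_trans (ler_wpM2r (normc_ge0 _) (normc_expi_quadratic _)) _.
  by rewrite le_eqVlt; apply/orP; left; apply/eqP; ring.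
have e : s%:C * (Fp - z * Ff) =
   (expi (s * xi ord0 i / hbar) - 1 - (0 +i* (s * xi ord0 i / hbar))) * Ff -
   (expi (s * xi ord0 i / hbar) * Ff - Ff - s%:C * Fp).
  have -> : 0 +i* (s * xi ord0 i / hbar) = s%:C * z.
    by apply: complexP; rewrite /z !ReImE /=; ring.
  by ring.
have : normc (s%:C * (Fp - z * Ff)) <= s * ((normc cn * \int[mu]_x (C * (wt x ^+ (2 * d))^-1) +
   3 * (xi ord0 i / hbar) ^+ 2 * normc Ff) * s).
  rewrite e; apply: le_trans (normcB _ _) _; apply: le_trans (lerD hB hA) _.
  by rewrite le_eqVlt; apply/orP; left; apply/eqP; ring.
by rewrite Normc.normcM normc_real gtr0_norm// ler_pM2l.
Qed.

Lemma fourier_coord f i xi : schwartz f ->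
  (xi ord0 i)%:C * fourier hbar f xi =
  fourier hbar (fun x => (0 +i* (- hbar)) * cpartial i f x) xi.
Proof.
move=> hf; rewrite fourierZ; last exact/schwartz_integrable/schwartz_cpartial.
rewrite fourier_cpartial// mulrA; congr (_ * _).
by apply: complexP; rewrite !ReImE /=; field; rewrite gt_eqF.
Qed.

Lemma fourier_monomial f r : schwartz f -> exists2 g, schwartz g &
  forall xi, (monomial r xi)%:C * fourier hbar f xi = fourier hbar g xi.
Proof.
move=> hf; elim: r => [|i r [g hg IH]].
  by exists f => // xi; rewrite /monomial big_nil mul1r.
exists (fun x => (0 +i* (- hbar)) * cpartial i g x).
  by apply: schwartzZ; exact: schwartz_cpartial.
move=> xi; rewrite -fourier_coord// -IH /monomial big_cons mulrA.
by congr (_ * _); rewrite rmorphM.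
Qed.

Lemma fourier_decays f : schwartz f -> decays (fourier hbar f).
Proof.
move=> hf; apply: monomial_decays => r.
have [g hg e] := fourier_monomial r hf.
exists (normc cn * \int[mu]_x normc (g x)) => xi.
rewrite -normc_real -Normc.normcM e; apply: fourier_bound; exact: schwartz_integrable.
Qed.

(** The transforms of Schwartz functions form a class stable under partial derivatives, since a
    derivative of a transform is the transform of a multiple of a coordinate times the function;
    [schwartz_coind] applies to that class. *)
Lemma schwartz_fourier f : schwartz f -> schwartz (fourier hbar f).
Proof.
move=> hf; apply: (@schwartz_coind _ _ (fun F => exists2 f, schwartz f & F = fourier hbar f)).
- move=> _ [g hg ->]; apply: fourier_ccontinuous; first exact: schwartz_cmeasurable.
  exact: schwartz_decays.
- move=> _ x i [g hg ->].
  have [dF _] := cpartialE (fun x => @fourier_cis_derive g x i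
     (schwartz_cmeasurable hg) (schwartz_decays hg)).
  exact: dF.
- by move=> _ [g hg ->]; exact: fourier_decays.
- move=> _ i [g hg ->].
  have [_ ->] := cpartialE (fun x => @fourier_cis_derive g x i
     (schwartz_cmeasurable hg) (schwartz_decays hg)).
  exists (fun x => (0 +i* (- hbar^-1)) * ((x ord0 i)%:C * g x)) => //.
  by apply: schwartzZ; exact: schwartz_coord.
- by exists f.
Qed.

End fourier_schwartz.

(** * Fourier inversion *)

Section fourier_inversion.
Context {R : realType} {d : nat} (hbar : R) (hbar_gt0 : 0 < hbar).
Local Notation V := 'rV[R]_d.
Local Notation mu := (lebesgue_rV d).
Local Notation cn := (normalization d hbar : R[i]).
Implicit Types (A B h : V -> R[i]) (x y z xi : V).

(** A kernel of modulus 1 does not affect the integrability of the tensor product, so integrability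
    of [A] and [B] is enough for Fubini. *)
Lemma fubini_phase (theta : V * V -> R) A B : measurable_fun setT theta ->
  cintegrable mu A -> cintegrable mu B ->
  cintegral mu (fun x => A x * cintegral mu (fun y => expi (theta (x, y)) * B y)) =
  cintegral mu (fun y => B y * cintegral mu (fun x => expi (theta (x, y)) * A x)).
Proof.
move=> mt iA iB; have mA := cintegrable_measurable iA; have mB := cintegrable_measurable iB.
pose F (z : V * V) := A z.1 * (expi (theta z) * B z.2).
have iF : cintegrable (mu \x mu)%E F.
  apply: (cintegrable_le _ (cintegrable_tensor iA iB)) => [|z].
    apply: cmeasurableM; first exact: (cmeasurable_comp mA).
    by apply: cmeasurableM; [exact: cmeasurable_expi|exact: (cmeasurable_comp mB)].
  by rewrite !Normc.normcM normc_expi mul1r.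
have i1 x : cintegrable mu (fun y => expi (theta (x, y)) * B y).
  apply: (@cintegrableMl _ _ _ _ _ 1) iB; last by move=> y; rewrite normc_expi.
  by apply: cmeasurable_expi; apply: (measurableT_comp mt); exact: pair1_measurable.
have i2 y : cintegrable mu (fun x => expi (theta (x, y)) * A x).
  apply: (@cintegrableMl _ _ _ _ _ 1) iA; last by move=> x; rewrite normc_expi.
  by apply: cmeasurable_expi; apply: (measurableT_comp mt); exact: pair2_measurable.
have e2 y x : F (x, y) = B y * (expi (theta (x, y)) * A x) by rewrite /F /=; ring.
transitivity (cintegral mu (fun x => cintegral mu (fun y => F (x, y)))).
  by apply: eq_cintegral => x; rewrite -cintegralZ.
rewrite (cfubini iF).
- by apply: eq_cintegral => y; rewrite (eq_cintegral _ (e2 y)) cintegralZ.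
- by move=> x; exact: (cintegrableZ (A x) (i1 x)).
- by move=> y; rewrite (funext (e2 y)); exact: (cintegrableZ (B y) (i2 y)).
Qed.

Lemma measurable_phase2 : measurable_fun setT (fun z : V * V => - (dot z.1 z.2 / hbar)).
Proof.
apply: measurable_funN; apply: measurable_funM; last exact: measurable_cst.
by apply: measurable_fun_dot; [exact: measurable_fst|exact: measurable_snd].
Qed.

Lemma cmeasurable_param_cintegral (K : V -> V -> R[i]) :
  cmeasurable (fun z : V * V => K z.1 z.2) ->
  cmeasurable (fun x => cintegral mu (fun y => K x y)).
Proof.
by move=> mK; exact: (@cmeasurable_cintegral2 _ _ _ _ R mu (fun p : V * V => K p.1 p.2)).
Qed.

Lemma cmeasurable_phase_cintegral h : cintegrable mu h ->
  cmeasurable (fun x => cintegral mu (fun z => expi (- (dot x z / hbar)) * h z)).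
Proof.
move=> ih; apply: cmeasurable_param_cintegral.
apply: cmeasurableM; first by apply: cmeasurable_expi; exact: measurable_phase2.
exact: (cmeasurable_comp (cintegrable_measurable ih)).
Qed.

Lemma phase_cintegral_bound h x : cintegrable mu h ->
  normc (cintegral mu (fun z => expi (- (dot x z / hbar)) * h z)) <= \int[mu]_z normc (h z).
Proof.
move=> ih.
apply: (le_normc_cintegral (fourier_integrable hbar x ih) (cintegrable_normc ih)) => z.
by rewrite Normc.normcM normc_expi mul1r.
Qed.

Lemma integrable_phase_cintegral A h : cintegrable mu A -> cintegrable mu h ->
  cintegrable mu (fun x => A x * cintegral mu (fun z => expi (- (dot x z / hbar)) * h z)).
Proof.
move=> iA ih; under eq_fun do rewrite mulrC.
apply: (cintegrableMl (cmeasurable_phase_cintegral ih) _ iA) => x.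
exact: phase_cintegral_bound.
Qed.

Lemma fourier_cmeasurable h : cintegrable mu h -> cmeasurable (fourier hbar h).
Proof.
move=> ih; apply: cmeasurableM; first exact: cmeasurable_cst.
exact: cmeasurable_phase_cintegral.
Qed.

Lemma fourier_multiplication A B : cintegrable mu A -> cintegrable mu B ->
  cintegral mu (fun x => A x * fourier hbar B x) =
  cintegral mu (fun x => fourier hbar A x * B x).
Proof.
move=> iA iB.
have key C D : cintegrable mu C -> cintegrable mu D ->
    cintegral mu (fun x => C x * fourier hbar D x) =
    cn * cintegral mu (fun x => C x * cintegral mu (fun y => expi (- (dot x y / hbar)) * D y)).
  move=> iC iD; rewrite -cintegralZ; last exact: integrable_phase_cintegral.
  by apply: eq_cintegral => x; rewrite /fourier mulrCA.
rewrite (key _ _ iA iB) (fubini_phase measurable_phase2 iA iB).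
rewrite [RHS](eq_cintegral _ (g := fun x => B x * fourier hbar A x)); last by move=> x;
  rewrite mulrC.
transitivity (cn * cintegral mu (fun x => B x * cintegral mu (fun y => expi (- (dot x y / hbar)) *
  A y))); last first.
  by rewrite -key.
apply: (congr1 (fun w : R[i] => cn * w)); apply: eq_cintegral => x.
apply: (congr1 (fun w : R[i] => B x * w)).
by apply: eq_cintegral => y; rewrite dotC.
Qed.

Lemma expi_sum (I : Type) (s : seq I) (a : I -> R) :
  expi (\sum_(i <- s) a i) = \prod_(i <- s) expi (a i).
Proof. by apply: (big_morph _ (@expiD R) (@expi0 R)). Qed.

Lemma normalization_sqr : cn * cn = ((2 * pi * hbar) ^- d)%:C.
Proof.
have p0 : 0 < 2 * pi * hbar by rewrite !mulr_gt0// pi_gt0.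
rewrite /normalization -rmorphM /=; congr (_%:C).
rewrite -powRD; last by rewrite (gt_eqF p0) implybT.
rewrite -opprD -splitr powRN powR_mulrn//; exact: ltW.
Qed.

(** The l^1 norm in the exponent makes both the integrand and its transform products over the
    coordinates, with [laplace_fourier] in each factor. *)
Lemma poisson_kernel (e : R) (v : V) : 0 < e ->
  let F := fun xi : V => (\prod_i expR (- e * `|xi ord0 i|))%:C * expi (dot v xi / hbar) in
  cintegrable mu F /\
  cintegral mu F = (\prod_i (2 * e / (e ^+ 2 + (v ord0 i / hbar) ^+ 2)))%:C.
Proof.
move=> e0 F.
have L i := laplace_fourier (v ord0 i / hbar) e0.
have [iP eP] := @cintegral_prod_coord R d _ (fun i => (L i).1).
have eF xi : F xi = \prod_i ((expR (- e * `|xi ord0 i|))%:C * expi (v ord0 i / hbar * xi ord0 i)).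
  rewrite /F big_split /= rmorph_prod -expi_sum; congr (_ * expi _).
  by rewrite /dot mulr_suml; apply: eq_bigr => i _; rewrite mulrAC.
rewrite (funext eF); split => //.
by rewrite eP rmorph_prod; apply: eq_bigr => i _; have [_] := L i.
Qed.

Lemma ccvg_unique (u : nat -> R[i]) (l1 l2 : R[i]) : ccvg u l1 -> ccvg u l2 -> l1 = l2.
Proof.
by move=> [a1 b1] [a2 b2]; apply: complexP; [exact: cvg_unique a1 a2|exact: cvg_unique b1 b2].
Qed.

Lemma ccvgZ (a : R[i]) (u : nat -> R[i]) (l : R[i]) : ccvg u l -> ccvg (fun n => a * u n) (a * l).
Proof.
move=> [h1 h2]; split; rewrite ?Re_mulc ?Im_mulc.
- under eq_fun do rewrite Re_mulc.
  by apply: cvgB; apply: cvgM => //; exact: cvg_cst.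
- under eq_fun do rewrite Im_mulc.
  by apply: cvgD; apply: cvgM => //; exact: cvg_cst.
Qed.

Lemma ccvg_real1 (a : nat -> R) (w : R[i]) : a n @[n --> \oo] --> (1 : R) ->
  ccvg (fun n => (a n)%:C * w) w.
Proof.
case: w => [p q] a1.
have L (r : R) : a n * r @[n --> \oo] --> r.
  by rewrite -[X in _ --> X]mul1r; apply: cvgM => //; exact: cvg_cst.
split => /=.
- by under eq_fun do rewrite mul0r subr0; exact: L.
- by under eq_fun do rewrite mul0r addr0; exact: L.
Qed.

(** The kernel of [poisson_kernel] at [e = 1], with [hbar] scaled out. It is left unnormalized; its
    mass [(2 * pi) ^+ d] is absorbed by the two normalizations of the double Fourier transform. *)
Definition cauchy_kernel (w : V) : R := \prod_i (2 * (1 + w ord0 i ^+ 2)^-1).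

Lemma cauchy_kernel_ge0 w : 0 <= cauchy_kernel w.
Proof. by apply: prodr_ge0 => i _; rewrite mulr_ge0// invr_ge0 addr_ge0// sqr_ge0. Qed.

Lemma cauchy_kernel_integral : cintegrable mu (fun w => (cauchy_kernel w)%:C) /\
  cintegral mu (fun w => (cauchy_kernel w)%:C) = ((2 * pi) ^+ d)%:C.
Proof.
have [c1 c2] := @cauchy_density_integral R.
have ci : cintegrable (@lebesgue_measure R) (fun s : R => (2 * (1 + s ^+ 2)^-1)%:C).
  apply: (le_cintegrable _ (real_integrableZ 2 c1)) => [|s].
    apply: cmeasurable_real; apply/measurable_EFinP;
      exact: (measurable_int _ (real_integrableZ 2 c1)).
  by rewrite normc_real ger0_norm// mulr_ge0// invr_ge0 addr_ge0// sqr_ge0.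
have [iP eP] := @cintegral_prod_coord R d _ (fun=> ci).
have E (w : V) : \prod_(i < d) (2 * (1 + w ord0 i ^+ 2)^-1)%:C = (cauchy_kernel w)%:C :> R[i].
  by rewrite /cauchy_kernel rmorph_prod.
rewrite -(funext E); split => //; rewrite eP.
by rewrite prodr_const card_ord cintegral_real RintegralZl// c2 -rmorphXn.
Qed.

Definition damping (e : R) (xi : V) : R := \prod_i expR (- e * `|xi ord0 i|).

Lemma dampingE e xi : damping e xi = expR (- e * \sum_i `|xi ord0 i|).
Proof. by rewrite mulr_sumr expR_sum. Qed.

Lemma damping_le1 e xi : 0 < e -> `|damping e xi| <= 1.
Proof.
move=> e0; rewrite dampingE ger0_norm ?expR_ge0// -expR0 ler_expR mulNr oppr_le0.
by apply: mulr_ge0; [exact: ltW|exact: sumr_ge0].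
Qed.

Lemma measurable_damping e : measurable_fun setT (damping e).
Proof.
rewrite (funext (dampingE e)); apply: (measurableT_comp (@measurable_expR R)).
apply: measurable_funM; first exact: measurable_cst.
apply: measurable_sum => i; apply: measurableT_comp => //; exact: measurable_rV_coordT.
Qed.

Lemma cvg_damping (e : nat -> R) xi : e n @[n --> \oo] --> (0 : R) ->
  damping (e n) xi @[n --> \oo] --> (1 : R).
Proof.
move=> ecvg; under eq_fun do rewrite dampingE; rewrite -expR0.
apply: continuous_cvg; first exact: continuous_expR.
have : - e n * (\sum_i `|xi ord0 i|) @[n --> \oo] --> - 0 * \sum_i `|xi ord0 i|.
  by apply: cvgM; [exact: cvgN|exact: cvg_cst].
by rewrite oppr0 mul0r.
Qed.

Lemma damped_inverse_fourier h (e : R) y : 0 < e -> cintegrable mu h ->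
  cintegral mu (fun xi => expi (- (dot (- y) xi / hbar)) * ((damping e xi)%:C *
    fourier hbar h xi)) =
  cn * (hbar ^+ d)%:C *
    cintegral mu (fun w => h ((e * hbar) *: w + y) * (cauchy_kernel w)%:C).
Proof.
move=> e0 ih.
pose A xi := (damping e xi)%:C * expi (dot y xi / hbar).
have iA : cintegrable mu A by have [] := poisson_kernel y e0.
have hE xi : expi (- (dot (- y) xi / hbar)) * ((damping e xi)%:C * fourier hbar h xi) =
   cn * (A xi * cintegral mu (fun z => expi (- (dot xi z / hbar)) * h z)).
  by rewrite dotNl mulNr opprK /fourier /A; ring.
have iAI := integrable_phase_cintegral iA ih.
rewrite (eq_cintegral _ hE) cintegralZ// -mulrA; apply: (congr1 (fun w : R[i] => cn * w)).
rewrite (fubini_phase measurable_phase2 iA ih) /=.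
pose P z := h z * (\prod_i (2 * e / (e ^+ 2 + ((y - z) ord0 i / hbar) ^+ 2)))%:C.
have PK z : cintegral mu (fun xi => expi (- (dot xi z / hbar)) * A xi) =
    (\prod_i (2 * e / (e ^+ 2 + ((y - z) ord0 i / hbar) ^+ 2)))%:C.
  have [_ <-] := poisson_kernel (y - z) e0; apply: eq_cintegral => xi.
  by rewrite /A mulrCA -expiD dotDl dotNl (dotC xi); congr (_ * expi _); ring.
transitivity (cintegral mu P); first by apply: eq_cintegral => z; rewrite /P -PK.
have eh0 : e * hbar != 0 by rewrite gt_eqF// mulr_gt0.
have iP : cintegrable mu P.
  have -> : P = fun z => h z * cintegral mu (fun xi => expi (- (dot z xi / hbar)) * A xi).
    apply/funext => z; rewrite /P -PK; apply: (congr1 (fun w : R[i] => h z * w)).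
    by apply: eq_cintegral => xi; rewrite dotC.
  exact: integrable_phase_cintegral.
(* The substitution z = (e hbar) w + y has Jacobian (e hbar)^d, and the rescaled kernel carries
   e^(-d); the factor [hbar ^+ d] of the statement is what remains. *)
have [iPa ePa] := cintegral_affine y eh0 iP.
have eP w : P ((e * hbar) *: w + y) =
  (e ^- d)%:C * (h ((e * hbar) *: w + y) * (cauchy_kernel w)%:C).
  rewrite /P mulrCA; apply: (congr1 (fun z : R[i] => h ((e * hbar) *: w + y) * z)).
  rewrite -rmorphM; apply: (congr1 (fun z : R => z%:C)).
  rewrite /cauchy_kernel -[X in _ ^- X]card_ord -exprVn -prodr_const -big_split.
  apply: eq_bigr => i _; rewrite /= !mxE.
  have -> : (y ord0 i - (e * hbar * w ord0 i + y ord0 i)) / hbar = - (e * w ord0 i).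
    by field; rewrite gt_eqF.
  have w2 : 1 + w ord0 i ^+ 2 != 0 by rewrite gt_eqF// ltr_pwDl ?sqr_ge0.
  have -> : e ^+ 2 + (- (e * w ord0 i)) ^+ 2 = e ^+ 2 * (1 + w ord0 i ^+ 2) by ring.
  by field; rewrite w2 gt_eqF.
have iPb : cintegrable mu (fun w => h ((e * hbar) *: w + y) * (cauchy_kernel w)%:C).
  have := cintegrableZ ((e ^+ d)%:C) iPa; congr cintegrable; apply/funext => w.
  by rewrite eP mulrA -rmorphM divff ?expf_neq0 ?gt_eqF// mul1r.
move: ePa; rewrite (eq_cintegral _ eP) cintegralZ// => ePa.
rewrite gtr0_norm ?mulr_gt0// in ePa.
have -> : cintegral mu P = ((e * hbar) ^+ d)%:C * (((e * hbar) ^- d)%:C * cintegral mu P).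
  by rewrite mulrA -rmorphM divff ?expf_neq0// mul1r.
rewrite -ePa mulrA -rmorphM; congr (_%:C * _).
by rewrite exprMn mulrAC divff ?mul1r// expf_neq0// gt_eqF.
Qed.

Lemma cvg_cauchy_average h (M : R) (e : nat -> R) y : ccontinuous h ->
  (forall x, normc (h x) <= M) -> e n @[n --> \oo] --> (0 : R) ->
  ccvg (fun n => cintegral mu (fun w => h ((e n * hbar) *: w + y) * (cauchy_kernel w)%:C))
    (h y * ((2 * pi) ^+ d)%:C).
Proof.
move=> ch hM ecvg; have [iQ <-] := cauchy_kernel_integral.
rewrite -cintegralZ//; have mQ := cintegrable_measurable iQ.
have iMQ : mu.-integrable setT (EFin \o (fun w => M * cauchy_kernel w)).
  apply: real_integrableZ; have := cintegrable_normc iQ; congr (integrable _ _ _).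
  by apply/funext => w; rewrite /comp normc_real ger0_norm ?cauchy_kernel_ge0.
apply: (cdominated_convergence _ _ _ iMQ).
- move=> n; apply: cmeasurableM => //; apply: ccontinuous_cmeasurable.
  exact: ccontinuous_affine.
- by apply: cmeasurableM => //; exact: cmeasurable_cst.
- move=> w.
  have cw : (e n * hbar) *: w + y @[n --> \oo] --> y.
    rewrite -[X in _ --> X]add0r -(scale0r w) -(mul0r hbar).
    by apply: cvgD; [apply: cvgZr_tmp; apply: cvgM => //; exact: cvg_cst|exact: cvg_cst].
  have hw : ccvg (fun n => h ((e n * hbar) *: w + y)) (h y).
    case: ch => ch1 ch2; split.
    + exact: (cvg_comp _ _ cw (ch1 y)).
    + exact: (cvg_comp _ _ cw (ch2 y)).
  by rewrite mulrC; under eq_fun do rewrite mulrC; exact: ccvgZ.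
- move=> n w; rewrite Normc.normcM normc_real ger0_norm ?cauchy_kernel_ge0//.
  by rewrite ler_wpM2r ?cauchy_kernel_ge0.
Qed.

(* Insert the factor [exp (- e * sum |xi_i|)] into the inverse transform: by Fubini this
   convolves [h] with a rescaled [cauchy_kernel], an approximate identity as [e -> 0]. *)
Theorem fourier_inversion h (M : R) y : ccontinuous h -> (forall x, normc (h x) <= M) ->
  cintegrable mu h -> cintegrable mu (fourier hbar h) ->
  fourier hbar (fourier hbar h) (- y) = h y.
Proof.
move=> ch hM ih iFh.
pose e (n : nat) : R := n.+1%:R^-1.
have e0 n : 0 < e n by rewrite invr_gt0.
have ecvg : e n @[n --> \oo] --> (0 : R) by exact: cvg_harmonic.
have lim1 : ccvg (fun n => cintegral mu (fun xi =>
    expi (- (dot (- y) xi / hbar)) * ((damping (e n) xi)%:C * fourier hbar h xi)))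
    (cintegral mu (fun xi => expi (- (dot (- y) xi / hbar)) * fourier hbar h xi)).
  have mF := fourier_cmeasurable ih.
  apply: (cdominated_convergence _ _ _ (cintegrable_normc iFh)).
  - move=> n; apply: cmeasurableM; first exact: cmeasurable_phase.
    by apply: cmeasurableM => //; apply: cmeasurable_real; exact: measurable_damping.
  - by apply: cmeasurableM => //; exact: cmeasurable_phase.
  - by move=> xi; apply: ccvgZ; apply: ccvg_real1; exact: cvg_damping.
  - move=> n xi; rewrite 2!Normc.normcM normc_expi mul1r normc_real.
    by apply: ler_piMl; [exact: normc_ge0|exact: damping_le1].
have lim2 : ccvg (fun n => cintegral mu (fun xi =>
    expi (- (dot (- y) xi / hbar)) * ((damping (e n) xi)%:C * fourier hbar h xi)))
    (cn * (hbar ^+ d)%:C * (h y * ((2 * pi) ^+ d)%:C)).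
  under eq_fun do rewrite damped_inverse_fourier//.
  by apply: ccvgZ; exact: (cvg_cauchy_average y ch hM ecvg).
rewrite {1}/fourier (ccvg_unique lim1 lim2).
(* The two normalizations multiply to (2 pi hbar)^(-d), which cancels the mass of the kernel
   together with [hbar ^+ d]. *)
have -> : cn * (cn * (hbar ^+ d)%:C * (h y * ((2 * pi) ^+ d)%:C)) =
  (cn * cn) * ((2 * pi) ^+ d * hbar ^+ d)%:C * h y by rewrite rmorphM /=; ring.
rewrite normalization_sqr -rmorphM -exprMn mulVf ?mul1r// expf_neq0//.
by rewrite gt_eqF// !mulr_gt0// pi_gt0.
Qed.

End fourier_inversion.

Lemma cintegral_reflect {R : realType} n (w : 'rV[R]_n) (f : 'rV[R]_n -> R[i]) :
  cintegrable (lebesgue_rV n) f ->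
  cintegrable (lebesgue_rV n) (fun x => f (w - x)) /\
  cintegral (lebesgue_rV n) (fun x => f (w - x)) = cintegral (lebesgue_rV n) f.
Proof.
move=> fi; have N1 : -1 != 0 :> R by rewrite oppr_eq0 oner_eq0.
have e x : f (-1 *: x + w) = f (w - x) by rewrite scaleN1r addrC.
have [] := cintegral_affine w N1 fi.
by rewrite (funext e) normrN normr1 expr1n invr1 mul1r.
Qed.

(** * Change of window *)

Section fourier_products.
Context {R : realType} {d : nat} (hbar : R) (hbar_gt0 : 0 < hbar).
Local Notation V := 'rV[R]_d.
Local Notation mu := (lebesgue_rV d).
Local Notation cn := (normalization d hbar : R[i]).
Implicit Types (A B h : V -> R[i]) (x y z xi : V).

(** The second factor is given as the inverse transform of [B], so that Fubini suffices and [B] need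
    only be integrable. In the change of window [B] is the transform of a product with [f], about
    which nothing more is known. *)
Lemma fourier_mul A B w : cintegrable mu A -> cintegrable mu B ->
  fourier hbar (fun y => A y * fourier hbar B (- y)) w =
  cn * cintegral mu (fun s => B s * fourier hbar A (w - s)).
Proof.
move=> iA iB.
pose A' y := expi (- (dot w y / hbar)) * A y.
have iA' : cintegrable mu A' := fourier_integrable hbar w iA.
(* The two minus signs make this literally the phase of [fourier hbar B] at [- y]. *)
pose theta (p : V * V) := - (dot (- p.1) p.2 / hbar).
have mtheta : measurable_fun setT theta.
  have -> : theta = fun p : V * V => dot p.1 p.2 / hbar.
    by apply/funext => p; rewrite /theta dotNl mulNr opprK.
  apply: measurable_funM; last exact: measurable_cst.
  by apply: measurable_fun_dot; [exact: measurable_fst|exact: measurable_snd].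
have thE y s : expi (theta (y, s)) * A' y = expi (- (dot (w - s) y / hbar)) * A y.
  rewrite /A' /theta /= mulrA -expiD; congr (expi _ * _).
  by rewrite dotNl dotDl dotNl (dotC y); ring.
have mI : cmeasurable (fun y => cintegral mu (fun s => expi (theta (y, s)) * B s)).
  apply: cmeasurable_param_cintegral; apply: cmeasurableM.
    by apply: cmeasurable_expi; move: mtheta; congr measurable_fun; apply/funext => -[].
  exact: (cmeasurable_comp (cintegrable_measurable iB)).
have iAI : cintegrable mu (fun y => A' y * cintegral mu (fun s => expi (theta (y, s)) * B s)).
  under eq_fun do rewrite mulrC.
  apply: (cintegrableMl mI (M := \int[mu]_x normc (B x)) _ iA') => y.
  exact: (phase_cintegral_bound hbar (- y) iB).
rewrite {1}/fourier.
transitivity (cn * (cn * cintegral mu (fun y => A' y * cintegral mu (fun s => expi (theta (y,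
  s)) * B s)))).
  apply: (congr1 (fun w : R[i] => cn * w)); rewrite -cintegralZ//; apply: eq_cintegral => y.
  by rewrite /fourier /A' /theta /=; ring.
rewrite (fubini_phase mtheta iA' iB) -cintegralZ; last first.
  have mJ : cmeasurable (fun s => cintegral mu (fun y => expi (theta (y, s)) * A' y)).
    apply: cmeasurable_param_cintegral; apply: cmeasurableM.
      apply: cmeasurable_expi.
      have -> : (fun p : V * V => theta (p.2, p.1)) = fun p : V * V => dot p.2 p.1 / hbar.
        by apply/funext => p; rewrite /theta dotNl mulNr opprK.
      apply: measurable_funM; last exact: measurable_cst.
      by apply: measurable_fun_dot; [exact: measurable_snd|exact: measurable_fst].
    exact: (cmeasurable_comp (cintegrable_measurable iA')).
  under eq_fun do rewrite mulrC.
  apply: (cintegrableMl mJ (M := \int[mu]_x normc (A x)) _ iB) => s.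
  rewrite (eq_cintegral _ (fun y => thE y s)).
  exact: (phase_cintegral_bound hbar (w - s) iA).
apply: (congr1 (fun w : R[i] => cn * w)); apply: eq_cintegral => s.
rewrite mulrCA; apply: (congr1 (fun w : R[i] => B s * w)); rewrite /fourier.
by apply: (congr1 (fun w : R[i] => cn * w)); apply: eq_cintegral => y.
Qed.

Lemma schwartz_inversion h y : schwartz h -> fourier hbar (fourier hbar h) (- y) = h y.
Proof.
move=> hh; have [M _ hM] := decays_bounded (schwartz_decays hh).
apply: (fourier_inversion hbar_gt0 y (schwartz_ccontinuous hh) hM).
- exact: schwartz_integrable.
- exact/schwartz_integrable/schwartz_fourier.
Qed.

Lemma fourier_schwartz_mul A B w : schwartz A -> schwartz B ->
  fourier hbar (fun y => A y * B y) w =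
  cn * cintegral mu (fun s => fourier hbar B s * fourier hbar A (w - s)).
Proof.
move=> hA hB.
have -> : (fun y => A y * B y) = fun y => A y * fourier hbar (fourier hbar B) (- y).
  by apply/funext => y; rewrite schwartz_inversion.
apply: fourier_mul.
- exact: schwartz_integrable.
- exact/schwartz_integrable/schwartz_fourier.
Qed.

(** Submultiplicativity bounds [wt z] by [wt y * wt (z - y)], which takes [N] powers from each
    factor; the further [2 * d] powers available from [A] keep the bound integrable in [y]. *)
Lemma decays_convolution A B N : decays A -> decays B ->
  exists2 C : R, 0 <= C & forall z y, normc (A y) * normc (B (z - y)) <=
    C * (wt z ^+ N)^-1 * (wt y ^+ (2 * d))^-1.
Proof.
move=> dA dB; have [a a0 ha] := decays_bound (N + 2 * d) dA.
have [b b0 hb] := decays_bound N dB.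
exists (a * b) => [|z y]; first exact: mulr_ge0.
apply: le_trans (ler_pM (normc_ge0 _) (normc_ge0 _) (ha y) (hb (z - y))) _.
have -> : a * (wt y ^+ (N + 2 * d))^-1 * (b * (wt (z - y) ^+ N)^-1) =
  a * b * ((wt y * wt (z - y)) ^+ N)^-1 * (wt y ^+ (2 * d))^-1.
  by rewrite exprD exprMn !invfM; ring.
rewrite ler_wpM2r ?invr_ge0 ?exprn_ge0 ?wt_ge0// ler_wpM2l ?mulr_ge0//.
rewrite lef_pV2 ?posrE ?wtX_gt0 ?exprn_gt0 ?mulr_gt0 ?wt_gt0//.
rewrite lerXn2r ?nnegrE ?mulr_ge0 ?wt_ge0//.
by rewrite -[z in leLHS](subrKC y); exact: wtD.
Qed.

Lemma decays_opp B : decays B -> decays (fun y => B (- y)).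
Proof. by move=> hB N; have [C hC] := hB N; exists C => y; rewrite -wtN. Qed.

(** The geometric mean of the two bounds, with [a * b <= (a + b) ^+ 2]. It merges a bound in one
    variable with a bound in another into a bound in both; since exponents are halved,
    [fourier_mul_shift_decay] starts from decay of order [2 * N]. *)
Lemma sqr_bound (k a b u v : R) : 0 <= a -> 0 <= b -> 0 <= u -> 0 <= v -> 0 <= k ->
  k <= a * u ^+ 2 -> k <= b * v ^+ 2 -> k <= (a + b) * u * v.
Proof.
move=> a0 b0 u0 v0 k0 ka kb.
rewrite -(@ler_pXn2r _ 2) ?nnegrE ?mulr_ge0 ?addr_ge0//.
apply: (@le_trans _ _ ((a * u ^+ 2) * (b * v ^+ 2))); first by rewrite expr2 ler_pM.
have -> : ((a + b) * u * v) ^+ 2 = (a + b) ^+ 2 * (u ^+ 2 * v ^+ 2) by ring.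
have -> : a * u ^+ 2 * (b * v ^+ 2) = a * b * (u ^+ 2 * v ^+ 2) by ring.
by rewrite ler_wpM2r ?mulr_ge0 ?sqr_ge0//; nra.
Qed.

(* The short-time Fourier transform of [A] with window [B] decays in [z] by the rapid
   decrease of [A] and [B], and in [w] by that of their Fourier transforms. *)
Lemma fourier_mul_shift_decay A B N : schwartz A -> schwartz B ->
  exists2 C : R, 0 <= C & forall z w,
    normc (fourier hbar (fun y => A y * B (y - z)) w) <=
    C * (wt z ^+ N)^-1 * (wt w ^+ N)^-1.
Proof.
move=> hA hB.
have [C1 C10 h1] := decays_convolution (2 * N) (schwartz_decays hA)
  (decays_opp (schwartz_decays hB)).
have [C2 C20 h2] := decays_convolution (2 * N) (schwartz_decays (schwartz_fourier hbar_gt0 hB))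
  (schwartz_decays (schwartz_fourier hbar_gt0 hA)).
pose W : R := \int[mu]_y (wt (y : V) ^+ (2 * d))^-1.
have W0 : 0 <= W by apply: Rintegral_ge0 => y _; rewrite invr_ge0 exprn_ge0 ?wt_ge0.
have n0 : 0 <= normc cn by exact: normc_ge0.
exists (normc cn * C1 * W + normc cn * C2 * W) => [|z w].
  by rewrite addr_ge0 ?mulr_ge0.
have iW (k : R) : mu.-integrable setT (EFin \o (fun y => k * (wt y ^+ (2 * d))^-1)).
  exact: integrable_wtZ.
have sq (x : V) : (wt x ^+ (2 * N))^-1 = ((wt x ^+ N)^-1) ^+ 2.
  by rewrite exprVn -exprM mulnC.
apply: sqr_bound; rewrite ?mulr_ge0 ?normc_ge0 ?invr_ge0 ?exprn_ge0 ?wt_ge0//.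
- rewrite -sq -!mulrA.
  have hBz : schwartz (fun y => B (y - z)) by exact: schwartz_shift.
  have iAB : cintegrable mu (fun y => A y * B (y - z)).
    have [M _ hM] := decays_bounded (schwartz_decays hA).
    apply: (cintegrableMl (schwartz_cmeasurable hA) hM); exact: schwartz_integrable.
  rewrite {1}/fourier Normc.normcM ler_wpM2l//.
  have -> : C1 * (W * (wt z ^+ (2 * N))^-1) =
    \int[mu]_y (C1 * (wt z ^+ (2 * N))^-1 * (wt y ^+ (2 * d))^-1).
    by rewrite RintegralZl ?mulrA//; [rewrite mulrAC|exact: integrable_wt].
  apply: (le_normc_cintegral (fourier_integrable hbar w iAB) (iW _)) => y.
  rewrite !Normc.normcM normc_expi mul1r; apply: le_trans (h1 z y).
  by rewrite opprB.
- rewrite -sq -!mulrA.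
  have hBz : schwartz (fun y => B (y - z)) by exact: schwartz_shift.
  rewrite fourier_schwartz_mul// Normc.normcM ler_wpM2l//.
  have -> : C2 * (W * (wt w ^+ (2 * N))^-1) =
    \int[mu]_y (C2 * (wt w ^+ (2 * N))^-1 * (wt y ^+ (2 * d))^-1).
    by rewrite RintegralZl ?mulrA//; [rewrite mulrAC|exact: integrable_wt].
  have hFBz := schwartz_fourier hbar_gt0 hBz.
  have hFA := schwartz_fourier hbar_gt0 hA.
  apply: le_normc_cintegral (iW _) _ => [|s].
    have [M _ hM] := decays_bounded (schwartz_decays hFBz).
    apply: (cintegrableMl (schwartz_cmeasurable hFBz) hM).
    by have [] := cintegral_reflect w (schwartz_integrable hFA).
  rewrite fourier_shift; last exact: schwartz_integrable.
  by rewrite -mulrA Normc.normcM normc_expi mul1r Normc.normcM; exact: h2.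
Qed.

(* Average against the approximate identity [cauchy_kernel], which is bounded. *)
Lemma ccontinuous_integral_eq0 h (M : R) y : ccontinuous h ->
  (forall x, normc (h x) <= M) -> cintegrable mu h ->
  \int[mu]_x normc (h x) = 0 -> h y = 0.
Proof.
move=> ch hM ih h0.
pose e (n : nat) : R := n.+1%:R^-1.
have e0 n : 0 < e n by rewrite invr_gt0.
have ecvg : e n @[n --> \oo] --> (0 : R) by exact: cvg_harmonic.
have [iQ _] := @cauchy_kernel_integral R d.
have ker_le w : normc (@cauchy_kernel R d w)%:C <= 2 ^+ d.
  rewrite normc_real ger0_norm ?cauchy_kernel_ge0// -[X in _ ^+ X]card_ord -prodr_const.
  apply: ler_prod => i _; rewrite mulr_ge0 ?invr_ge0 ?addr_ge0 ?sqr_ge0//=.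
  by rewrite ler_piMr// invf_le1 ?ltr_pwDl ?sqr_ge0// lerDl sqr_ge0.
have z n : cintegral mu (fun w => h ((e n * hbar) *: w + y) * (cauchy_kernel w)%:C) = 0.
  have eh0 : e n * hbar != 0 by rewrite gt_eqF// mulr_gt0.
  have inh : cintegrable mu (fun x => (normc (h x))%:C).
    apply: (cintegrable_le _ ih) => [|x].
      by apply: cmeasurable_real; exact/measurable_normc/(cintegrable_measurable ih).
    by rewrite normc_real ger0_norm ?normc_ge0.
  have [ia _] := cintegral_affine y eh0 ih.
  have [[ina _] ena] := cintegral_affine y eh0 inh.
  apply: Normc.eq0_normc; apply/eqP; rewrite eq_le normc_ge0 andbT.
  have iP : cintegrable mu (fun w => h ((e n * hbar) *: w + y) * (cauchy_kernel w)%:C).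
    by under eq_fun do rewrite mulrC; apply: (cintegrableMl (cintegrable_measurable iQ) ker_le ia).
  have : normc (cintegral mu (fun w => h ((e n * hbar) *: w + y) * (cauchy_kernel w)%:C)) <=
      \int[mu]_w (2 ^+ d * normc (h ((e n * hbar) *: w + y))).
    apply: (le_normc_cintegral iP); first exact: real_integrableZ.
    by move=> w; rewrite Normc.normcM mulrC ler_wpM2r ?normc_ge0.
  move=> /le_trans; apply; rewrite RintegralZl//.
  move: ena; rewrite !cintegral_real h0 -rmorphM mulr0 => /(congr1 (@complex.Re R)) /= ->.
  by rewrite mulr0.
have := cvg_cauchy_average hbar y ch hM ecvg; rewrite (funext z) => l0.
have c0 : ccvg (fun=> 0 : R[i]) 0 by split; exact: cvg_cst.
have := ccvg_unique c0 l0 => /esym/eqP; rewrite mulf_eq0 => /orP[/eqP//|].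
move=> /eqP/(congr1 (@complex.Re R)) /= /eqP; rewrite expf_eq0 => /andP[_].
by rewrite gt_eqF// mulr_gt0// pi_gt0.
Qed.

End fourier_products.

Lemma ge0_integralZl_real {R : realType} dT (T : measurableType dT) (m : {measure set T -> \bar R})
    (k : R) (h : T -> R) : 0 <= k -> (forall x, 0 <= h x) -> measurable_fun setT h ->
  (\int[m]_x (k * h x)%:E = k%:E * \int[m]_x (h x)%:E)%E.
Proof.
move=> k0 h0 mh; rewrite -ge0_integralZl_EFin//.
- by move=> x _; rewrite lee_fin.
- by apply/measurable_EFinP.
Qed.

Section window_change.
Context {R : realType} {d : nat} (hbar : R) (hbar_gt0 : 0 < hbar).
Local Notation V := 'rV[R]_d.
Local Notation mu := (lebesgue_rV d).
Local Notation cn := (normalization d hbar : R[i]).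
Implicit Types (A B f g h : V -> R[i]) (x y z xi : V).

Definition wtker x : R := (wt x ^+ (2 * d))^-1.

Definition wtmass : R := \int[mu]_x wtker x.

Lemma wtker_ge0 x : 0 <= wtker x.
Proof. by rewrite invr_ge0 exprn_ge0 ?wt_ge0. Qed.

Lemma wtker_le1 x : wtker x <= 1.
Proof. by rewrite invf_le1 ?wtX_gt0// exprn_ege1// wt_ge1. Qed.

Lemma measurable_wtker : measurable_fun setT wtker.
Proof. by apply/measurable_EFinP; exact: (measurable_int _ integrable_wt). Qed.

Lemma wtmass_ge0 : 0 <= wtmass.
Proof. by apply: Rintegral_ge0 => x _; exact: wtker_ge0. Qed.

Lemma wtker_translate (a : V) : (\int[mu]_x (wtker (x + a))%:E = wtmass%:E)%E.
Proof.
rewrite EFin_Rintegral; last exact: integrable_wt.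
have := @ge0_integral_affine R d 1 a (EFin \o wtker) (oner_neq0 R).
rewrite normr1 expr1n invr1 mul1e => <-.
- by apply: eq_integral => x _; rewrite scale1r.
- by apply/measurable_EFinP; exact: measurable_wtker.
- by move=> x; rewrite lee_fin wtker_ge0.
Qed.

(** Young's inequality in L^1 for the convolution of [fourier_mul]. The transform of [A] is
    controlled by a multiple of a fixed integrable weight, so that dependence on further parameters
    is confined to the constant [D]. *)
Lemma fourier_mul_L1 A B (D M : R) : cintegrable mu A -> cintegrable mu B -> 0 <= D ->
  (forall w, normc (fourier hbar A w) <= D * wtker w) ->
  (\int[mu]_s (normc (B s))%:E <= M%:E)%E ->
  (\int[mu]_w (normc (fourier hbar (fun y => A y * fourier hbar B (- y)) w))%:E
    <= (normc cn * D * wtmass * M)%:E)%E.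
Proof.
move=> iA iB D0 hD hM; set k := normc cn * D.
have k0 : 0 <= k by rewrite mulr_ge0 ?normc_ge0.
have mB := cintegrable_measurable iB.
have mnB := measurable_normc mB.
have mFA := fourier_cmeasurable hbar iA.
pose G (p : V * V) : R := k * (normc (B p.2) * wtker (p.1 - p.2)).
have mG : measurable_fun setT G.
  apply: measurable_funM; first exact: measurable_cst.
  apply: measurable_funM; first exact: (measurableT_comp mnB).
  by apply: (measurableT_comp measurable_wtker); apply: measurable_funB_rV.
have G0 p : (0 <= (G p)%:E)%E by rewrite lee_fin !mulr_ge0 ?normc_ge0 ?wtker_ge0.
have iphi (c : R) w : mu.-integrable setT (EFin \o (fun s => c * (normc (B s) * wtker (w - s)))).
  apply: real_integrableZ; apply: (le_real_integrable _ (cintegrable_normc iB)) => [|s].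
    apply: measurable_funM; first exact: mnB.
    by apply: (measurableT_comp measurable_wtker); apply: measurable_funB_rV.
  by rewrite ger0_norm ?mulr_ge0 ?normc_ge0 ?wtker_ge0// ler_piMr ?normc_ge0 ?wtker_le1.
have iFB : cintegrable mu (fun y => A y * fourier hbar B (- y)).
  have mFB : cmeasurable (fun y => fourier hbar B (- y)).
    apply: (cmeasurable_comp (fourier_cmeasurable hbar iB)).
    rewrite (_ : -%R = fun y : V => -1 *: y); last by apply/funext => y; rewrite scaleN1r.
    exact: measurable_funZ_rV.
  under eq_fun do rewrite mulrC.
  by apply: (cintegrableMl mFB (fun y => fourier_bound hbar (- y) iB) iA).
have le w : ((normc (fourier hbar (fun y => A y * fourier hbar B (- y)) w))%:E <=
    \int[mu]_s (G (w, s))%:E)%E.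
  rewrite -EFin_Rintegral; last exact: iphi.
  have iker : mu.-integrable setT (EFin \o (fun s => normc (B s) * wtker (w - s))).
    by have := iphi 1 w; congr (integrable _ _ _); apply/funext => s /=; rewrite mul1r.
  have -> : \int[mu]_s G (w, s) = k * \int[mu]_s (normc (B s) * wtker (w - s)).
    by rewrite -RintegralZl.
  rewrite lee_fin fourier_mul// Normc.normcM /k -mulrA ler_wpM2l ?normc_ge0//.
  rewrite -RintegralZl//.
  apply: le_normc_cintegral (iphi D w) _ => [|s].
    under eq_fun do rewrite mulrC.
    apply: (@cintegrableMl _ _ _ _ _ D) iB.
      by apply: (cmeasurable_comp mFA); apply: measurable_funB_rV.
    by move=> s; apply: le_trans (hD _) _; rewrite ler_piMr// wtker_le1.
  by rewrite Normc.normcM mulrCA ler_wpM2l ?normc_ge0.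
apply: (@le_trans _ _ (\int[mu]_w \int[mu]_s (G (w, s))%:E)%E).
  apply: ge0_le_integral => //.
  - by move=> w _; rewrite lee_fin normc_ge0.
  - by apply/measurable_EFinP; apply: measurable_normc; exact: fourier_cmeasurable.
  - apply: (@measurable_fun_fubini_tonelli_F _ _ _ _ _ mu (EFin \o G)) => //.
    exact/measurable_EFinP.
(* With the integral over [w] taken first, the translated kernel contributes [wtmass] whatever [s]
   is. *)
rewrite (fubini_tonelli (EFin \o G)) => //=; last exact/measurable_EFinP.
have -> : (\int[mu]_s \int[mu]_w (G (w, s))%:E = (k * wtmass)%:E * \int[mu]_s (normc (B s))%:E)%E.
  rewrite -ge0_integralZl_real ?mulr_ge0 ?wtmass_ge0//; last by move=> s; exact: normc_ge0.
  apply: eq_integral => s _; rewrite mulrAC EFinM -(wtker_translate (- s)).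
  rewrite -ge0_integralZl_real ?mulr_ge0 ?normc_ge0//.
  - by apply: eq_integral => w _; rewrite /G /= mulrA.
  - by move=> w; exact: wtker_ge0.
  - by apply: (measurableT_comp measurable_wtker); apply: measurable_funD_rV.
  exact: normc_ge0.
by rewrite [leRHS]EFinM lee_wpmul2l// lee_fin mulr_ge0 ?wtmass_ge0.
Qed.

(** For fixed [p.1] the integral of the modulus over [p.2] is |A (p.1)| times the L^1 norm of [B],
    by reflection and translation. *)
Lemma cintegrable_convolution A B : cintegrable mu A -> cintegrable mu B ->
  cintegrable (mu \x mu)%E (fun p : V * V => A p.1 * B (p.1 - p.2)).
Proof.
move=> iA iB; have mA := cintegrable_measurable iA; have mB := cintegrable_measurable iB.
apply: cintegrable_prod12.
  apply: cmeasurableM; first exact: (cmeasurable_comp mA).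
  by apply: (cmeasurable_comp mB); exact: measurable_funB_rV.
have inB := cintegrable_normc iB.
have N1 : -1 != 0 :> R by rewrite oppr_eq0 oner_eq0.
have e y : (\int[mu]_x (normc (A y * B (y - x)))%:E =
    (\int[mu]_x normc (B x))%:E * (normc (A y))%:E)%E.
  rewrite EFin_Rintegral// muleC.
  have := @ge0_integral_affine R d (-1) y (fun x => (normc (B x))%:E) N1.
  rewrite normrN normr1 expr1n invr1 mul1e => <-.
  - rewrite -ge0_integralZl_EFin ?normc_ge0//.
    + by apply: eq_integral => x _; rewrite Normc.normcM EFinM scaleN1r [- x + y]addrC.
    + by move=> x _; rewrite lee_fin normc_ge0.
    + apply/measurable_EFinP; apply: (measurableT_comp (measurable_normc mB)).
      apply: measurable_funD_rV; last exact: measurable_cst.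
      exact: measurable_funZ_rV.
  - by apply/measurable_EFinP; exact: measurable_normc.
  - by move=> x; rewrite lee_fin normc_ge0.
rewrite /=; under eq_integral do rewrite e.
have I0 : 0 <= \int[mu]_x normc (B x) by apply: Rintegral_ge0 => x _; exact: normc_ge0.
rewrite ge0_integralZl_EFin//; last 2 first.
- by move=> x _; rewrite lee_fin normc_ge0.
- by apply/measurable_EFinP; exact: measurable_normc.
have /cintegrableP[_ foo] := iA.
by rewrite lte_mul_pinfty.
Qed.

Lemma bounded_schwartz_integrable f (M : R) g : cmeasurable f -> (forall x, normc (f x) <= M) ->
  schwartz g -> cintegrable mu (fun x => f x * g x).
Proof. by move=> mf hM hg; apply: (cintegrableMl mf hM); exact: schwartz_integrable. Qed.

(* With [a_x y = f y * conj (g0 (y - x))] one has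
   |g0|^2 * f * G(. + xi) = integral over x of (G(. + xi) * g0(. - x)) * a_x,
   and the Fourier transform of each integrand is a convolution with that of [a_x]. *)
Lemma window_change f (Mf : R) g0 G (M0 : R) : ccontinuous f ->
  (forall x, normc (f x) <= Mf) -> schwartz g0 -> (exists y, g0 y != 0) -> schwartz G ->
  (forall x, (\int[mu]_s (normc (fourier hbar (fun y => f y * conjc (g0 (y - x))) s))%:E
    <= M0%:E)%E) ->
  exists M : R, forall xi,
    (\int[mu]_w (normc (fourier hbar (fun y => f (y - xi) * G y) w))%:E <= M%:E)%E.
Proof.
move=> cf hMf hg0 [y0 g0y0] hG hM0.
have mf := ccontinuous_cmeasurable cf.
have mg0 := schwartz_cmeasurable hg0.
have mG := schwartz_cmeasurable hG.
pose k y := conjc (g0 y) * g0 y.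
have [Mg _ hMg] := decays_bounded (schwartz_decays hg0).
have hcg0 := schwartz_conj hg0.
have hMcg y : normc (conjc (g0 y)) <= Mg by rewrite normc_conj.
have ik : cintegrable mu k.
  exact: (bounded_schwartz_integrable (schwartz_cmeasurable hcg0) hMcg).
pose N0 := cintegral mu k.
(* [k] is |g0|^2, continuous and nonnegative: a vanishing integral would force it to vanish at
   [y0]. *)
have N00 : 0 < normc N0.
  rewrite normc_gt0; apply: contra_neq g0y0 => N0E.
  have kE y : k y = (normc (k y))%:C.
    by rewrite /k mulrC mulc_conj normc_real ger0_norm// sqr_ge0.
  have ck : ccontinuous k.
    by apply: ccontinuousM; exact: schwartz_ccontinuous.
  have hMk y : normc (k y) <= Mg * Mg.
    by rewrite Normc.normcM ler_pM ?normc_ge0.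
  have : k y0 = 0.
    apply: (ccontinuous_integral_eq0 hbar_gt0 y0 ck hMk ik).
    have : cintegral mu (fun y => (normc (k y))%:C) = 0 by rewrite -(funext kE).
    by rewrite cintegral_real => /(congr1 (@complex.Re R)).
  rewrite /k mulrC mulc_conj => /(congr1 (@complex.Re R)) /= /eqP.
  by rewrite expf_eq0 => /andP[_ /eqP]; exact: Normc.eq0_normc.
have [C C0 hC] := fourier_mul_shift_decay hbar_gt0 (2 * d) hG hg0.
pose K := normc cn * C * wtmass * M0.
have M00 : 0 <= M0.
  by rewrite -lee_fin; apply: le_trans (hM0 0); apply: integral_ge0 => s _;
    rewrite lee_fin normc_ge0.
have K0 : 0 <= K by rewrite !mulr_ge0 ?normc_ge0 ?wtmass_ge0.
exists (K * wtmass / normc N0) => xi.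
pose H y := f y * G (y + xi).
have hGxi : schwartz (fun y => G (y - - xi)) by exact: schwartz_shift.
have GE : (fun y => G (y - - xi)) = (fun y => G (y + xi)) by apply/funext => y; rewrite opprK.
rewrite GE in hGxi.
have iH : cintegrable mu H by exact: (bounded_schwartz_integrable mf hMf hGxi).
pose A x y := G (y + xi) * g0 (y - x).
pose a x y := f y * conjc (g0 (y - x)).
have hcg0x x : schwartz (fun y => conjc (g0 (y - x))).
  exact: (schwartz_shift x hcg0).
have ia x : cintegrable mu (a x) by exact: (bounded_schwartz_integrable mf hMf (hcg0x x)).
have iVa x : cintegrable mu (fourier hbar (a x)).
  apply/cintegrableP; split; first exact: fourier_cmeasurable.
  exact: le_lt_trans (hM0 x) (ltry _).
have inva x y : fourier hbar (fourier hbar (a x)) (- y) = a x y.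
  apply: (@fourier_inversion _ _ _ hbar_gt0 _ (Mf * Mg)) => //.
  - by apply: ccontinuousM => //; exact/schwartz_ccontinuous.
  - by move=> z; rewrite Normc.normcM ler_pM ?normc_ge0.
have hg0x x : schwartz (fun y => g0 (y - x)) by exact: schwartz_shift.
have iA x : cintegrable mu (A x).
  have -> : A x = fun y => g0 (y - x) * G (y + xi) by apply/funext => y; exact: mulrC.
  apply: (@bounded_schwartz_integrable _ Mg) hGxi; last by [].
  exact: schwartz_cmeasurable.
(* Up to a translation by [xi], which only changes the phase of the transform, [A x] is the product
   of [G] with [g0] centred at [x + xi]. Hence the decay in [x + xi], with a constant free of
   [xi]. *)
have bA x w : normc (fourier hbar (A x) w) <= C * wtker (x + xi) * wtker w.
  pose A0 y := G y * g0 (y - (x + xi)).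
  have iA0 : cintegrable mu A0.
    have -> : A0 = fun y => g0 (y - (x + xi)) * G y by apply/funext => y; exact: mulrC.
    apply: (@bounded_schwartz_integrable _ Mg) hG; last by [].
    by apply: schwartz_cmeasurable; exact: schwartz_shift.
  have -> : A x = fun y => A0 (y - - xi).
    apply/funext => y; rewrite /A0 /A opprK; congr (_ * g0 _).
    by rewrite opprD addrACA subrr addr0.
  rewrite fourier_shift// Normc.normcM normc_expi mul1r; exact: hC.
pose T x w := fourier hbar (fun y => A x y * a x y) w.
have TE x w : T x w = cn * cintegral mu (fun y => expi (- (dot w y / hbar)) * H y * k (y - x)).
  rewrite /T {1}/fourier; apply: (congr1 (fun w : R[i] => cn * w)).
  by apply: eq_cintegral => y; rewrite /A /a /H /k; ring.
(* Inversion recovers [a x] from its transform, whose L^1 norm is at most [M0] for every [x]. The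
   bound obtained is integrable in [x], and its integral does not depend on [xi]. *)
have TL1 x : (\int[mu]_w (normc (T x w))%:E <= (K * wtker (x + xi))%:E)%E.
  have := @fourier_mul_L1 (A x) (fourier hbar (a x)) (C * wtker (x + xi)) M0 (iA x) (iVa x)
    (mulr_ge0 C0 (wtker_ge0 _)) (bA x) (hM0 x).
  have -> : (fun y => A x y * fourier hbar (fourier hbar (a x)) (- y)) = (fun y => A x y * a x y).
    by apply/funext => y; rewrite inva.
  by rewrite /K; congr (_ <= _%:E)%E; ring.
(* In [T] the two windows combine into [k (y - x)]; integrating over [x] replaces it by its mass
   [N0] and leaves the transform of [H]. *)
have fubT w : cintegrable mu (T ^~ w) /\
    cintegral mu (T ^~ w) = N0 * fourier hbar H w.
  have iEH := fourier_integrable hbar w iH.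
  have ic := cintegrable_convolution iEH ik.
  have i1 y : cintegrable mu (fun x => expi (- (dot w y / hbar)) * H y * k (y - x)).
    by apply: cintegrableZ; have [] := cintegral_reflect y ik.
  have i2 x : cintegrable mu (fun y => expi (- (dot w y / hbar)) * H y * k (y - x)).
    under eq_fun do rewrite mulrC.
    apply: (@cintegrableMl _ _ _ _ _ (Mg * Mg)) iEH.
      apply: (cmeasurable_comp (cintegrable_measurable ik)).
      by apply: measurable_funB_rV => //; exact: measurable_cst.
    by move=> y; rewrite Normc.normcM ler_pM ?normc_ge0.
  have [iJ eJ] := cfubini21 ic i2.
  have [_ eI] := cfubini12 ic i1.
  rewrite (funext (TE ^~ w)); split; first exact: cintegrableZ.
  rewrite cintegralZ// /fourier mulrCA; apply: (congr1 (fun w : R[i] => cn * w)).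
  rewrite eJ -eI -cintegralZ//; apply: eq_cintegral => y /=.
  have [ir er] := cintegral_reflect y ik.
  by rewrite [LHS](cintegralZ _ ir) er mulrC.
have mT : cmeasurable (fun p : V * V => T p.1 p.2).
  apply: cmeasurableM; first exact: cmeasurable_cst.
  apply: (@cmeasurable_cintegral2 _ _ _ _ R mu (fun q : (V * V) * V =>
    expi (- (dot q.1.2 q.2 / hbar)) * (A q.1.1 q.2 * a q.1.1 q.2))).
  have m1 : measurable_fun setT (fun q : (V * V) * V => q.1.1) by exact: measurableT_comp.
  have m2 : measurable_fun setT (fun q : (V * V) * V => q.1.2) by exact: measurableT_comp.
  have m3 : measurable_fun setT (fun q : (V * V) * V => q.2) by exact: measurable_snd.
  have md : measurable_fun setT (fun q : (V * V) * V => q.2 - q.1.1) by exact: measurable_funB_rV.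
  have mxi : measurable_fun setT (fun q : (V * V) * V => q.2 + xi).
    by apply: measurable_funD_rV => //; exact: measurable_cst.
  apply: cmeasurableM.
    apply: cmeasurable_expi; apply: measurable_funN; apply: measurable_funM;
      last exact: measurable_cst.
    exact: measurable_fun_dot.
  apply: cmeasurableM; apply: cmeasurableM.
  - exact: (cmeasurable_comp mG mxi).
  - exact: (cmeasurable_comp mg0 md).
  - exact: (cmeasurable_comp mf m3).
  - apply: cmeasurable_conj; exact: (cmeasurable_comp mg0 md).
pose nT (p : V * V) : \bar R := (normc (T p.1 p.2))%:E.
have mnT : measurable_fun setT nT by by apply/measurable_EFinP; exact: measurable_normc.
have nT0 p : (0 <= nT p)%E by rewrite lee_fin normc_ge0.
have le1 q : ((normc N0 * normc (fourier hbar H q))%:E <= \int[mu]_x nT (x, q))%E.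
  have [iT eT] := fubT q.
  by rewrite -Normc.normcM -eT; exact: normc_cintegralE.
have mFH := measurable_normc (fourier_cmeasurable hbar iH).
have le2 : (\int[mu]_w (normc N0 * normc (fourier hbar H w))%:E <= (K * wtmass)%:E)%E.
  apply: (@le_trans _ _ (\int[mu]_w \int[mu]_x nT (x, w))%E).
    apply: ge0_le_integral => //.
    - by move=> w _; rewrite lee_fin mulr_ge0 ?normc_ge0.
    - apply/measurable_EFinP; apply: measurable_funM => //; exact: measurable_cst.
    - exact: (@measurable_fun_fubini_tonelli_G _ _ _ _ _ mu nT).
  rewrite -(fubini_tonelli nT)//.
  apply: (@le_trans _ _ (\int[mu]_x (K * wtker (x + xi))%:E)%E).
    apply: ge0_le_integral => //.
    - by move=> x _; apply: integral_ge0.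
    - exact: (@measurable_fun_fubini_tonelli_F _ _ _ _ _ mu nT).
    - apply/measurable_EFinP; apply: measurable_funM; first exact: measurable_cst.
      by apply: (measurableT_comp measurable_wtker); apply: measurable_funD_rV.
    - by move=> x _; exact: TL1.
  rewrite ge0_integralZl_real//.
  - by rewrite wtker_translate -EFinM.
  - by move=> x; exact: wtker_ge0.
  - by apply: (measurableT_comp measurable_wtker); apply: measurable_funD_rV.
(* The function of the statement is [H] translated by [xi], so the two transforms have the same
   modulus. *)
have eF q : normc (fourier hbar (fun y => f (y - xi) * G y) q) = normc (fourier hbar H q).
  have -> : (fun y => f (y - xi) * G y) = fun y => H (y - xi).
    by apply/funext => y; rewrite /H subrK.
  by rewrite fourier_shift// Normc.normcM normc_expi mul1r.
under eq_integral do rewrite eF.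
move: le2; rewrite ge0_integralZl_real ?normc_ge0//; last by move=> w; exact: normc_ge0.
by move=> le2; rewrite EFinM lee_pdivlMr// muleC.
Qed.

End window_change.

(** The integral of a nonnegative function is a supremum over the simple functions below it, and a
    larger function has more of them. *)
Lemma ge0_le_integral_nonmeasurable {R : realType} dT (T : measurableType dT)
    (m : {measure set T -> \bar R}) (a b : T -> \bar R) :
  (forall s, (0 <= a s)%E) -> (forall s, (a s <= b s)%E) ->
  (\int[m]_s a s <= \int[m]_s b s)%E.
Proof.
move=> a0 ab; rewrite !ge0_integralTE//; last by move=> s; exact: le_trans (ab s).
by apply: ereal_sup_le => _ [h ha <-]; exists h => // s; exact: le_trans (ab s).
Qed.

(** * The representation formula *)

Section representation.
Context {R : realType} {d : nat} (hbar : R) (hbar_gt0 : 0 < hbar).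
Local Notation V := 'rV[R]_d.
Local Notation mu := (lebesgue_rV d).
Local Notation cn := (normalization d hbar : R[i]).
Implicit Types (f g h gamma : V -> R[i]) (u : (V -> R[i]) -> R[i]) (x y z xi t : V).

Lemma cintegral_translate (a : V) f : cintegrable mu f ->
  cintegrable mu (fun x => f (x + a)) /\ cintegral mu (fun x => f (x + a)) = cintegral mu f.
Proof.
move=> fi; have [] := cintegral_affine a (oner_neq0 R) fi.
rewrite normr1 expr1n invr1 mul1r => i1 e1; rewrite -e1; split.
  by apply: eq_cintegrable i1 => y; rewrite scale1r.
by apply: eq_cintegral => y; rewrite scale1r.
Qed.

Lemma conj_tf_shift x xi g y : conjc (tf_shift hbar x xi g y) =
  cn * (expi (- (dot xi y / hbar)) * conjc (g (y - x))).
Proof. by rewrite /tf_shift !conjcM conj_expi conjc_real mulrA. Qed.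

Lemma schwartz_conj_tf_shift x xi g : schwartz g ->
  schwartz (fun y => conjc (tf_shift hbar x xi g y)).
Proof.
move=> hg; have := schwartz_expi cn (- (hbar^-1 *: xi)) (schwartz_shift x (schwartz_conj hg)).
congr schwartz; apply/funext => y; rewrite conj_tf_shift mulrA.
by rewrite dotNl dotZl [_ / hbar]mulrC.
Qed.

Lemma stft_identified u f g x xi : identified_with u f -> schwartz g ->
  stft hbar g u x xi = fourier hbar (fun y => f y * conjc (g (y - x))) xi.
Proof.
move=> [cf [M hM] uf] hg; rewrite /stft /pairing uf; last exact: schwartz_conj_tf_shift.
have ifg : cintegrable mu (fun y => f y * conjc (g (y - x))).
  apply: (bounded_schwartz_integrable (ccontinuous_cmeasurable cf) hM).
  exact: (schwartz_shift x (schwartz_conj hg)).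
rewrite /distr /fourier -cintegralZ; last exact: fourier_integrable.
by apply: eq_cintegral => y; rewrite conj_tf_shift; ring.
Qed.

(** The conjugated modulation adds [xi] to the frequency, and the translation by [x] becomes a phase
    at that new frequency. The same formula serves for [u^] tested on shifts of [g] and for plane
    waves tested on shifts of [gamma]. *)
Lemma fourier_conj_tf_shift g x xi y : schwartz g ->
  fourier hbar (fun z => conjc (tf_shift hbar x xi g z)) y =
  cn * (expi (- (dot (y + xi) x / hbar)) * fourier hbar (fun z => conjc (g z)) (y + xi)).
Proof.
move=> hg; have icg := schwartz_integrable (schwartz_conj hg).
rewrite -(fourier_shift hbar x (y + xi) icg).
have igs := schwartz_integrable (schwartz_shift x (schwartz_conj hg)).
rewrite {1}/fourier; apply: (congr1 (fun c : R[i] => cn * c)).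
rewrite /fourier -cintegralZ; last exact: fourier_integrable.
apply: eq_cintegral => z; rewrite conj_tf_shift dotDl mulrDl opprD expiD; ring.
Qed.

Lemma stft_fourier_distr u f g x xi : identified_with u f -> schwartz g ->
  stft hbar g (fourier_distr hbar u) x xi =
  fourier hbar (fun z => f (z - xi) * fourier hbar (fun y => conjc (g y)) z) x.
Proof.
move=> [cf [M hM] uf] hg; rewrite /stft /pairing /fourier_distr uf; last first.
  by apply: schwartz_fourier => //; exact: schwartz_conj_tf_shift.
set G := fourier hbar (fun y => conjc (g y)).
have hG : schwartz G by apply: schwartz_fourier => //; exact: schwartz_conj.
have mfx : cmeasurable (fun z => f (z - xi)).
  apply: (cmeasurable_comp (ccontinuous_cmeasurable cf)).
  by apply: measurable_funB_rV.
have ifG : cintegrable mu (fun z => f (z - xi) * G z).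
  by apply: (bounded_schwartz_integrable mfx _ hG) => z.
rewrite /distr [RHS]/fourier; have iE := fourier_integrable hbar x ifG.
(* Translating by [xi] moves the shift from [G] to [f], so that the Schwartz factor is the same for
   every [xi]. *)
have [_ <-] := cintegral_translate xi iE.
have [iEx _] := cintegral_translate xi iE.
rewrite -cintegralZ//; apply: eq_cintegral => y.
by rewrite (fourier_conj_tf_shift x xi y hg) addrK (dotC x) -/G; ring.
Qed.

Lemma conj_plane_wave t y : conjc (plane_wave hbar t y) = plane_wave hbar (- t) y.
Proof. by rewrite /plane_wave conjcM conjc_real conj_expi dotNl mulNr. Qed.

(** Integrating against the plane wave of frequency [- t] is evaluating the Fourier transform at
    [t]. *)
Lemma stft_plane_wave gamma t x xi : schwartz gamma ->
  stft hbar gamma (distr (plane_wave hbar (- t))) x xi =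
  cn * (expi (- (dot (t + xi) x / hbar)) *
    fourier hbar (fun y => conjc (gamma y)) (t + xi)).
Proof.
move=> hg; rewrite -(fourier_conj_tf_shift x xi t hg) /stft /pairing /distr /fourier.
have ig := schwartz_integrable (schwartz_conj_tf_shift x xi hg).
rewrite -cintegralZ; last exact: fourier_integrable.
by apply: eq_cintegral => y; rewrite /plane_wave dotNl mulNr mulrA.
Qed.

Lemma stft_conj_plane_wave gamma t x xi : schwartz gamma ->
  stft_conj hbar gamma (distr (plane_wave hbar t)) x xi =
  conjc (stft hbar gamma (distr (plane_wave hbar (- t))) x xi).
Proof.
move=> hg; rewrite /stft_conj; apply: (congr1 (@conjc R)).
rewrite /stft /pairing /distr_conj /distr.
have ig := schwartz_integrable (schwartz_conj (schwartz_conj_tf_shift x xi hg)).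
rewrite -cintegral_conj.
  by apply: eq_cintegral => y; rewrite conjcM conj_plane_wave conjcK.
apply: (@cintegrableMl _ _ _ _ _ (normc cn)) ig.
  apply: cmeasurableM; first exact: cmeasurable_cst.
  apply: cmeasurable_expi; apply: measurable_funM; last exact: measurable_cst.
  by apply: measurable_fun_dot => //; exact: measurable_cst.
by move=> y; rewrite Normc.normcM normc_expi mulr1.
Qed.

Lemma fourier_reflect h xi : cintegrable mu h ->
  fourier hbar (fun x => h (- x)) xi = fourier hbar h (- xi).
Proof.
move=> ih; rewrite /fourier; apply: (congr1 (fun c : R[i] => cn * c)).
have [_ <-] := cintegral_reflect 0 (fourier_integrable hbar (- xi) ih).
by apply: eq_cintegral => x; rewrite sub0r dotNl dotNr opprK.
Qed.

Lemma conj_fourier h xi : cintegrable mu h ->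
  conjc (fourier hbar (fun x => conjc (h x)) xi) = fourier hbar h (- xi).
Proof.
move=> ih; rewrite /fourier conjcM conjc_real; apply: (congr1 (fun c : R[i] => cn * c)).
rewrite -cintegral_conj; last by apply: fourier_integrable; exact: cintegrable_conj.
by apply: eq_cintegral => x; rewrite conjcM conj_expi conjcK dotNl mulNr.
Qed.

(** The conjugate of the transform of conj gamma is the reflected transform of [gamma]. The
    multiplication formula moves the other transform onto it, and inversion gives back [gamma]. *)
Lemma fourier_parseval g gamma : schwartz g -> schwartz gamma ->
  cintegral mu (fun z => fourier hbar (fun y => conjc (g y)) z *
    conjc (fourier hbar (fun y => conjc (gamma y)) z)) = inner gamma g.
Proof.
move=> hg hgamma; have igamma := schwartz_integrable hgamma.
have icg := schwartz_integrable (schwartz_conj hg).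
have iF := schwartz_integrable (schwartz_fourier hbar_gt0 hgamma).
have [iA _] := cintegral_reflect 0 iF.
have iA' : cintegrable mu (fun z => fourier hbar gamma (- z)).
  by apply: eq_cintegrable iA => z; rewrite sub0r.
transitivity (cintegral mu (fun z => fourier hbar gamma (- z) *
    fourier hbar (fun y => conjc (g y)) z)).
  by apply: eq_cintegral => z; rewrite conj_fourier// mulrC.
rewrite (fourier_multiplication hbar iA' icg); apply: eq_cintegral => y.
by rewrite (fourier_reflect y iF) (schwartz_inversion hbar_gt0).
Qed.

Lemma inner_conj f g : cintegrable mu (fun y => f y * conjc (g y)) ->
  inner g f = conjc (inner f g).
Proof.
move=> ifg; rewrite /inner -cintegral_conj//.
by apply: eq_cintegral => y; rewrite conjcM conjcK mulrC.
Qed.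

(** The integral of the supremum dominates the integral at each [x]. Only this weaker bound, uniform
    in [x], is needed for the change of window. *)
Lemma modulation_stft_bound u f : modulation_oo1 hbar u -> identified_with u f ->
  exists g0, [/\ schwartz g0, (exists y, g0 y != 0) & exists M0 : R, forall x,
    (\int[mu]_s (normc (fourier hbar (fun y => f y * conjc (g0 (y - x))) s))%:E
      <= M0%:E)%E].
Proof.
move=> [_ [g0 [hg0 g0n0 foo]]] huf; exists g0; split=> //.
set S := (\int[mu]_s _)%E in foo.
have leS x :
    (\int[mu]_s (normc (fourier hbar (fun y => f y * conjc (g0 (y - x))) s))%:E <= S)%E.
  apply: ge0_le_integral_nonmeasurable => s; first by rewrite lee_fin normc_ge0.
  by apply: ereal_sup_ubound; exists x => //; rewrite (stft_identified _ _ huf).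
have S0 : (0 <= S)%E.
  by apply: le_trans (leS 0); apply: integral_ge0 => s _; rewrite lee_fin normc_ge0.
by exists (fine S) => x; rewrite fineK ?ge0_fin_numE.
Qed.

End representation.

(** * Integrability and evaluation of the double integral *)

Section main.
Context {R : realType} {d : nat} (hbar : R) (hbar_gt0 : 0 < hbar).
Local Notation V := 'rV[R]_d.
Local Notation mu := (lebesgue_rV d).
Local Notation cn := (normalization d hbar : R[i]).
Implicit Types (f g gamma : V -> R[i]) (t : V).

(** [F] is the integrand of the representation formula once [stft_fourier_distr] and
    [stft_plane_wave] have made both factors explicit. *)
Lemma fourier_window_fubini f (Mf M : R) (G D : V -> R[i]) t : ccontinuous f ->
  (forall x, normc (f x) <= Mf) -> schwartz G -> schwartz D ->
  (forall xi, (\int[mu]_w (normc (fourier hbar (fun y => f (y - xi) * G y) w))%:E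
    <= M%:E)%E) ->
  let F := fun z : V * V => fourier hbar (fun y => f (y - z.2) * G y) z.1 *
    conjc (cn * (expi (- (dot (t + z.2) z.1 / hbar)) * D (t + z.2))) in
  cintegrable (mu \x mu)%E F /\
  cintegral (mu \x mu)%E F = f t * cintegral mu (fun z => G z * conjc (D z)).
Proof.
move=> cf hMf hG hD hM F.
have mf := ccontinuous_cmeasurable cf.
have mG := schwartz_cmeasurable hG.
have mD := schwartz_cmeasurable hD.
have mfx (p : V) : cmeasurable (fun z : V => f (z - p)).
  by apply: (cmeasurable_comp mf); exact: measurable_funB_rV.
have ih (p : V) : cintegrable mu (fun y => f (y - p) * G y).
  by apply: (bounded_schwartz_integrable (mfx p) _ hG) => z.
have iFh (p : V) : cintegrable mu (fourier hbar (fun y => f (y - p) * G y)).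
  apply/cintegrableP; split; first exact: fourier_cmeasurable.
  exact: le_lt_trans (hM p) (ltry _).
have mFh : cmeasurable (fun z : V * V => fourier hbar (fun y => f (y - z.2) * G y) z.1).
  apply: cmeasurableM; first exact: cmeasurable_cst.
  apply: (@cmeasurable_cintegral2 _ _ _ _ R mu (fun q : (V * V) * V =>
    expi (- (dot q.1.1 q.2 / hbar)) * (f (q.2 - q.1.2) * G q.2))).
  have m1 : measurable_fun setT (fun q : (V * V) * V => q.1.1) by exact: measurableT_comp.
  have m2 : measurable_fun setT (fun q : (V * V) * V => q.1.2) by exact: measurableT_comp.
  have m3 : measurable_fun setT (fun q : (V * V) * V => q.2) by exact: measurable_snd.
  apply: cmeasurableM.
    apply: cmeasurable_expi; apply: measurable_funN; apply: measurable_funM;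
      last exact: measurable_cst.
    exact: measurable_fun_dot.
  apply: cmeasurableM; last exact: (cmeasurable_comp mG).
  by apply: (cmeasurable_comp mf); exact: measurable_funB_rV.
have mt2 : measurable_fun setT (fun z : V * V => t + z.2).
  by apply: measurable_funD_rV; [exact: measurable_cst|exact: measurable_snd].
have mF : cmeasurable F.
  apply: cmeasurableM => //; apply: cmeasurable_conj.
  apply: cmeasurableM; first exact: cmeasurable_cst.
  apply: cmeasurableM; last exact: (cmeasurable_comp mD).
  apply: cmeasurable_expi; apply: measurable_funN; apply: measurable_funM;
    last exact: measurable_cst.
  by apply: measurable_fun_dot => //; exact: measurable_fst.
have nF (p q : V) : normc (F (p, q)) =
    normc cn * normc (D (t + q)) * normc (fourier hbar (fun y => f (y - q) * G y) p).
  by rewrite /F 1!Normc.normcM normc_conj !Normc.normcM normc_expi mul1r mulrC.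
have [iDt _] := cintegral_translate t (schwartz_integrable hD).
have eD (q : V) : D (q + t) = D (t + q) by rewrite addrC.
have iD' : cintegrable mu (fun q => D (t + q)) by exact: eq_cintegrable eD iDt.
have M0 : 0 <= M.
  by rewrite -lee_fin; apply: le_trans (hM 0); apply: integral_ge0 => s _;
    rewrite lee_fin normc_ge0.
have iF : cintegrable (mu \x mu)%E F.
  (* In this order the integral over the first variable is at most [M] times the modulus of
     [cn * D (t + q)], which is integrable in [q]. *)
  apply: cintegrable_prod21 => //.
  pose nT (p : V * V) : \bar R := (normc (F p))%:E.
  have mnT : measurable_fun setT nT by apply/measurable_EFinP; exact: measurable_normc.
  have nT0 p : (0 <= nT p)%E by rewrite lee_fin normc_ge0.
  have iN := real_integrableZ (M * normc cn) (cintegrable_normc iD').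
  apply: (@le_lt_trans _ _ (\int[mu]_q (M * normc cn * normc (D (t + q)))%:E)%E).
    apply: ge0_le_integral => //.
    - by move=> q _; apply: integral_ge0 => p _; exact: nT0.
    - exact: (@measurable_fun_fubini_tonelli_G _ _ _ _ _ mu nT).
    - exact: (measurable_int _ iN).
    - move=> q _; under eq_integral do rewrite nF.
      rewrite ge0_integralZl_real.
      + rewrite -mulrA [leRHS]EFinM muleC lee_wpmul2r// lee_fin mulr_ge0 ?normc_ge0//.
      + by rewrite mulr_ge0 ?normc_ge0.
      + by move=> p; exact: normc_ge0.
      + by apply: measurable_normc; exact: fourier_cmeasurable.
  rewrite -EFin_Rintegral ?ltry//.
split=> //.
have inner_int (q : V) : cintegrable mu (fun p => F (p, q)) /\
    cintegral mu (fun p => F (p, q)) = f t * (G (t + q) * conjc (D (t + q))).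
  have iE := fourier_integrable hbar (- (t + q)) (iFh q).
  have FE (p : V) : F (p, q) = cn * conjc (D (t + q)) *
      (expi (- (dot (- (t + q)) p / hbar)) * fourier hbar (fun y => f (y - q) * G y) p).
    rewrite /F /= !conjcM conjc_real conj_expi dotNl mulNr.
    move: (fourier _ _ _) => c; ring.
  rewrite (funext FE); split; first exact: cintegrableZ.
  rewrite cintegralZ// mulrAC.
  (* The factor [cn] coming from the plane wave is the normalization of the outer transform, so the
     inner integral is by definition a double Fourier transform at [- (t + q)]. Inversion evaluates
     [f (. - q) * G] at [t + q], where the shift by [q] cancels. *)
  transitivity (fourier hbar (fourier hbar (fun y => f (y - q) * G y)) (- (t + q)) *
    conjc (D (t + q))).
    by [].
  have [MG _ hMG] := decays_bounded (schwartz_decays hG).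
  rewrite (@fourier_inversion _ _ _ hbar_gt0 _ (Mf * MG))//.
  - by rewrite addrK mulrA.
  - apply: ccontinuousM; last exact: schwartz_ccontinuous.
    exact: ccontinuous_shift.
  - by move=> y; rewrite Normc.normcM ler_pM ?normc_ge0.
have iF2 (q : V) : cintegrable mu (fun p => F (p, q)) by have [] := inner_int q.
have [_ <-] := cfubini21 iF iF2.
have iGD : cintegrable mu (fun z => G z * conjc (D z)).
  have [MG _ hMG] := decays_bounded (schwartz_decays hG).
  exact: (bounded_schwartz_integrable mG hMG (schwartz_conj hD)).
have [iGDt eGD] := cintegral_translate t iGD.
rewrite -eGD -cintegralZ//; apply: eq_cintegral => q.
by have [_ ->] := inner_int q; rewrite addrC.
Qed.

End main.

Local Close Scope classical_set_scope.

Theorem lemma6p5 (R : realType) (d : nat) (hd : (0 < d)%N)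
  (hbar : R) (hbar_gt0 : 0 < hbar) (hbar_le1 : hbar <= 1)
  (u : ('rV[R]_d -> R[i]) -> R[i]) (hu : modulation_oo1 hbar u)
  (f : 'rV[R]_d -> R[i]) (huf : identified_with u f)
  (g gamma : 'rV[R]_d -> R[i]) (hg : schwartz g) (hgamma : schwartz gamma)
  (hggamma : inner g gamma != 0) (t : 'rV[R]_d) :
  let mu := (lebesgue_rV d \x lebesgue_rV d)%E in
  let F1 := fun z : 'rV[R]_d * 'rV[R]_d =>
    stft hbar g (fourier_distr hbar u) z.1 z.2 *
    conjc (stft hbar gamma (distr (plane_wave hbar (- t))) z.1 z.2) in
  let F2 := fun z : 'rV[R]_d * 'rV[R]_d =>
    stft hbar g (fourier_distr hbar u) z.1 z.2 *
    stft_conj hbar gamma (distr (plane_wave hbar t)) z.1 z.2 in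
  [/\ cintegrable mu F1, cintegrable mu F2,
      f t = (inner gamma g)^-1 * cintegral mu F1 &
      (inner gamma g)^-1 * cintegral mu F1 =
      (inner gamma g)^-1 * cintegral mu F2].
Proof.
move=> mu F1 F2.
have F21 : F2 = F1 by apply/funext => z; rewrite /F2 stft_conj_plane_wave.
have [g0 [hg0 g0n0 [M0 hM0]]] := modulation_stft_bound hu huf.
have [cf [Mf hMf] _] := huf.
pose G := fourier hbar (fun y => conjc (g y)).
pose D := fourier hbar (fun y => conjc (gamma y)).
have hG : schwartz G by apply: schwartz_fourier => //; exact: schwartz_conj.
have hD : schwartz D by apply: schwartz_fourier => //; exact: schwartz_conj.
have [M hM] := window_change hbar_gt0 cf hMf hg0 g0n0 hG hM0.
have [iF eF] := fourier_window_fubini hbar_gt0 t cf hMf hG hD hM.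
have F1E : (fun z : 'rV[R]_d * 'rV[R]_d => fourier hbar (fun y => f (y - z.2) * G y) z.1 *
    conjc (normalization d hbar * (expi (- (dot (t + z.2) z.1 / hbar)) * D (t + z.2)))) = F1.
  by apply/funext => z; rewrite /F1 (stft_fourier_distr _ _ _ huf)// stft_plane_wave.
rewrite F1E in iF eF; rewrite F21; split=> //.
have [Mg _ hMg] := decays_bounded (schwartz_decays hg).
have igg := bounded_schwartz_integrable (schwartz_cmeasurable hg) hMg (schwartz_conj hgamma).
(* The hypothesis is on <g, gamma>, while the formula divides by its conjugate. *)
have n0 : inner gamma g != 0.
  rewrite (inner_conj igg); apply: contra_neq hggamma => /(congr1 conjc).
  by rewrite conjcK conjc0.
by rewrite eF (fourier_parseval hbar_gt0)// mulrC mulfK.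
Qed.
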